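(* Let $\Omega\subset\mathbb{R}^2$ satisfy one of the following two sets of assumptions. (i) $\Omega$ is a convex, bounded domain, symmetric with respect to the $y$-axis, and there are $a>0$ and concave, even functions $p,-q:(-a,a)\to\mathbb{R}$ such that $\Omega=\{(x,y)\in\mathbb{R}^2:\ -a<x<a,\ q(x)<y<p(x)\}$. (ii) $\Omega$ is a $C^2$, convex, unbounded domain, symmetric with respect to the $y$-axis, satisfying a uniform interior sphere condition, and there are $a\in(0,+\infty]$ and a concave, even, $C^2$ function $p:(-a,a)\to\mathbb{R}$ such that $\Omega=\{(x,y)\in\mathbb{R}^2:\ -a<x<a,\ y<p(x)\}$. Let $S_a=\{(x,y)\in\mathbb{R}^2:\ |x|<a\}$. If $\mu_1(\Omega)=\mu_1^{odd}(\Omega)$, then $$\mu_1(\Omega)-\mu_1(S_a)=\mu_1(\Omega)-1\ \ge\ \lambda_1(-a,a).$$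
   Context: Gaussian measure: $d\gamma_x=\frac{1}{\sqrt{2\pi}}e^{-x^2/2}\,dx$ on $\mathbb{R}$, and $d\gamma_2=d\gamma_x\otimes d\gamma_y=\frac{1}{2\pi}e^{-(x^2+y^2)/2}\,dx\,dy$ on $\mathbb{R}^2$. Uniform interior sphere condition: there is $r>0$ such that for every $P\in\partial\Omega$ there is an open disk of radius $r$ contained in $\Omega$ whose boundary contains $P$. Neumann eigenvalue problem: for a (possibly unbounded) domain $\Omega\subset\mathbb{R}^2$ with outward normal $\nu$, consider $$-\mathrm{div}\left(e^{-\frac{x^2+y^2}{2}}\nabla u\right)=\mu\, e^{-\frac{x^2+y^2}{2}}u\ \text{ in }\Omega,\qquad \frac{\partial u}{\partial\nu}=0\ \text{ on }\partial\Omega,$$ understood in the weak sense: $u\in H^1(\Omega,d\gamma_2)$, $u\neq 0$, and $\int_\Omega \nabla u\cdot\nabla\varphi\,d\gamma_2=\mu\int_\Omega u\varphi\,d\gamma_2$ for all $\varphi\in H^1(\Omega,d\gamma_2)$. Here $H^1(\Omega,d\gamma_2)$ is the weighted Sobolev space of functions which, together with their weak first derivatives, belong to $L^2(\Omega,d\gamma_2)$. The lowest eigenvalue is $0$, with constant eigenfunctions. $\mu_1(\Omega)$ denotes the first nontrivial (i.e. smallest positive) eigenvalue of this problem. For $\Omega$ symmetric with respect to the $y$-axis, $\mu_1^{odd}(\Omega)$ is the lowest eigenvalue $\mu$ of this problem having a corresponding eigenfunction $u$ that is odd with respect to the $y$-axis, i.e. $u(-x,y)=-u(x,y)$. $\lambda_1(-a,a)$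 is the first Dirichlet eigenvalue of the one-dimensional Hermite operator $v\mapsto -v''+xv'$ in $(-a,a)$, that is, the minimum of $\int_{-a}^a (z')^2\,d\gamma_x\big/\int_{-a}^a z^2\,d\gamma_x$ over nonzero $z\in H^1_0((-a,a),d\gamma_x)$, where $H^1_0((-a,a),d\gamma_x)$ is the closure of $C_0^\infty(-a,a)$ in $H^1((-a,a),d\gamma_x)$. If $a=+\infty$, then $(-a,a)=\mathbb{R}$ and $S_a=\mathbb{R}^2$. *)

(* Defs.v *)
From HB Require Import structures.
From mathcomp Require Import all_boot all_order all_algebra.
From mathcomp Require Import all_classical all_reals all_analysis.

Set Implicit Arguments.
Unset Strict Implicit.
Unset Printing Implicit Defensive.

Import Order.TTheory GRing.Theory Num.Theory.
Import numFieldNormedType.Exports.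

Local Open Scope classical_set_scope.
Local Open Scope ring_scope.

Definition gauss1 (R : realType) : probability (measurableTypeR R) R :=
  normal_prob 0 1.

Definition gauss2 (R : realType) :
    {measure set (measurableTypeR R * measurableTypeR R) -> \bar R} :=
  (gauss1 R \x gauss1 R)%E.

Definition lebesgue2 (R : realType) :
    {measure set (measurableTypeR R * measurableTypeR R) -> \bar R} :=
  (lebesgue_measure \x lebesgue_measure)%E.

(* Class C^k on an open set U: all iterated directional derivatives up to
   order k exist and are continuous on U.  In finite dimension this is the
   usual class C^k. *)
Fixpoint Ck (R : realType) (V : normedModType R) (U : set V) (k : nat)
    (f : V -> R) : Prop :=
  {in U, continuous f} /\
  if k is k'.+1 then
    forall v, (forall z, U z -> derivable f z v) /\ Ck U k' ('D_v f)
  else True.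

Definition test_function (R : realType) (V : normedModType R) (U : set V)
    (phi : V -> R) : Prop :=
  [/\ forall k, Ck setT k phi,
      compact (closure [set z | phi z != 0]) &
      closure [set z | phi z != 0] `<=` U].

Definition L2 (R : realType) d (T : measurableType d)
    (m : {measure set T -> \bar R}) (D : set T) (f : T -> R) : Prop :=
  measurable_fun D f /\ m.-integrable D (fun x => (f x ^+ 2)%:E).

Section plane.
Variable R : realType.
Implicit Types (Omega : set (R * R)) (u : R * R -> R) (a : \bar R).

Definition weak_partial Omega (v : R * R) u (g : R * R -> R) : Prop :=
  forall phi : R * R -> R, test_function Omega phi ->
    \int[lebesgue2 R]_(z in Omega) (u z * 'D_v phi z) =
    - \int[lebesgue2 R]_(z in Omega) (g z * phi z).

(* u belongs to H^1(Omega, gauss2), with weak gradient (ux, uy). *)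
Definition H1 Omega u (ux uy : R * R -> R) : Prop :=
  [/\ L2 (gauss2 R) Omega u,
      L2 (gauss2 R) Omega ux /\ L2 (gauss2 R) Omega uy,
      weak_partial Omega (1, 0) u ux & weak_partial Omega (0, 1) u uy].

Definition neumann_eigenpair Omega (m : R) u : Prop :=
  exists ux uy : R * R -> R,
  [/\ H1 Omega u ux uy,
      ~ {ae gauss2 R, forall z, Omega z -> u z = 0} &
      forall phi phix phiy, H1 Omega phi phix phiy ->
        \int[gauss2 R]_(z in Omega) (ux z * phix z + uy z * phiy z) =
        m * \int[gauss2 R]_(z in Omega) (u z * phi z)].

Definition neumann_eigenvalue Omega (m : R) : Prop :=
  exists u, neumann_eigenpair Omega m u.

Definition odd_wrt_y_axis Omega u : Prop :=
  {ae gauss2 R, forall z, Omega z -> u (- z.1, z.2) = - u z}.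

(* The least element of A, or +oo if A has no least element. *)
Definition least_element (A : set R) : \bar R :=
  ereal_inf (EFin @` (A `&` lbound A)).

Definition mu1 Omega : \bar R :=
  least_element [set m | 0 < m /\ neumann_eigenvalue Omega m].

Definition mu1_odd Omega : \bar R :=
  least_element [set m | exists2 u, neumann_eigenpair Omega m u
                             & odd_wrt_y_axis Omega u].

Definition sym_itv a : set R := [set x | (- a < x%:E < a)%E].

Definition strip a : set (R * R) := [set z | sym_itv a z.1].

Definition weak_deriv (I : set R) (z g : R -> R) : Prop :=
  forall phi : R -> R, test_function I phi ->
    \int[lebesgue_measure]_(x in I) (z x * 'D_1 phi x) =
    - \int[lebesgue_measure]_(x in I) (g x * phi x).

(* z belongs to H^1_0(I, gauss1), with weak derivative g: it is a limit of
   test functions for the H^1 norm. *)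
Definition H10 (I : set R) (z g : R -> R) : Prop :=
  [/\ L2 (gauss1 R) I z, L2 (gauss1 R) I g, weak_deriv I z g &
      forall e : R, 0 < e -> exists2 phi, test_function I phi &
        \int[gauss1 R]_(x in I) ((z x - phi x) ^+ 2) +
        \int[gauss1 R]_(x in I) ((g x - 'D_1 phi x) ^+ 2) < e].

(* The infimum of the Rayleigh quotients is attained, hence a minimum. *)
Definition lambda1 a : \bar R :=
  ereal_inf [set l%:E | l in [set l | exists z g : R -> R,
    [/\ H10 (sym_itv a) z g,
        ~ {ae gauss1 R, forall x, sym_itv a x -> z x = 0} &
        l = (\int[gauss1 R]_(x in sym_itv a) (g x ^+ 2)) /
            (\int[gauss1 R]_(x in sym_itv a) (z x ^+ 2))]]].

Definition planar_domain Omega : Prop :=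
  [/\ open Omega, connected Omega & Omega !=set0].

Definition boundary Omega : set (R * R) := closure Omega `\` interior Omega.

Definition symmetric_wrt_y_axis Omega : Prop :=
  forall z, Omega z -> Omega (- z.1, z.2).

(* The norm of R * R is the sup norm, so its balls are squares. *)
Definition disk (c : R * R) (r : R) : set (R * R) :=
  [set z | (z.1 - c.1) ^+ 2 + (z.2 - c.2) ^+ 2 < r ^+ 2].

Definition uniform_interior_sphere Omega : Prop :=
  exists2 r : R, 0 < r & forall P, boundary Omega P ->
    exists c, disk c r `<=` Omega /\ boundary (disk c r) P.

(* Near each boundary point, Omega is the subgraph of a C^2 function in some
   orthonormal frame, the rotation of the standard one with cosine c and
   sine s. *)
Definition C2_domain Omega : Prop :=
  planar_domain Omega /\ forall P, boundary Omega P ->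
    exists (c s : R) (h : R -> R),
    [/\ c ^+ 2 + s ^+ 2 = 1, Ck (setT : set R) 2 h &
        \forall z \near P,
          Omega z <-> - s * z.1 + c * z.2 < h (c * z.1 + s * z.2)].

Definition concave_on (I : set R) (p : R -> R) : Prop :=
  convex_function (I : set (convex_lmodType R^o)) (fun x : R => - p x).

Definition even_on (I : set R) (p : R -> R) : Prop :=
  forall x, I x -> p (- x) = p x.

Definition bounded_assumptions Omega a : Prop :=
  [/\ planar_domain Omega, convex_set (Omega : set (convex_lmodType (R^o * R^o)%type)),
      bounded_set Omega, symmetric_wrt_y_axis Omega &
      (0 < a < +oo)%E /\ exists p q : R -> R,
      [/\ concave_on (sym_itv a) p, even_on (sym_itv a) p,
          concave_on (sym_itv a) (fun x => - q x),
          even_on (sym_itv a) (fun x => - q x) &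
          Omega = [set z | sym_itv a z.1 /\ q z.1 < z.2 < p z.1]]].

Definition unbounded_assumptions Omega a : Prop :=
  [/\ C2_domain Omega,
      convex_set (Omega : set (convex_lmodType (R^o * R^o)%type)),
      ~ bounded_set Omega,
      symmetric_wrt_y_axis Omega /\ uniform_interior_sphere Omega &
      (0 < a)%E /\ exists p : R -> R,
      [/\ concave_on (sym_itv a) p, even_on (sym_itv a) p,
          Ck (sym_itv a) 2 p &
          Omega = [set z | sym_itv a z.1 /\ z.2 < p z.1]]].

End plane.

(* Main.v *)
Require Import Defs.
From HB Require Import structures.
From mathcomp Require Import all_boot all_order all_algebra finmap.
From mathcomp Require Import all_classical all_reals all_analysis.
From mathcomp Require Import measurable_realfun lebesgue_integral.
From mathcomp Require Import ring lra.

Set Implicit Arguments.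
Unset Strict Implicit.
Unset Printing Implicit Defensive.

Import Order.TTheory GRing.Theory Num.Theory.
Import numFieldNormedType.Exports.

Local Open Scope classical_set_scope.
Local Open Scope ring_scope.

(** Why the theorem is true.  On the line, let D^* f = x f - f' be the adjoint of
the derivative for the Gaussian measure ([dstar]).  The commutation relation
D D^* - D^* D = 1 gives |D^* f|^2 = |f|^2 + |f'|^2 for smooth compactly
supported f, all norms being Gaussian L^2 norms ([nsq_dstar]).  So
|D^* f|^2 >= |f|^2 always, and |D^* f|^2 >= (1 + lambda1 a) |f|^2 when f is
supported in ]-a, a[.  Moreover a compactly supported f has the form D^* A, with
A supported in the same interval, as soon as its mean is zero
([dstar_preimage]).

Odd eigenfunctions ([odd_eigenvalue_bound]).  Let u be an odd eigenfunction of
Omega, with eigenvalue m.  Test u against finite sums v of products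
alpha(x) beta(y) supported in Omega, which are dense ([tens_dense]).  As u is
odd, only the odd part v_o of v in x matters.  The slices of Omega at constant y
are symmetric intervals, by convexity and symmetry, and v_o has mean zero on
each of them: it is D_x^* phi for a test function phi of Omega
([odd_part_preimage]).  Hence <u, v> = <u, D_x^* phi> = <u_x, phi>, while
(1 + lambda1 a) |phi|^2 <= |v_o|^2 <= |v|^2 by integrating the inequality of the
line over the slices.  By Cauchy-Schwarz,
(1 + lambda1 a) |u|^2 <= |u_x|^2 <= |grad u|^2 = m |u|^2, which is
m - 1 >= lambda1 a.  The argument is by duality so that the derivatives fall on
the test functions only, and no representative of u on slices has to be chosen.

The strip ([mu1_strip]).  The function y is an eigenfunction of the strip with
eigenvalue 1, because D^* 1 = y; cutoffs make this rigorous ([strip_ipy]).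
Conversely let u have mean zero on the strip.  A sum of tensors v is
(v - b(y)) + (b(y) - c) + c, where b(y) is the mean of v over the slice and c the
mean of b.  The three terms are orthogonal; the first is in the closure of the
range of D_x^*, the second in the closure of the range of D_y^*
([strip_decomposition], [centered_closure]).  As |D^* f| >= |f| in each variable,
duality gives <u, v>^2 <= |grad u|^2 |v|^2, hence |u|^2 <= |grad u|^2, and every
positive eigenvalue is at least 1.

When mu1 Omega = mu1_odd Omega, either both are infinite and there is nothing to
prove, or their common value is the eigenvalue of an odd eigenfunction. *)

(** * Smooth functions *)

Definition smooth (R : realType) (V : normedModType R) (f : V -> R) : Prop :=
  forall k, Ck setT k f.

Section Ck.
Variables (R : realType) (V : normedModType R).
Implicit Types (f g : V -> R).

Lemma CkT_continuous k f : Ck setT k f -> continuous f.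
Proof. by case: k => [|k] [cf _] x; apply: cf; rewrite inE. Qed.

Lemma CkT_S k f : Ck setT k.+1 f -> Ck setT k f.
Proof.
elim: k f => [|k IH] f; first by case.
by move=> [cf df]; split => // v; have [dfv Cfv] := df v; split => //; exact: IH.
Qed.

Lemma CkD k f g : Ck setT k f -> Ck setT k g -> Ck setT k (fun x => f x + g x).
Proof.
elim: k f g => [|k IH] f g [cf df] [cg dg]; (split; [by move=> x xT; apply: cvgD; [exact: cf|exact: cg]|]) => //.
move=> v; have [dfv Cfv] := df v; have [dgv Cgv] := dg v; split.
  by move=> z _; apply: derivableD; [exact: dfv|exact: dgv].
have -> : 'D_v (fun x => f x + g x) = fun x => 'D_v f x + 'D_v g x.
  by apply/funext => x; rewrite (@deriveD _ _ _ f g)//; [exact: dfv|exact: dgv].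
exact: IH.
Qed.

Lemma Ck_cst k c : Ck (@setT V) k (fun=> c).
Proof.
elim: k c => [|k IH] c; (split; [by move=> x xT; exact: cvg_cst|]) => // v.
split; first by move=> z _; exact: derivable_cst.
have -> : 'D_v (fun=> c) = fun=> 0 :> R.
  by apply/funext => x; exact: (derive_cst c).
exact: IH.
Qed.

Lemma CkM k f g : Ck setT k f -> Ck setT k g -> Ck setT k (fun x => f x * g x).
Proof.
elim: k f g => [|k IH] f g Cf Cg; (split; [by move=> x xT; apply: cvgM; [exact: (CkT_continuous Cf)|exact: (CkT_continuous Cg)]|]) => // v.
have [cf df] := Cf; have [cg dg] := Cg.
have [dfv Cfv] := df v; have [dgv Cgv] := dg v; split.
  by move=> z _; apply: derivableM; [exact: dfv|exact: dgv].
have -> : 'D_v (fun x => f x * g x) = fun x => f x * 'D_v g x + g x * 'D_v f x.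
  by apply/funext => x; rewrite (@deriveM _ _ f g)//; [exact: dfv|exact: dgv].
by apply: CkD; apply: IH => //; exact: CkT_S.
Qed.

Lemma CkZ k c f : Ck setT k f -> Ck setT k (fun x => c * f x).
Proof. by move=> Cf; apply: CkM => //; exact: Ck_cst. Qed.

Lemma smooth_continuous f : smooth f -> continuous f.
Proof. by move=> sf; exact: (CkT_continuous (sf 0%N)). Qed.

Lemma smooth_derivable f x v : smooth f -> derivable f x v.
Proof. by move=> sf; have [_ /(_ v)[+ _]] := sf 1%N; exact. Qed.

Lemma smooth_derive f v : smooth f -> smooth ('D_v f).
Proof. by move=> sf k; have [_ /(_ v)[]] := sf k.+1. Qed.

Lemma smoothD f g : smooth f -> smooth g -> smooth (fun x => f x + g x).
Proof. by move=> sf sg k; exact: CkD. Qed.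

Lemma smoothM f g : smooth f -> smooth g -> smooth (fun x => f x * g x).
Proof. by move=> sf sg k; exact: CkM. Qed.

Lemma smooth_cst c : smooth (fun _ : V => c).
Proof. by move=> k; exact: Ck_cst. Qed.

Lemma smoothZ c f : smooth f -> smooth (fun x => c * f x).
Proof. by move=> sf k; exact: CkZ. Qed.

Lemma smoothN f : smooth f -> smooth (fun x => - f x).
Proof.
move=> sf; rewrite (_ : (fun x => - f x) = fun x => -1 * f x); first exact: smoothZ.
by apply/funext => x; rewrite mulN1r.
Qed.

Lemma smoothB f g : smooth f -> smooth g -> smooth (fun x => f x - g x).
Proof. by move=> sf sg; apply: smoothD => //; exact: smoothN. Qed.

Lemma smoothX n f : smooth f -> smooth (fun x => f x ^+ n).
Proof.
move=> sf; elim: n => [|n IH].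
  by rewrite (_ : (fun x => _) = fun=> 1)//; exact: smooth_cst.
rewrite (_ : (fun x => _) = fun x => f x * f x ^+ n); first exact: smoothM.
by apply/funext => x; rewrite exprS.
Qed.

End Ck.

Section smooth1.
Variable R : realType.
Implicit Types (f g : R -> R).

(** These variants fix the direction and the shape of the functions, so that
derivatives of explicit formulas can be built as terms. *)
Lemma is_derive1D f g (x df dg : R) : is_derive x 1 f df -> is_derive x 1 g dg ->
  is_derive x 1 (fun t : R => f t + g t) (df + dg).
Proof. exact: is_deriveD. Qed.

Lemma is_derive1M f g (x df dg : R) : is_derive x 1 f df -> is_derive x 1 g dg ->
  is_derive x 1 (fun t : R => f t * g t) (f x * dg + g x * df).
Proof. exact: is_deriveM. Qed.

Lemma is_derive1Z c f (x df : R) : is_derive x 1 f df ->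
  is_derive x 1 (fun t : R => c * f t) (c * df).
Proof. exact: is_deriveZ. Qed.

Lemma is_derive1_id (x : R) : is_derive x 1 (fun t : R => t) 1.
Proof. exact: is_derive_id. Qed.

Lemma is_derive1_cst (x c : R) : is_derive x 1 (fun _ : R => c) 0.
Proof. exact: is_derive_cst. Qed.

Lemma is_derive1o f g (x df dg : R) : is_derive (g x) 1 f df -> is_derive x 1 g dg ->
  is_derive x 1 (fun t : R => f (g t)) (dg * df).
Proof. by move=> hf hg; rewrite mulrC; exact: is_derive1_comp. Qed.

(** On the line every direction is a multiple of 1; this handles the
quantification over directions in [Ck]. *)
Lemma derive1_dir f (x v df : R) : is_derive x 1 f df -> is_derive x v f (v * df).
Proof.
move=> [d1 D1].
have df1 : differentiable f x by exact/derivable1_diffP.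
apply: DeriveDef; first exact: diff_derivable.
rewrite deriveE// -D1 deriveE//.
by rewrite -{1}(mulr1 v) -[v * 1]/(v *: (1 : R)) linearZ.
Qed.

(** A class of functions that is stable under differentiation consists of
smooth functions: its stability provides the derivatives of all orders at once. *)
Lemma smooth_class (P : (R -> R) -> Prop) :
  (forall f, P f -> exists2 f', P f' & forall x : R, is_derive x 1 f (f' x)) ->
  forall f, P f -> smooth f.
Proof.
move=> H f Pf k; elim: k f Pf => [|k IH] f Pf; have [f' Pf' ff'] := H _ Pf;
  (split; [by move=> x _; apply/differentiable_continuous/derivable1_diffP; case: (ff' x)|]) => //.
move=> v; have vf x := derive1_dir v (ff' x); split; first by move=> z _; case: (vf z).
rewrite (_ : 'D_v f = fun x => v * f' x); first by apply: CkZ; exact: IH.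
by apply/funext => x; case: (vf x).
Qed.

Lemma smooth_is_derive f (x : R) : smooth f -> is_derive x 1 f ('D_1 f x).
Proof. by move=> sf; apply/derivableP/smooth_derivable. Qed.

Lemma smooth_id : smooth (fun x : R => x).
Proof.
apply: (@smooth_class (fun f => f = id \/ exists c, f = cst c)); last by left.
move=> f [->|[c ->]].
  exists (cst 1); first by right; exists 1.
  by move=> x; apply: is_derive_id.
exists (cst 0); first by right; exists 0.
by move=> x; exact: is_derive_cst.
Qed.

Lemma is_derive_expsq (c x : R) :
  is_derive x 1 (fun x => expR (c * x ^+ 2)) (2 * c * x * expR (c * x ^+ 2)).
Proof.
have h : is_derive x 1 (fun x : R => c * (x * x)) (c * (x * 1 + x * 1)).
  by apply: is_derive1Z; apply: is_derive1M; exact: is_derive1_id.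
by apply: (is_derive_eq (is_derive1o (is_derive_expR _) h)); ring.
Qed.

(** The products of a polynomial and of a fixed Gaussian are stable under
differentiation. *)
Lemma smooth_expsq (c : R) : smooth (fun x : R => expR (c * x ^+ 2)).
Proof.
apply: (@smooth_class (fun f : R -> R => exists p : {poly R}, f = fun x : R => p.[x] * expR (c * x ^+ 2))); last first.
  by exists 1; apply/funext => x; rewrite hornerC mul1r.
move=> _ [p ->]; exists (fun x => (p^`() + (2 * c) *: 'X * p).[x] * expR (c * x ^+ 2)); first by eexists.
move=> x; apply: (is_derive_eq (is_derive1M (is_derive_poly p x) (is_derive_expsq c x))).
by rewrite !(hornerD, hornerM, hornerZ, hornerX); ring.
Qed.

Lemma smooth_opp f : smooth f -> smooth (fun x : R => f (- x)).
Proof.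
move=> sf; apply: (@smooth_class (fun f => exists2 g : R -> R, smooth g & f = fun x : R => g (- x))); last by exists f.
move=> _ [g sg ->]; exists (fun x => - 'D_1 g (- x)).
  by exists (fun x => - 'D_1 g x) => //; apply: smoothN; exact: smooth_derive.
move=> x; apply: (is_derive_eq (is_derive1o (smooth_is_derive (- x) sg) (is_deriveNid _ _))).
by rewrite mulN1r.
Qed.

Lemma smooth_comp_add f (c : R) : smooth f -> smooth (fun x : R => f (x + c)).
Proof.
move=> sf; apply: (@smooth_class (fun f => exists2 g : R -> R, smooth g & f = fun x : R => g (x + c))); last by exists f.
move=> _ [g sg ->]; exists (fun x => 'D_1 g (x + c)).
  by exists (fun x => 'D_1 g x) => //; exact: smooth_derive.
move=> x; have h : is_derive x 1 (fun t : R => t + c) (1 + 0).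
  by apply: (@is_derive1D (fun t => t) (fun=> c)).
apply: (is_derive_eq (@is_derive1o g _ x _ _ (smooth_is_derive (x + c) sg) h)).
by rewrite addr0 mul1r.
Qed.

Lemma smooth_scale f (c : R) : smooth f -> smooth (fun x : R => f (c * x)).
Proof.
move=> sf; apply: (@smooth_class (fun f => exists2 g : R -> R, smooth g & f = fun x : R => g (c * x))); last by exists f.
move=> _ [g sg ->]; exists (fun x => c * 'D_1 g (c * x)).
  by exists (fun x => c * 'D_1 g x) => //; apply: smoothZ; exact: smooth_derive.
move=> x; apply: (is_derive_eq (is_derive1o (smooth_is_derive (c * x) sg) (is_derive1Z c (is_derive1_id _)))).
by rewrite mulr1.
Qed.

End smooth1.

Section plane_smooth.
Variable R : realType.
Implicit Types (f g : R -> R).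

Lemma smooth_fst f : smooth f -> smooth (fun z : R * R => f z.1).
Proof.
move=> sf k; have := sf k; elim: k f {sf} => [|k IH] f [cf df];
  (split; [move=> x _; apply: (@continuous_comp _ _ _ fst f); [exact: cvg_fst|by apply: cf; rewrite inE]|]) => //.
move=> v; have [dv Cv] := df v.1; split; first by move=> z _; exact: (dv z.1).
exact: (IH _ Cv).
Qed.

Lemma smooth_snd f : smooth f -> smooth (fun z : R * R => f z.2).
Proof.
move=> sf k; have := sf k; elim: k f {sf} => [|k IH] f [cf df];
  (split; [move=> x _; apply: (@continuous_comp _ _ _ snd f); [exact: cvg_snd|by apply: cf; rewrite inE]|]) => //.
move=> v; have [dv Cv] := df v.2; split; first by move=> z _; exact: (dv z.2).
exact: (IH _ Cv).
Qed.

End plane_smooth.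

(** * Bump functions and plateaus *)

Section flat.
Variable R : realType.
Implicit Types (f g : R -> R) (p q : {poly R}).

(** Differentiability of the flat functions at the origin, where no formula is
available, comes from their quadratic decay. *)
Lemma is_derive_quadratic f (a C : R) :
  (forall h, `|f (h + a) - f a| <= C * h ^+ 2) -> is_derive a 1 f 0.
Proof.
move=> fC.
have cv : (fun h => h^-1 *: (f (h *: (1 : R) + a) - f a)) @ 0^' --> (0 : R).
  apply/cvgrPdist_le => e e0.
  have C0 : 0 <= C by have := le_trans (normr_ge0 _) (fC 1); rewrite expr1n mulr1.
  have d0 : 0 < e / (C + 1) by rewrite divr_gt0 // ltr_wpDl.
  near=> h.
  have h0 : h != 0 by near: h; exact: nbhs_dnbhs_neq.
  have hd : `|h| <= e / (C + 1) by near: h; apply: dnbhs0_le.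
  rewrite sub0r normrN normrZ normfV /GRing.scale/= mulr1.
  rewrite ler_pdivrMl ?normr_gt0//.
  apply: (le_trans (fC h)); rewrite -real_normK ?num_real// expr2.
  rewrite mulrCA ler_wpM2l//.
  have : (C + 1) * `|h| <= e by rewrite mulrC -ler_pdivlMr// ltr_wpDl.
  by have := normr_ge0 h; nra.
by apply: DeriveDef; [apply/cvg_ex; exists 0|exact: cvg_lim cv].
Unshelve. all: by end_near. Qed.

(** The exponential series dominates each monomial up to a factorial. *)
Lemma horner_le_exp p : exists C, forall t : R, 0 <= t -> `|p.[t]| <= C * expR t.
Proof.
exists (\sum_(i < size p) `|p`_i| * i`!%:R) => t t0.
rewrite horner_coef (le_trans (ler_norm_sum _ _ _))// mulr_suml ler_sum// => i _.
rewrite normrM normrX (ger0_norm t0) -mulrA ler_wpM2l//.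
have fi : 0 < (i : nat)`!%:R :> R by rewrite ltr0n fact_gt0.
rewrite mulrC -ler_pdivrMr//.
case: (i : nat) => [|n]; first by rewrite expr0 fact0 divr1 -expR0 ler_expR.
by have := expR_ge1Dxn n t0; apply: le_trans; rewrite lerDr.
Qed.

(** The functions p(1/x) exp(-1/x), extended by zero: a class which is stable
under differentiation and contains exp(-1/x), the source of all bumps. *)
Definition flat p (x : R) : R := if 0 < x then p.[x^-1] * expR (- x^-1) else 0.

Lemma flat_gt0E p x : 0 < x -> flat p x = p.[x^-1] * expR (- x^-1).
Proof. by rewrite /flat => ->. Qed.

Lemma flat_le0E p x : x <= 0 -> flat p x = 0.
Proof. by rewrite /flat leNgt; case: ltP. Qed.

Lemma is_derive_flat p (x : R) : is_derive x 1 (flat p) (flat ('X^2 * (p - p^`())) x).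
Proof.
have [x0|x0|->] := ltgtP x 0.
- rewrite flat_le0E ?ltW//; apply: (@near_eq_is_derive _ _ _ (cst 0)).
  + by near=> y; rewrite flat_le0E// ltW//; near: y; exact: lt_nbhsl.
- rewrite flat_gt0E//.
  apply: (@near_eq_is_derive _ _ _ (fun x : R => p.[x^-1] * expR (- x^-1))).
  + by near=> y; rewrite flat_gt0E//; near: y; exact: lt_nbhsr.
  have hV : is_derive x 1 (fun x : R => x^-1) (- x ^- 2).
    have xn0 : x != 0 by rewrite gt_eqF.
    apply: DeriveDef; first by apply: (@derivableV _ _ id) => //; exact: derivable_id.
    by rewrite (@deriveV _ _ id)//= derive_id /GRing.scale/= mulr1.
  have hN : is_derive x 1 (fun x : R => - x^-1) (x ^- 2).
    by apply: (is_derive_eq (@is_deriveN _ _ _ _ _ _ _ hV)); rewrite opprK.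
  apply: (is_derive_eq (is_derive1M (is_derive1o (is_derive_poly p _) hV) (is_derive1o (is_derive_expR _) hN))).
  by rewrite !(hornerM, hornerXn, hornerD, hornerN, hornerX) -exprVn; ring.
- rewrite flat_le0E//.
  have [C HC] := horner_le_exp ('X^2 * p).
  apply: (@is_derive_quadratic _ _ C) => h; rewrite addr0 (flat_le0E _ (lexx 0)) subr0.
  have [h0|h0] := ltP 0 h; last first.
    have C0 : 0 <= C by have := le_trans (normr_ge0 _) (HC 0 (lexx _)); rewrite expR0 mulr1.
    by rewrite flat_le0E// normr0 mulr_ge0// sqr_ge0.
  rewrite flat_gt0E// normrM (ger0_norm (expR_ge0 _)).
  have hi0 : 0 <= h^-1 by rewrite invr_ge0 ltW.
  have := HC _ hi0; rewrite hornerM hornerXn normrM ger0_norm ?sqr_ge0// exprVn.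
  rewrite ler_pdivrMl ?exprn_gt0// => Hh.
  rewrite expRN ler_pdivrMr ?expR_gt0//.
  by rewrite -mulrA [C * _]mulrCA.
Unshelve. all: by end_near. Qed.

Lemma smooth_flat p : smooth (flat p).
Proof.
apply: (@smooth_class _ (fun f : R -> R => exists p, f = flat p)); last by exists p.
by move=> _ [q ->]; eexists; [by exists ('X^2 * (q - q^`()))|exact: is_derive_flat].
Qed.

End flat.

Section bump.
Variable R : realType.

(** Positive exactly between [b] and [c]. *)
Definition itv_bump (b c x : R) : R := flat 1 (x - b) * flat 1 (c - x).

Lemma smooth_bump b c : smooth (itv_bump b c).
Proof.
apply: smoothM; first by apply: (@smooth_comp_add _ _ (- b)); exact: smooth_flat.
have : smooth (fun x : R => flat 1 (- x + c)).
  apply: (@smooth_opp _ (fun x => flat 1 (x + c))).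
  by apply: smooth_comp_add; exact: smooth_flat.
by under [in X in X -> _]eq_fun do rewrite addrC.
Qed.

Let flat1_ge0 (x : R) : 0 <= flat 1 x.
Proof. by rewrite /flat; case: ifP => // _; rewrite hornerC mul1r expR_ge0. Qed.

Let flat1_le1 (x : R) : flat 1 x <= 1.
Proof.
rewrite /flat; case: ifPn => // x0; rewrite hornerC mul1r -expR0 ler_expR.
by rewrite lerNl oppr0 invr_ge0 ltW.
Qed.

Let flat1_gt0 (x : R) : 0 < x -> 0 < flat 1 x.
Proof. by move=> x0; rewrite flat_gt0E// hornerC mul1r expR_gt0. Qed.

Lemma bump_ge0 b c x : 0 <= itv_bump b c x.
Proof. by rewrite mulr_ge0. Qed.

Lemma bump_le1 b c x : itv_bump b c x <= 1.
Proof. by rewrite -[leRHS]mulr1 ler_pM. Qed.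

Lemma bump_gt0 b c x : b < x < c -> 0 < itv_bump b c x.
Proof. by move=> /andP[bx xc]; rewrite mulr_gt0// flat1_gt0// subr_gt0. Qed.

Lemma bump_out b c x : ~~ (b < x < c) -> itv_bump b c x = 0.
Proof.
rewrite negb_and -!leNgt => /orP[h|h]; rewrite /itv_bump.
  by rewrite flat_le0E ?mul0r// subr_le0.
by rewrite mulrC flat_le0E ?mul0r// subr_le0.
Qed.

(** Powers, rather than translated or rescaled bumps, let the approximations of
the indicator of ]b, c[ converge at every point while keeping the same support. *)
Definition plateau (n : nat) (b c x : R) : R := 1 - (1 - itv_bump b c x) ^+ n.

Lemma smooth_plateau n b c : smooth (plateau n b c).
Proof.
apply: smoothB; first exact: smooth_cst.
by apply: smoothX; apply: smoothB; [exact: smooth_cst|exact: smooth_bump].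
Qed.

Lemma plateau_ge0 n b c x : 0 <= plateau n b c x.
Proof.
rewrite subr_ge0 exprn_ile1// ?subr_ge0 ?bump_le1//.
by rewrite lerBlDr lerDl bump_ge0.
Qed.

Lemma plateau_le1 n b c x : plateau n b c x <= 1.
Proof. by rewrite lerBlDr lerDl exprn_ge0// subr_ge0 bump_le1. Qed.

Lemma plateau_out n b c x : ~~ (b < x < c) -> plateau n b c x = 0.
Proof. by move=> h; rewrite /plateau bump_out// subr0 expr1n subrr. Qed.

Lemma cvg_plateau b c x : b < x < c -> plateau n b c x @[n --> \oo] --> (1 : R).
Proof.
move=> h; rewrite -[X in _ --> X]subr0; apply: cvgB; first exact: cvg_cst.
apply: cvg_expr; have := bump_gt0 h; have := bump_le1 b c x => h1 h0.
by rewrite ger0_norm ?subr_ge0// ltrBlDr ltrDl.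
Qed.

Lemma bump_incl b c b' c' x : b' <= b -> c <= c' -> itv_bump b c x <= itv_bump b' c' x.
Proof.
have mono (s t : R) : s <= t -> flat 1 s <= flat 1 t.
  move=> st; have [s0|s0] := ltP 0 s; last by rewrite flat_le0E.
  have t0 := lt_le_trans s0 st.
  by rewrite !flat_gt0E// !hornerC !mul1r ler_expR lerN2 lef_pV2.
by move=> bb cc; rewrite ler_pM// mono ?lerB.
Qed.

End bump.

(** * Square integrable functions and closures of classes *)

Lemma Rintegral_out d (T : measurableType d) (R : realType)
    (m : {measure set T -> \bar R}) (D : set T) (F : T -> R) :
  (forall z, ~ D z -> F z = 0) -> \int[m]_(z in D) F z = \int[m]_z F z.
Proof.
move=> F0; rewrite Rintegral_mkcond; apply: eq_Rintegral => z _; rewrite patchE.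
by case: ifPn => //; rewrite notin_setE => /F0.
Qed.

Section L2.
Context d (T : measurableType d) (R : realType).
Variables (m : {measure set T -> \bar R}) (D : set T).
Hypothesis mD : measurable D.
Implicit Types (f g u v : T -> R).

Local Notation ip f g := (\int[m]_(x in D) (f x * g x)).
Local Notation nsq f := (\int[m]_(x in D) (f x ^+ 2)).

Lemma L2_integrableM f g : L2 m D f -> L2 m D g ->
  m.-integrable D (EFin \o (fun x => f x * g x)).
Proof.
move=> [mf If] [mg Ig].
apply: (@le_integrable _ _ _ m D mD _ (fun x => (f x ^+ 2)%:E + (g x ^+ 2)%:E)%E).
- by apply/measurable_EFinP; exact: measurable_funM.
- move=> x Dx /=; rewrite lee_fin normrM.
  rewrite [leRHS]ger0_norm ?addr_ge0 ?sqr_ge0//.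
  have := sqr_ge0 (`|f x| - `|g x|).
  by rewrite -(real_normK (num_real (f x))) -(real_normK (num_real (g x))); nra.
- exact: integrableD.
Qed.

Lemma L2Z c f : L2 m D f -> L2 m D (fun x => c * f x).
Proof.
move=> [mf If]; split; first by apply: measurable_funM => //; exact: measurable_cst.
have := integrableZl mD (c ^+ 2) If; apply: eq_integrable => // x _.
by rewrite -EFinM exprMn.
Qed.

Lemma L2D f g : L2 m D f -> L2 m D g -> L2 m D (fun x => f x + g x).
Proof.
move=> hf hg; have Ifg := L2_integrableM hf hg; move: hf hg => [mf If] [mg Ig].
split; first exact: measurable_funD.
have h := integrableD mD (integrableD mD If Ig) (integrableZl mD 2 Ifg).
apply: (@eq_integrable _ _ _ m D mD _ _ _ h) => x _ /=.
by rewrite -!EFinM -!EFinD; congr EFin; ring.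
Qed.

Lemma L2N f : L2 m D f -> L2 m D (fun x => - f x).
Proof.
move=> /(L2Z (-1)); rewrite (_ : (fun x => -1 * f x) = fun x => - f x)//.
by apply/funext => x; rewrite mulN1r.
Qed.

Lemma L2B f g : L2 m D f -> L2 m D g -> L2 m D (fun x => f x - g x).
Proof. by move=> hf hg; apply: L2D => //; exact: L2N. Qed.

Lemma ipC f g : ip f g = ip g f.
Proof. by apply: eq_Rintegral => x _; rewrite mulrC. Qed.

Lemma ipDr u f g : L2 m D u -> L2 m D f -> L2 m D g ->
  ip u (fun x => f x + g x) = ip u f + ip u g.
Proof.
move=> hu hf hg; rewrite -RintegralD//; [|exact: L2_integrableM|exact: L2_integrableM].
by apply: eq_Rintegral => x _; rewrite mulrDr.
Qed.

Lemma ipZr c u f : L2 m D u -> L2 m D f ->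
  ip u (fun x => c * f x) = c * ip u f.
Proof.
move=> hu hf; rewrite -RintegralZl//; last exact: L2_integrableM.
by apply: eq_Rintegral => x _; rewrite mulrCA.
Qed.

Lemma ipBr u f g : L2 m D u -> L2 m D f -> L2 m D g ->
  ip u (fun x => f x - g x) = ip u f - ip u g.
Proof.
move=> hu hf hg; rewrite -RintegralB//; [|exact: L2_integrableM|exact: L2_integrableM].
by apply: eq_Rintegral => x _; rewrite mulrBr.
Qed.

Lemma nsqE f : nsq f = ip f f. Proof. by []. Qed.

Lemma nsq_ge0 f : 0 <= nsq f.
Proof. by apply: Rintegral_ge0 => x _; exact: sqr_ge0. Qed.

Lemma nsqD f g : L2 m D f -> L2 m D g ->
  nsq (fun x => f x + g x) = nsq f + 2 * ip f g + nsq g.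
Proof.
move=> hf hg; have hfg := L2D hf hg.
rewrite nsqE ipDr// ipC ipDr// [ip (fun x => _ + _) g]ipC ipDr// (ipC g f) -!nsqE.
by ring.
Qed.

Lemma nsqZ c f : L2 m D f -> nsq (fun x => c * f x) = c ^+ 2 * nsq f.
Proof.
move=> hf; have hcf := L2Z c hf; rewrite nsqE ipZr// ipC ipZr// -nsqE; ring.
Qed.

Lemma cauchy_schwarz f g : L2 m D f -> L2 m D g -> ip f g ^+ 2 <= nsq f * nsq g.
Proof.
move=> hf hg.
have H t : 0 <= nsq f + 2 * (t * ip f g) + t ^+ 2 * nsq g.
  rewrite -ipZr// -nsqZ// -nsqD//; [exact: nsq_ge0|exact: L2Z].
move: H (nsq_ge0 f) (nsq_ge0 g); move: (nsq f) (nsq g) (ip f g) => A C B H A0.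
rewrite le_eqVlt => /orP[/eqP C0|C0]; last first.
  have := H (- B / C).
  rewrite (_ : _ + _ = (A * C - B ^+ 2) / C); last by field; rewrite gt_eqF.
  by rewrite pmulr_lge0 ?invr_gt0// subr_ge0.
rewrite -C0 mulr0; have [->|B0] := eqVneq B 0; first by rewrite expr0n.
have := H (- (A + 1) / B); rewrite -C0 mulr0 addr0 divfK//.
by move=> h; exfalso; lra.
Qed.

Lemma nsqD_le f g : L2 m D f -> L2 m D g ->
  nsq (fun x => f x + g x) <= 2 * nsq f + 2 * nsq g.
Proof.
move=> hf hg; rewrite nsqD//.
have := nsq_ge0 (fun x => f x + -1 * g x).
rewrite nsqD ?nsqZ ?ipZr//; last exact: L2Z.
by rewrite sqrrN expr1n mul1r; lra.
Qed.

(** A weight [e] instead of the constant 2 keeps the factor of [nsq f] close to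
1, without which [L2_closure_bound] would lose its sharp constant. *)
Lemma nsqD_young e f g : 0 < e -> L2 m D f -> L2 m D g ->
  nsq (fun x => f x + g x) <= (1 + e) * nsq f + (1 + e^-1) * nsq g.
Proof.
move=> e0 hf hg; rewrite nsqD//.
have := nsq_ge0 (fun x => e * f x + -1 * g x).
rewrite nsqD; [|exact: L2Z|exact: L2Z].
rewrite !nsqZ// ipZr//; last exact: L2Z.
rewrite ipC ipZr// (ipC g f) => h.
rewrite -(ler_pM2l e0).
rewrite [e * (_ + _ * nsq g)](_ : _ = (e + e ^+ 2) * nsq f + (e + 1) * nsq g).
  by rewrite sqrrN expr1n mul1r in h; lra.
by field; rewrite gt_eqF.
Qed.

Definition L2_closure (P : (T -> R) -> Prop) f : Prop :=
  L2 m D f /\ forall e : R, 0 < e ->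
    exists v, [/\ P v, L2 m D v & nsq (fun x => f x - v x) < e].

Lemma L2_closure_incl P f : P f -> L2 m D f -> L2_closure P f.
Proof.
move=> Pf hf; split => // e e0; exists f; split => //.
under eq_Rintegral do rewrite subrr expr0n/=.
by rewrite Rintegral_cst// mul0r.
Qed.

Lemma L2_closureD (P : (T -> R) -> Prop) f g :
  (forall f g, P f -> P g -> P (fun x => f x + g x)) ->
  L2_closure P f -> L2_closure P g -> L2_closure P (fun x => f x + g x).
Proof.
move=> PD [hf cf] [hg cg]; split; first exact: L2D.
move=> e e0; have e4 : 0 < e / 4 by rewrite divr_gt0.
have [v [Pv hv fv]] := cf _ e4; have [w [Pw hw gw]] := cg _ e4.
exists (fun x => v x + w x); split; [exact: PD|exact: L2D|].
under eq_Rintegral do rewrite opprD addrACA.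
by apply: (le_lt_trans (nsqD_le (L2B hf hv) (L2B hg hw))); lra.
Qed.

Lemma L2_closureZ (P : (T -> R) -> Prop) c f :
  (forall f, P f -> P (fun x => c * f x)) ->
  L2_closure P f -> L2_closure P (fun x => c * f x).
Proof.
move=> PZ [hf cf]; split; first exact: L2Z.
move=> e e0; have c1 : 0 < c ^+ 2 + 1 by rewrite ltr_wpDl ?sqr_ge0.
have [v [Pv hv fv]] := cf (e / (c ^+ 2 + 1)) (divr_gt0 e0 c1).
exists (fun x => c * v x); split; [exact: PZ|exact: L2Z|].
under eq_Rintegral do rewrite -mulrBr.
rewrite nsqZ; last exact: L2B.
move: fv; rewrite ltr_pdivlMr// => fv.
by have := nsq_ge0 (fun x => f x - v x); lra.
Qed.

Lemma L2_closure_closure P f : L2_closure (L2_closure P) f -> L2_closure P f.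
Proof.
move=> [hf cf]; split => // e e0; have e4 : 0 < e / 4 by rewrite divr_gt0.
have [v [[_ cv] hv fv]] := cf _ e4; have [w [Pw hw vw]] := cv _ e4.
exists w; split => //.
under eq_Rintegral => x _ do rewrite -(subrKA (v x)).
by apply: (le_lt_trans (nsqD_le (L2B hf hv) (L2B hv hw))); lra.
Qed.

(** Estimates obtained by integration by parts hold for test functions [v];
this carries them, with the same constant, to any [f] in the closure, in
particular to [u] itself, which bounds [nsq u]. *)
Lemma L2_closure_bound (P : (T -> R) -> Prop) u f K : 0 <= K -> L2 m D u ->
  (forall v, P v -> L2 m D v -> ip u v ^+ 2 <= K * nsq v) ->
  L2_closure P f -> ip u f ^+ 2 <= K * nsq f.
Proof.
move=> K0 hu HP [hf cf].
have step (a : R) : 0 < a -> ip u f ^+ 2 <= (1 + a) ^+ 2 * (K * nsq f).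
  move=> a0; apply/ler_addgt0Pr => e e0.
  (* [L] collects the factors of the square norm of [f - v] in the final sum. *)
  set L := ((1 + a) * K + nsq u) * (1 + a^-1).
  have L0 : 0 <= L.
    have a1 : 0 <= 1 + a by rewrite addr_ge0// ltW.
    have a2 : 0 <= 1 + a^-1 by rewrite addr_ge0// invr_ge0 ltW.
    by rewrite mulr_ge0// addr_ge0 ?nsq_ge0// mulr_ge0.
  have [v [Pv hv fv]] := cf (e / (L + 1)) (divr_gt0 e0 (ltr_wpDl L0 ltr01)).
  have hfv := L2B hf hv.
  have h1 : ip u f = ip u v + ip u (fun x => f x - v x).
    by rewrite ipBr//; ring.
  have h2 := HP _ Pv hv.
  have h3 := cauchy_schwarz hu hfv.
  have h4 : nsq v <= (1 + a) * nsq f + (1 + a^-1) * nsq (fun x => f x - v x).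
    have := nsqD_young a0 hf (L2Z (-1) hfv); rewrite nsqZ// sqrrN expr1n mul1r.
    by under eq_Rintegral do rewrite mulN1r subKr.
  have h5 (x y : R) : (x + y) ^+ 2 <= (1 + a) * x ^+ 2 + (1 + a^-1) * y ^+ 2.
    rewrite -(ler_pM2l a0).
    rewrite [leRHS](_ : _ = (a + a ^+ 2) * x ^+ 2 + (a + 1) * y ^+ 2); last by field; rewrite gt_eqF.
    by have := sqr_ge0 (a * x - y); nra.
  have h6 := h5 (ip u v) (ip u (fun x => f x - v x)); rewrite -h1 in h6.
  move: fv; rewrite ltr_pdivlMr ?(ltr_wpDl L0)// => fv.
  set d2 := nsq (fun x => f x - v x) in fv h3 h4.
  have d20 : 0 <= d2 by exact: nsq_ge0.
  have ai : 0 <= 1 + a^-1 by rewrite addr_ge0// invr_ge0 ltW.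
  apply: (le_trans h6).
  have h7 : (1 + a) * ip u v ^+ 2 <= (1 + a) * (K * ((1 + a) * nsq f + (1 + a^-1) * d2)).
    rewrite ler_pM2l ?addr_gt0//; apply: (le_trans h2); exact: ler_wpM2l.
  have h8 : (1 + a^-1) * ip u (fun x => f x - v x) ^+ 2 <= (1 + a^-1) * (nsq u * d2).
    exact: ler_wpM2l.
  apply: (le_trans (lerD h7 h8)).
  have : L * d2 <= e by apply: le_trans (ltW fv); nra.
  by rewrite /L; nra.
rewrite leNgt; apply/negP => lt.
have F0 : 0 <= K * nsq f by rewrite mulr_ge0// nsq_ge0.
set S := ip u f ^+ 2 in lt step; set F := K * nsq f in lt step F0.
(* For [a <= 1], [(1 + a) ^+ 2 * F <= F + 3 * a * F], which is below [S] for this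
[a]. *)
set a := Num.min 1 ((S - F) / (6 * (F + 1))).
have F1 : 0 < F + 1 by rewrite ltr_wpDl.
have a0 : 0 < a.
  by rewrite lt_min ltr01/= divr_gt0 ?subr_gt0// mulr_gt0.
have a1 : a <= 1 by rewrite ge_min lexx.
have a2 : a * (6 * (F + 1)) <= S - F.
  by rewrite -ler_pdivlMr ?mulr_gt0// ge_min lexx orbT.
by have := step _ a0; nra.
Qed.

Lemma L2_ae0 f : L2 m D f -> \int[m]_(x in D) (f x ^+ 2) = 0 ->
  {ae m, forall x, D x -> f x = 0}.
Proof.
move=> [mf If] f0.
have H : (\int[m]_(x in D) `|(f x ^+ 2)%:E| = 0)%E.
  rewrite -[RHS]/(0%:E) -f0 /Rintegral fineK; last exact: integrable_fin_num.
  by apply: eq_integral => x _; rewrite gee0_abs// lee_fin sqr_ge0.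
have mf2 : measurable_fun D (fun x => (f x ^+ 2)%:E) by exact: (measurable_int m).
have [A _] := ae_eq_integral_abs m mD mf2.
have := A H; apply: negligibleS => x /= nQ K; apply: nQ => Dx.
by have [] := K Dx; move/eqP; rewrite sqrf_eq0 => /eqP.
Qed.

End L2.

Section finite_L2.
Context d (T : measurableType d) (R : realType).
Variables (m : {measure set T -> \bar R}) (D : set T).
Hypothesis mD : measurable D.
Hypothesis mfin : (m D < +oo)%E.
Implicit Types (f g : T -> R).

Lemma bounded_integrable f (M : R) : measurable_fun D f ->
  (forall x, D x -> `|f x| <= M) -> m.-integrable D (EFin \o f).
Proof.
move=> mf fM; apply: (@le_integrable _ _ _ m D mD _ (cst M%:E)).
- exact/measurable_EFinP.
- by move=> x Dx /=; rewrite lee_fin (le_trans (fM _ Dx))// ler_norm.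
- apply/integrableP; split; first exact: measurable_cst.
  by rewrite /= integral_cst// lte_mul_pinfty.
Qed.

Lemma bounded_L2 f (M : R) : measurable_fun D f ->
  (forall x, D x -> `|f x| <= M) -> L2 m D f.
Proof.
move=> mf fM; split => //; apply: (@bounded_integrable _ (M ^+ 2)).
  exact: measurable_funX.
move=> x Dx; rewrite normrX lerXn2r ?nnegrE//; last exact: fM.
by apply: le_trans (fM _ Dx).
Qed.

End finite_L2.

Section closure_dct.
Import HBNNSimple.
Context d (T : measurableType d) (R : realType).
Variables (m : {measure set T -> \bar R}) (D : set T).
Hypothesis mD : measurable D.
Implicit Types (f g u v : T -> R).

(** Dominated convergence: [(f - f_ n) ^+ 2] is below [(2 * h) ^+ 2], which is
integrable. *)
Lemma L2_closure_lim (P : (T -> R) -> Prop) (f_ : nat -> T -> R) f h :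
  L2 m D f -> L2 m D h -> (forall n x, D x -> `|f_ n x| <= h x) ->
  (forall x, D x -> f_ n x @[n --> \oo] --> f x) ->
  (forall n, L2_closure m D P (f_ n)) -> L2_closure m D P f.
Proof.
move=> hf hh fh cvf clf; apply: L2_closure_closure => //; split => // e e0.
have hf_ n : L2 m D (f_ n) by have [] := clf n.
have fh' x : D x -> `|f x| <= h x.
  move=> Dx; have cv : `|f_ n x| @[n --> \oo] --> `|f x| by apply: cvg_norm; exact: cvf.
  rewrite -(cvg_lim _ cv)//; apply: limr_le; first by apply/cvg_ex; exists `|f x|.
  by apply: nearW => n; exact: fh.
have I4 : m.-integrable D (EFin \o (fun x => (2 * h x) ^+ 2)) by have [] := L2Z mD 2 hh.
have mfn n : measurable_fun D (EFin \o (fun x => (f x - f_ n x) ^+ 2)).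
  by apply/measurable_EFinP; apply: measurable_funX; have [] := L2B mD hf (hf_ n).
have cvx x : D x -> (EFin \o (fun x => (f x - f_ n x) ^+ 2)) x @[n --> \oo] --> (cst 0%E : T -> \bar R) x.
  move=> Dx /=; apply/cvg_EFin; first by near=> n.
  rewrite [X in _ --> X](_ : _ = (f x - f x) ^+ 2); last by rewrite subrr expr0n.
  rewrite [X in X @ _ --> _](_ : _ = (fun n => (f x - f_ n x) * (f x - f_ n x))).
    by apply: cvgM; (apply: cvgB; [exact: cvg_cst|exact: cvf]).
  by apply/funext.
have lex x n : D x -> (`|((f x - f_ n x) ^+ 2)%:E| <= ((2 * h x) ^+ 2)%:E)%E.
  move=> Dx /=; rewrite lee_fin ger0_norm ?sqr_ge0//.
  have h0 : 0 <= h x by exact: le_trans (fh' _ Dx).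
  rewrite -real_normK ?num_real// lerXn2r ?nnegrE ?mulr_ge0//.
  by rewrite (le_trans (ler_normB _ _))// mulr_natl mulr2n lerD ?fh ?fh'.
have [_ _ H] := @dominated_convergence _ _ _ m D mD _ (cst 0%E) _
  mfn (measurable_cst _) (aeW _ cvx) I4 (aeW _ lex).
have {}H : \int[m]_(x in D) (f x - f_ n x) ^+ 2 @[n --> \oo] --> (0 : R).
  by apply: fine_cvg; rewrite integral0 in H; exact: H.
move/cvgrPdist_lt : H => /(_ _ e0) [n _ /(_ n (leqnn n))].
rewrite sub0r normrN => Hn; exists (f_ n); split => //.
by apply: le_lt_trans Hn; rewrite ler_norm.
Unshelve. all: by end_near. Qed.

(** Dominated convergence with the integrable bound [`|g| * h]. *)
Lemma cvg_ip_L2 (g h f : T -> R) (f_ : nat -> T -> R) :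
  L2 m D g -> L2 m D h -> (forall n, L2 m D (f_ n)) -> L2 m D f ->
  (forall n x, D x -> `|f_ n x| <= h x) ->
  (forall x, D x -> f_ n x @[n --> \oo] --> f x) ->
  \int[m]_(x in D) (g x * f_ n x) @[n --> \oo] --> \int[m]_(x in D) (g x * f x).
Proof.
move=> hg hh hf_ hf fh cf.
have mfn n : measurable_fun D (EFin \o (fun x => g x * f_ n x)).
  exact: (measurable_int m (L2_integrableM mD hg (hf_ n))).
have mf : measurable_fun D (EFin \o (fun x => g x * f x)).
  exact: (measurable_int m (L2_integrableM mD hg hf)).
have hag : L2 m D (fun x => `|g x|).
  have [mg Ig] := hg; split; first exact: measurableT_comp.
  by apply: eq_integrable Ig => // x _; rewrite real_normK ?num_real.
have cvx x : D x -> (EFin \o (fun x => g x * f_ n x)) x @[n --> \oo] --> (EFin \o (fun x => g x * f x)) x.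
  by move=> Dx; apply/cvg_EFin; [near=> n|apply: cvgM; [exact: cvg_cst|exact: cf]].
have lex x n : D x -> (`|(g x * f_ n x)%:E| <= (`|g x| * h x)%:E)%E.
  by move=> Dx; rewrite lee_fin normrM ler_wpM2l// fh.
have [_ _ H] := @dominated_convergence _ _ _ m D mD _ _ _ mfn mf (aeW _ cvx)
  (L2_integrableM mD hag hh) (aeW _ lex).
apply: fine_cvg; rewrite fineK; first exact: H.
by apply: integrable_fin_num => //; exact: L2_integrableM.
Unshelve. all: by end_near. Qed.

Hypothesis mfin : (m D < +oo)%E.

Lemma L2_indic A : measurable A -> L2 m D (\1_A : T -> R).
Proof.
move=> mA; apply: (@bounded_L2 _ _ _ m D mD mfin _ 1).
  exact: measurable_indic.
by move=> x _; rewrite indicE; case: (_ \in _); rewrite ?normr1 ?normr0.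
Qed.

Variable P : (T -> R) -> Prop.
Hypothesis P0 : P (fun=> 0).
Hypothesis PD : forall f g, P f -> P g -> P (fun x => f x + g x).
Hypothesis PZ : forall c f, P f -> P (fun x => c * f x).

Local Notation Cl := (L2_closure m D P).

Lemma L2_closure0 : Cl (fun=> 0).
Proof.
apply: L2_closure_incl => //.
by apply: (@bounded_L2 _ _ _ m D mD mfin _ 0) => // x _; rewrite normr0.
Qed.

Lemma L2_closureB f g : Cl f -> Cl g -> Cl (fun x => f x - g x).
Proof.
move=> cf cg; rewrite (_ : (fun x => f x - g x) = fun x => f x + -1 * g x).
  by apply: L2_closureD => //; apply: L2_closureZ => //; move=> ? ?; exact: PZ.
by apply/funext => x; rewrite mulN1r.
Qed.

Lemma cvg_indic_nd (F : (set T)^nat) x : nondecreasing_seq F ->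
  (\1_(F n) x : R) @[n --> \oo] --> (\1_(\bigcup_n F n) x : R).
Proof.
move=> ndF; rewrite [X in _ --> X]indicE; have [|nx] := boolP (x \in _).
  rewrite inE => -[N _ FNx]; apply: cvg_near_cst; exists N => // n /= Nn.
  by rewrite indicE mem_set//; move/subsetPset: (ndF _ _ Nn); exact.
apply: cvg_near_cst; near=> n; rewrite indicE memNset// => Fnx.
by move: nx; rewrite notin_setE; apply; exists n.
Unshelve. all: by end_near. Qed.

Lemma L2_closure_indic_nd (F : (set T)^nat) : nondecreasing_seq F ->
  (forall n, measurable (F n)) -> (forall n, Cl (\1_(F n))) -> Cl (\1_(\bigcup_n F n)).
Proof.
move=> ndF mF clF; apply: (@L2_closure_lim _ (fun n => \1_(F n)) _ (\1_D)) => //.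
- by apply: L2_indic; exact: bigcupT_measurable.
- exact: L2_indic.
- move=> n x Dx; rewrite !indicE (mem_set Dx).
  by case: (_ \in _); rewrite ?normr1 ?normr0.
- by move=> x Dx; exact: cvg_indic_nd.
Qed.

Lemma indic_setD (A B : set T) : B `<=` A -> \1_(A `\` B) = (fun x => \1_A x - \1_B x) :> (T -> R).
Proof.
move=> BA; apply/funext => x; rewrite !indicE.
have [xB|xB] := boolP (x \in B).
  have xA : x \in A by rewrite inE; apply: BA; rewrite -inE.
  by rewrite xA subrr memNset// => -[_]; apply; rewrite -inE.
rewrite subr0; congr (nat_of_bool _)%:R; apply/idP/idP; rewrite !inE; first by case.
by move=> xA; split => // Bx; move: xB; rewrite mem_set.
Qed.

Lemma indic_setU (A B : set T) : A `&` B = set0 -> \1_(A `|` B) = (fun x => \1_A x + \1_B x) :> (T -> R).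
Proof.
move=> AB; apply/funext => x; rewrite !indicE in_setU.
have [xA|xA] := boolP (x \in A); have [xB|xB] := boolP (x \in B) => //=; rewrite ?addr0 ?add0r//.
by exfalso; have : (A `&` B) x; [split; rewrite -inE|rewrite AB].
Qed.

(** Dynkin's argument: the sets whose trace on [Q] has its indicator in the
closure form a lambda-system, by differences and monotone limits. *)
Lemma L2_closure_dynkin (G : set (set T)) (Q : set T) :
  measurable Q -> measurable = <<s G >> -> setI_closed G ->
  Cl (\1_Q) -> (forall A, G A -> Cl (\1_(A `&` Q))) ->
  forall A, measurable A -> Cl (\1_(A `&` Q)).
Proof.
move=> mQ mG GI clQ clG.
pose H := [set A : set T | measurable A /\ Cl (\1_(A `&` Q))].
suff : <<s G >> `<=` H by move=> GH A mA; have [] := GH A; rewrite -?mG.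
apply: (@lambda_system_subset _ G GI setT H) => //; last first.
- by move=> A GA; split; [rewrite mG; exact: sub_sigma_algebra|exact: clG].
split => //.
- by split => //; rewrite setTI.
- move=> A B BA [mA clA] [mB clB]; split; first exact: measurableD.
  rewrite (_ : (A `\` B) `&` Q = (A `&` Q) `\` (B `&` Q)); last first.
    by apply/seteqP; split => x /=; tauto.
  by rewrite indic_setD; [exact: L2_closureB|exact: setSI].
- move=> F ndF HF; split; first by apply: bigcupT_measurable => n; have [] := HF n.
  rewrite setI_bigcupl; apply: L2_closure_indic_nd.
  + by move=> i j ij; apply/subsetPset; apply: setSI; apply/subsetPset; exact: ndF.
  + by move=> n; apply: measurableI => //; have [] := HF n.
  + by move=> n; have [] := HF n.
Qed.

(** Simple functions increase to a nonnegative function, which dominates them;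
a general function is the difference of its positive and negative parts. *)
Lemma L2_closure_all : (forall A, measurable A -> A `<=` D -> Cl (\1_A)) ->
  forall f, L2 m D f -> Cl f.
Proof.
move=> clA; have pos f : (forall x, 0 <= f x) -> L2 m D f -> Cl f.
  move=> f0 hf; have [mf _] := hf.
  have mEf : measurable_fun D (EFin \o f) by exact/measurable_EFinP.
  pose g := nnsfun_approx mD mEf.
  apply: (@L2_closure_lim P (fun n => g n) f f hf hf).
  - move=> n x Dx; rewrite ger0_norm// -lee_fin /g nnsfun_approxE.
    by apply: (@le_approx _ _ _ D (EFin \o f)) => // y _; rewrite lee_fin.
  - move=> x Dx; have := @cvg_nnsfun_approx _ _ _ D mD _ mEf _ x Dx.
    by move=> /(_ (fun y _ => f0 y)) /fine_cvg; apply: cvg_trans.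
  - move=> n.
    have nD x : ~ D x -> g n x = 0.
      move=> Dx; rewrite /g nnsfun_approxE /approx big1 ?add0r => [|i _].
        by rewrite /integer_approx indicE memNset ?mulr0// => -[].
      rewrite /dyadic_approx; case: ifPn => _; rewrite indicE memNset ?mulr0//.
      by case.
    rewrite (_ : (g n : T -> R) = fun x => \sum_(i < #|` fset_set (range (g n))|)
        (fset_set (range (g n)))`_i * \1_(g n @^-1` [set (fset_set (range (g n)))`_i]) x); last first.
      by apply/funext => x; exact: fimfunEord.
    have clsum k (c : nat -> R) (B : nat -> set T) :
        (forall i, c i = 0 \/ Cl (\1_(B i))) ->
        Cl (fun x => \sum_(i < k) c i * \1_(B i) x).
      move=> cB; elim: k => [|k IH].
        by under eq_fun do rewrite big_ord0; exact: L2_closure0.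
      under eq_fun do rewrite big_ord_recr/=.
      apply: L2_closureD => //; have [->|] := cB k.
        by under eq_fun do rewrite mul0r; exact: L2_closure0.
      by move=> clB; apply: L2_closureZ => //; move=> ? ?; exact: PZ.
    apply: (clsum _ (fun i => (fset_set (range (g n)))`_i) (fun i => g n @^-1` [set (fset_set (range (g n)))`_i])).
    move=> i; have [c0|c0] := eqVneq (fset_set (range (g n)))`_i 0; [by left|right].
    apply: clA => // x /= gx; apply: contrapT => /nD gx0.
    by move/eqP : c0; rewrite -gx gx0.
move=> f hf; have [mf If] := hf.
have part s : L2 m D (fun x => Num.max (s * f x) 0) -> Cl (fun x => Num.max (s * f x) 0).
  by apply: pos => x; rewrite le_max lexx orbT.
have hpart s : s ^+ 2 = 1 -> L2 m D (fun x => Num.max (s * f x) 0).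
  move=> s1; have ms : measurable_fun D (fun x => Num.max (s * f x) 0).
    by apply: measurable_maxr => //; have [] := L2Z mD s hf.
  split => //; apply: (@le_integrable _ _ _ m D mD _ (fun x => (f x ^+ 2)%:E)) => //.
    by apply/measurable_EFinP; exact: measurable_funX.
  move=> x Dx /=; rewrite lee_fin !ger0_norm ?sqr_ge0//.
  have -> : f x ^+ 2 = (s * f x) ^+ 2 by rewrite exprMn s1 mul1r.
  by case: (leP (s * f x) 0) => // _; rewrite expr0n sqr_ge0.
have := L2_closureB (part 1 (hpart 1 _)) (part (-1) (hpart (-1) _)).
rewrite sqrrN expr1n => /(_ erefl erefl).
rewrite (_ : (fun x => _ - _) = f)//; apply/funext => x.
rewrite mul1r mulN1r; case: (leP (f x) 0); case: (leP (- f x) 0); lra.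
Qed.

End closure_dct.

(** * The Gaussian measures and their densities *)

Section density.
Import HBNNSimple.
Context d (T : measurableType d) (R : realType).
Variables (m n : {measure set T -> \bar R}) (w : T -> R).
Hypothesis mw : measurable_fun setT w.
Hypothesis w0 : forall x, 0 <= w x.
Hypothesis nE : forall A, measurable A -> n A = (\int[m]_(x in A) (w x)%:E)%E.

(** Indicators are the hypothesis [nE]; simple functions follow by linearity
and nonnegative functions by monotone convergence. *)
Lemma ge0_integral_density (f : T -> \bar R) : measurable_fun setT f ->
  (forall x, (0 <= f x)%E) -> (\int[n]_x f x = \int[m]_x (f x * (w x)%:E))%E.
Proof.
move=> mf f0; have mEw : measurable_fun setT (EFin \o w) by exact/measurable_EFinP.
have simple (g : {nnsfun T >-> R}) : (\int[n]_x (g x)%:E = \int[m]_x ((g x)%:E * (w x)%:E))%E.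
  under eq_integral do rewrite fimfunE -fsumEFin//.
  rewrite ge0_integral_fsum//; last 2 first.
  - by move=> r; exact/measurable_EFinP/measurableT_comp.
  - by move=> r x _; rewrite EFinM nnfun_muleindic_ge0.
  under [RHS]eq_integral => x _.
    rewrite fimfunE -fsumEFin// ge0_mule_fsuml//; last first.
      by move=> r; rewrite EFinM nnfun_muleindic_ge0.
    over.
  rewrite [RHS]ge0_integral_fsum//; last 2 first.
  - by move=> r; apply: emeasurable_funM => //; exact/measurable_EFinP/measurableT_comp.
  - by move=> r x _; apply: mule_ge0; [rewrite EFinM nnfun_muleindic_ge0|rewrite lee_fin].
  apply: eq_fsbigr => r; rewrite inE => -[x _ gx].
  have r0 : 0 <= r by rewrite -gx.
  under eq_integral do rewrite EFinM.
  under [RHS]eq_integral do rewrite EFinM -muleA.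
  have mi : measurable (g @^-1` [set r]) by rewrite -[X in measurable X]setTI; exact: measurable_funP.
  rewrite ge0_integralZl//; last first.
    by apply/measurable_EFinP; exact: measurable_indic.
  rewrite ge0_integralZl//; last 2 first.
  - by apply: emeasurable_funM => //; apply/measurable_EFinP; exact: measurable_indic.
  - by move=> y _; rewrite mule_ge0// lee_fin.
  congr (_ * _)%E; rewrite integral_indic// setIT nE// integral_mkcond.
  apply: eq_integral => y _; rewrite patchE indicE.
  by case: (_ \in _); rewrite ?mul1e ?mul0e.
pose g := nnsfun_approx measurableT mf.
have gf x : (g n x)%:E @[n --> \oo] --> f x by exact: cvg_nnsfun_approx.
have ndg x : {homo (fun k => (g k x)%:E) : i j / (i <= j)%N >-> (i <= j)%E}.
  by move=> i j ij; rewrite lee_fin; exact/lefP/nd_nnsfun_approx.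
have L := @cvg_monotone_convergence _ _ _ n setT measurableT (fun k x => (g k x)%:E).
transitivity (limn (fun k => \int[n]_x (g k x)%:E))%E.
  apply/esym/cvg_lim => //.
  under eq_integral => x _ do rewrite -(cvg_lim _ (gf x))//.
  apply: L => //.
  - by move=> k; apply/measurable_EFinP.
  - by move=> k x _; rewrite lee_fin.
apply/cvg_lim => //.
under eq_fun do rewrite simple.
have -> : (\int[m]_x (f x * (w x)%:E) = \int[m]_x limn (fun k => (g k x)%:E * (w x)%:E))%E.
  apply: eq_integral => x _; apply/esym/cvg_lim => //.
  by apply: cvgeZr => //; exact: gf.
apply: cvg_monotone_convergence => //.
- by move=> k; apply: emeasurable_funM => //; apply/measurable_EFinP.
- by move=> k x _; rewrite mule_ge0 ?lee_fin.
- by move=> x _ i j ij; rewrite lee_wpmul2r ?lee_fin//; have := ndg x i j ij; rewrite lee_fin.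
Qed.

End density.

Section gaussians.
Variable R : realType.
Local Notation T1 := (measurableTypeR R).
Local Notation leb := (@lebesgue_measure R).

(** The Gaussian weight on the line; [gw2] is the one on the plane. *)
Definition gw (x : R) : R := normal_pdf 0 1 x.

Lemma gwE x : gw x = normal_peak 1 * expR (- 2^-1 * x ^+ 2).
Proof.
rewrite /gw normal_pdfE ?oner_neq0// /normal_fun subr0; congr (_ * expR _).
by rewrite expr1n mulr2n; field.
Qed.

Lemma gw_gt0 x : 0 < gw x.
Proof. by rewrite gwE mulr_gt0 ?expR_gt0 ?normal_peak_gt0 ?oner_neq0. Qed.

Lemma smooth_gw : smooth gw.
Proof.
rewrite (_ : gw = fun x => normal_peak 1 * expR (- 2^-1 * x ^+ 2)).
  by apply: smoothZ; exact: smooth_expsq.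
by apply/funext => x; rewrite gwE.
Qed.

Lemma measurable_gw : measurable_fun [set: T1] gw.
Proof. exact: measurable_normal_pdf. Qed.

Lemma is_derive_gw (x : R) : is_derive x 1 gw (- x * gw x).
Proof.
rewrite (_ : gw = fun x => normal_peak 1 * expR (- 2^-1 * x ^+ 2)).
  by apply: (is_derive_eq (is_derive1Z _ (is_derive_expsq _ x))); field.
by apply/funext => y; rewrite gwE.
Qed.

Definition gw2 (z : R * R) : R := gw z.1 * gw z.2.

Lemma gw2_gt0 z : 0 < gw2 z.
Proof. by rewrite mulr_gt0 ?gw_gt0. Qed.

Lemma measurable_gw2 : measurable_fun [set: T1 * T1] gw2.
Proof.
by apply: measurable_funM; apply: (measurableT_comp measurable_gw).
Qed.

Lemma ge0_integral_gauss1 (f : R -> \bar R) : measurable_fun [set: T1] f ->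
  (forall x, (0 <= f x)%E) ->
  (\int[gauss1 R]_x f x = \int[leb]_x (f x * (gw x)%:E))%E.
Proof.
move=> mf f0; apply: ge0_integral_density => //; first exact: measurable_gw.
by move=> x; exact/ltW/gw_gt0.
Qed.

(** Tonelli reduces the plane to two applications of the result on the line. *)
Lemma ge0_integral_gauss2 (f : R * R -> \bar R) : measurable_fun [set: T1 * T1] f ->
  (forall x, (0 <= f x)%E) ->
  (\int[gauss2 R]_x f x = \int[lebesgue2 R]_x (f x * (gw2 x)%:E))%E.
Proof.
move=> mf f0.
have gw0 x : (0 <= (gw x)%:E)%E by rewrite lee_fin ltW ?gw_gt0.
have mEgw : measurable_fun [set: T1] (EFin \o gw) by apply/measurable_EFinP; exact: measurable_gw.
rewrite /gauss2 /lebesgue2 fubini_tonelli1// fubini_tonelli1//; last 2 first.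
- by apply: emeasurable_funM => //; apply/measurable_EFinP; exact: measurable_gw2.
- by move=> z; rewrite mule_ge0// lee_fin ltW// gw2_gt0.
rewrite ge0_integral_gauss1//; last 2 first.
- exact: measurable_fun_fubini_tonelli_F.
- by move=> x; apply: integral_ge0.
apply: eq_integral => x _; rewrite /fubini_F ge0_integral_gauss1//; last first.
  exact: measurableT_comp.
rewrite -ge0_integralZr//; last 2 first.
- apply: emeasurable_funM => //; exact: measurableT_comp.
- by move=> y _; rewrite mule_ge0.
by apply: eq_integral => y _; rewrite -muleA -EFinM /gw2/= [gw y * _]mulrC.
Qed.

(** The real integral is the difference of the integrals of the positive and
negative parts, to which the nonnegative case applies. *)
Lemma Rintegral_density d (T : measurableType d) (m n : {measure set T -> \bar R}) (w : T -> R)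
  (D : set T) (F : T -> R) : measurable D -> measurable_fun D F ->
  (forall x, 0 <= w x) ->
  (forall f : T -> \bar R, measurable_fun setT f -> (forall x, 0 <= f x)%E ->
     \int[n]_x f x = \int[m]_x (f x * (w x)%:E))%E ->
  \int[n]_(x in D) F x = \int[m]_(x in D) (F x * w x).
Proof.
move=> mD mF w0 H; rewrite Rintegral_mkcond [RHS]Rintegral_mkcond /Rintegral; congr fine.
have mFD : measurable_fun setT (EFin \o (F \_ D)).
  by apply/measurable_EFinP/(measurable_restrictT _ mD).
rewrite integralE H; [|exact: measurable_funepos|by move=> x; exact: funepos_ge0].
rewrite H; [|exact: measurable_funeneg|by move=> x; exact: funeneg_ge0].
rewrite [RHS]integralE; congr (_ - _)%E; apply: eq_integral => x _.
  rewrite !funeposE !patchE; case: ifPn => _; last by rewrite maxxx mul0e.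
  by rewrite maxe_pMl ?lee_fin// mul0e EFinM.
rewrite !funenegE !patchE; case: ifPn => _; last by rewrite oppe0 maxxx mul0e.
by rewrite maxe_pMl ?lee_fin// mul0e -EFinM mulNr.
Qed.

Lemma Rintegral_gauss1 (D : set R) (F : R -> R) : measurable (D : set T1) ->
  measurable_fun (D : set T1) F ->
  \int[gauss1 R]_(x in D) F x = \int[leb]_(x in D) (F x * gw x).
Proof.
move=> mD mF; apply: Rintegral_density => //.
- by move=> x; exact/ltW/gw_gt0.
- by move=> f mf f0; rewrite ge0_integral_gauss1.
Qed.

Lemma Rintegral_gauss2 (D : set (R * R)) (F : R * R -> R) : measurable (D : set (T1 * T1)) ->
  measurable_fun (D : set (T1 * T1)) F ->
  \int[gauss2 R]_(x in D) F x = \int[lebesgue2 R]_(x in D) (F x * gw2 x).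
Proof.
move=> mD mF; apply: Rintegral_density => //.
- by move=> x; exact/ltW/gw2_gt0.
- by move=> f mf f0; rewrite ge0_integral_gauss2.
Qed.

Lemma gauss2_setT : gauss2 R setT = 1%E.
Proof.
have := @product_measure1E _ _ T1 T1 R (gauss1 R) (gauss1 R) setT setT measurableT measurableT.
rewrite setXTT => H; apply: (etrans H); rewrite -[RHS]mule1.
by congr (_ * _)%E; exact: probability_setT.
Qed.

Lemma gauss2_fin (D : set (T1 * T1)) : measurable D -> (gauss2 R D < +oo)%E.
Proof.
move=> mD; apply: (@le_lt_trans _ _ (gauss2 R setT)); last by rewrite gauss2_setT ltry.
by apply: le_measure; rewrite ?inE.
Qed.

Lemma gauss1_fin (D : set T1) : measurable D -> (gauss1 R D < +oo)%E.
Proof. by move=> mD; rewrite (le_lt_trans (probability_le1 _ mD))// ltry. Qed.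

Lemma L2_cst (D : set T1) (k : R) : measurable D -> L2 (gauss1 R) D (fun=> k).
Proof.
by move=> mD; apply: (@bounded_L2 _ _ _ _ _ mD (gauss1_fin mD) _ `|k|).
Qed.

Lemma integrable_cst1 (D : set T1) (k : R) : measurable D ->
  (gauss1 R).-integrable D (EFin \o (fun=> k)).
Proof.
by move=> mD; apply: (@bounded_integrable _ _ _ _ _ mD (gauss1_fin mD) _ `|k|).
Qed.

Lemma gauss1_setT : fine (gauss1 R setT) = 1.
Proof. exact: (congr1 fine (@probability_setT _ _ _ (gauss1 R))). Qed.

Lemma gauss1_one : \int[gauss1 R]_y (1 : R) = 1.
Proof.
by rewrite Rintegral_cst// mul1r; exact: gauss1_setT.
Qed.

End gaussians.

(** * The adjoint of the derivative on the line *)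

Section support.
Variables (R : realType).

Lemma test_function_compact (V : normedModType R) (U K : set V) (phi : V -> R) :
  smooth phi -> compact K -> K `<=` U -> (forall z, ~ K z -> phi z = 0) ->
  test_function U phi.
Proof.
move=> sphi cK KU phi0.
have clK : closure [set z | phi z != 0] `<=` K.
  have Kc : closed K by apply: compact_closed => //; exact: norm_hausdorff.
  rewrite [X in _ `<=` X](closure_id K).1//; apply: closureS => z /= phiz.
  by apply: contrapT => /phi0/eqP; apply/negP.
split => //; last exact: subset_trans KU.
by apply: subclosed_compact cK clK; exact: closed_closure.
Qed.

Lemma test_function_out (V : normedModType R) (U : set V) (phi : V -> R) z :
  test_function U phi -> ~ U z -> phi z = 0.
Proof.
move=> [_ _ sU] Uz; apply: contrapT => /eqP phiz; apply: Uz; apply: sU.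
exact: subset_closure.
Qed.

End support.

Section line.
Variable R : realType.
Local Notation T1 := (measurableTypeR R).
Local Notation leb := (@lebesgue_measure R).
Implicit Types (f g : R -> R) (b c : R).

(** The fundamental theorem of calculus on an interval that contains the
support. *)
Lemma integral_derive_compact f f' (M : R) :
  (forall x : R, is_derive x 1 f (f' x)) -> continuous f' ->
  (forall x, M < `|x| -> f x = 0) -> (\int[leb]_x (f' x)%:E = 0)%E.
Proof.
move=> ff' cf' f0.
have cf : continuous f.
  by move=> x; apply/differentiable_continuous/derivable1_diffP; case: (ff' x).
have f'0 x : M < `|x| -> f' x = 0.
  move=> Mx; have [_ <-] := ff' x.
  rewrite (@near_eq_derive _ _ _ f (cst 0)) ?derive_cst//.
  near=> y; apply: f0; near: y.
  by apply: (cvgr_gt `|x|) => //; apply: cvg_norm; exact: cvg_id.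
pose N : R := `|M| + 1.
have N0 : 0 < N by rewrite ltr_wpDl.
have NN : - N < N by rewrite gtrN.
have MN : M < N by rewrite (le_lt_trans (ler_norm _))// ltrDl.
rewrite (_ : (\int[leb]_x (f' x)%:E = \int[leb]_(x in `[(- N)%R, N]) (f' x)%:E)%E); last first.
  rewrite [RHS]integral_mkcond; apply: eq_integral => x _; rewrite patchE.
  case: ifPn => //; rewrite notin_setE/= in_itv/= => /negP.
  rewrite -ler_norml -ltNge => Nx; rewrite f'0//; exact: lt_trans Nx.
rewrite (@continuous_FTC2 _ f' f (- N) N)//.
- by rewrite !f0 ?subee// ?normrN gtr0_norm.
- exact: continuous_subspaceT.
- split.
  + by move=> x _; case: (ff' x).
  + by apply/cvg_at_right_filter; exact: cf.
  + by apply/cvg_at_left_filter; exact: cf.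
- by move=> x _; rewrite derive1E; case: (ff' x).
Unshelve. all: by end_near. Qed.

(** The supporting interval is carried as a pair of bounds, which may be in the
wrong order: [f] is then zero. *)
Definition csmooth b c f := smooth f /\ forall x, ~~ (b <= x <= c) -> f x = 0.

Lemma csmooth_out b c f x : csmooth b c f -> ~~ (b <= x <= c) -> f x = 0.
Proof. by move=> [_]; exact. Qed.

Lemma csmooth_empty b c f x : c < b -> csmooth b c f -> f x = 0.
Proof.
move=> cb [_]; apply; apply/negP => /andP[bx xc].
by have := le_lt_trans (le_trans bx xc) cb; rewrite ltxx.
Qed.

Lemma csmooth_smooth b c f : csmooth b c f -> smooth f.
Proof. by case. Qed.

Lemma csmooth0 b c : csmooth b c (fun=> 0).
Proof. by split => //; exact: smooth_cst. Qed.

Lemma csmoothD b c f g : csmooth b c f -> csmooth b c g -> csmooth b c (fun x => f x + g x).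
Proof.
by move=> [sf f0] [sg g0]; split; [exact: smoothD|move=> x h; rewrite f0// g0// addr0].
Qed.

Lemma csmoothM b c f g : smooth g -> csmooth b c f -> csmooth b c (fun x => g x * f x).
Proof.
by move=> sg [sf f0]; split; [exact: smoothM|move=> x h; rewrite f0// mulr0].
Qed.

Lemma csmoothZ b c k f : csmooth b c f -> csmooth b c (fun x => k * f x).
Proof. by apply: csmoothM; exact: smooth_cst. Qed.

Lemma csmoothB b c f g : csmooth b c f -> csmooth b c g -> csmooth b c (fun x => f x - g x).
Proof.
move=> hf hg; rewrite (_ : (fun x => _ - _) = fun x => f x + -1 * g x).
  by apply: csmoothD => //; exact: csmoothZ.
by apply/funext => x; rewrite mulN1r.
Qed.

Lemma csmooth_widen b c b' c' f : b' <= b -> c <= c' -> csmooth b c f -> csmooth b' c' f.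
Proof.
move=> bb cc [sf f0]; split => // x h; apply: f0; apply: contra h => /andP[bx xc].
by rewrite (le_trans bb bx) (le_trans xc cc).
Qed.

Lemma csmooth_plateau n b c : csmooth b c (plateau n b c).
Proof.
split; first exact: smooth_plateau.
by move=> x h; apply: plateau_out; apply: contra h => /andP[/ltW -> /ltW ->].
Qed.

Lemma csmooth_opp b c f : csmooth b c f -> csmooth (- c) (- b) (fun x : R => f (- x)).
Proof.
move=> [sf f0]; split; first exact: smooth_opp.
by move=> x h; apply: f0; apply: contra h; rewrite lerNr lerNl andbC.
Qed.

Lemma csmooth_derive b c f : csmooth b c f -> csmooth b c ('D_1 f).
Proof.
move=> [sf f0]; split; first exact: smooth_derive.
move=> x; rewrite negb_and -!ltNge => h.
rewrite (@near_eq_derive _ _ _ f (cst 0)) ?derive_cst//.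
case/orP: h => h; near=> y; apply: f0; rewrite negb_and -!ltNge.
- by apply/orP; left; near: y; exact: lt_nbhsl.
- by apply/orP; right; near: y; exact: lt_nbhsr.
Unshelve. all: by end_near. Qed.

Lemma csmooth_bounded b c f : csmooth b c f -> exists M, forall x, `|f x| <= M.
Proof.
move=> [sf f0]; have cf := smooth_continuous sf.
have [bc|cb] := leP b c; last first.
  by exists 0 => x; rewrite (csmooth_empty x cb (conj sf f0)) normr0.
have cn : {within `[b, c], continuous (fun x => `|f x|)}.
  by apply: continuous_subspaceT => x; apply: cvg_norm; exact: cf.
have [d _ dmax] := EVT_max bc cn; exists `|f d| => x.
have [xbc|xbc] := boolP (b <= x <= c); first by apply: dmax; rewrite in_itv.
by rewrite f0// normr0.
Qed.

Lemma smooth_measurable (D : set T1) f : measurable D -> smooth f -> measurable_fun D f.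
Proof.
move=> mD sf; apply: measurable_funTS; apply: continuous_measurable_fun.
exact: smooth_continuous.
Qed.

Lemma csmooth_L2 (D : set T1) b c f : measurable D -> csmooth b c f -> L2 (gauss1 R) D f.
Proof.
move=> mD hf; have [M fM] := csmooth_bounded hf.
apply: (@bounded_L2 _ _ _ _ _ mD (gauss1_fin mD) f M) => //.
by apply: smooth_measurable => //; case: hf.
Qed.

Lemma csmooth_integrable (D : set T1) b c f : measurable D -> csmooth b c f ->
  (gauss1 R).-integrable D (EFin \o f).
Proof.
move=> mD hf; have [M fM] := csmooth_bounded hf.
apply: (@bounded_integrable _ _ _ _ _ mD (gauss1_fin mD) f M) => //.
by apply: smooth_measurable => //; case: hf.
Qed.

Lemma csmooth_lebesgue_integrable b c f : csmooth b c f -> leb.-integrable setT (EFin \o f).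
Proof.
move=> hf; have cf := smooth_continuous (csmooth_smooth hf).
have H := @continuous_compact_integrable R f `[b, c] (@segment_compact _ _ _) (continuous_subspaceT cf).
have [K _] := @integrable_mkcond _ _ _ leb `[b, c] (EFin \o f) (measurable_itv _).
apply: eq_integrable (K H) => // x _.
rewrite patchE; case: ifPn => //; rewrite notin_setE/= in_itv/= => /negP h.
by rewrite (csmooth_out hf).
Qed.

(** The adjoint of the derivative for the Gaussian measure: the logarithmic
derivative of the density is -x. *)
Definition dstar f (x : R) : R := x * f x - 'D_1 f x.

Lemma dstarD f g x : smooth f -> smooth g ->
  dstar (fun t => f t + g t) x = dstar f x + dstar g x.
Proof.
move=> sf sg; rewrite /dstar.
have [_ ->] := is_derive1D (smooth_is_derive x sf) (smooth_is_derive x sg); ring.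
Qed.

Lemma dstarZ f k x : smooth f ->
  dstar (fun t => f t * k) x = dstar f x * k.
Proof.
move=> sf; rewrite /dstar.
have [_ ->] := is_derive1M (smooth_is_derive x sf) (is_derive1_cst x k); ring.
Qed.

Lemma csmooth_dstar b c f : csmooth b c f -> csmooth b c (dstar f).
Proof.
move=> hf; apply: csmoothB; last exact: csmooth_derive.
by apply: csmoothM => //; exact: smooth_id.
Qed.

(** [dstar f] times the density is the derivative of minus [f] times the
density. *)
Lemma integral_dstar b c f : csmooth b c f -> \int[gauss1 R]_x dstar f x = 0.
Proof.
move=> hf; have sf := csmooth_smooth hf.
rewrite Rintegral_gauss1//; last by apply: smooth_measurable => //; exact: csmooth_smooth (csmooth_dstar hf).
suff H : (\int[leb]_x (dstar f x * gw x)%:E = 0)%E by rewrite /Rintegral H.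
apply: (@integral_derive_compact (fun x => - (f x * gw x)) (fun x => dstar f x * gw x) (`|b| + `|c|)).
- move=> x; have h := is_derive1M (smooth_is_derive x sf) (is_derive_gw x).
  apply: (is_derive_eq (@is_deriveN _ _ _ _ _ _ _ h)).
  by rewrite /dstar; ring.
- apply: smooth_continuous; apply: smoothM; last exact: smooth_gw.
  exact: csmooth_smooth (csmooth_dstar hf).
- move=> x bcx; rewrite (csmooth_out hf) ?mul0r ?oppr0//.
  apply/negP => /andP[bx xc]; move: bcx; rewrite ltNge => /negP; apply.
  rewrite ler_norml; have := normr_ge0 b; have := normr_ge0 c.
  by have := ler_norm c; have := lerNnormlW (lexx `|b|); move=> *; apply/andP; split; lra.
Qed.

(** The commutation of the derivative with its adjoint, in integrated form: the
difference of the integrands is [dstar] of x f(x)^2, whose integral vanishes. *)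
Lemma nsq_dstar b c f : csmooth b c f ->
  \int[gauss1 R]_x (dstar f x ^+ 2) =
  \int[gauss1 R]_x (f x ^+ 2) + \int[gauss1 R]_x ('D_1 f x ^+ 2).
Proof.
move=> hf; have hf' := csmooth_derive hf; have sf := csmooth_smooth hf.
have mT : measurable [set: T1] by [].
have h2 : csmooth b c (fun x => x * f x ^+ 2).
  rewrite (_ : (fun x => _) = fun x => (x * f x) * f x).
    by apply: csmoothM => //; apply: smoothM => //; exact: smooth_id.
  by apply/funext => x; rewrite -mulrA.
have [_ If] := csmooth_L2 mT hf; have [_ If'] := csmooth_L2 mT hf'.
have If2 : (gauss1 R).-integrable setT (EFin \o (fun x => f x ^+ 2 + 'D_1 f x ^+ 2)).
  exact: (integrableD mT If If').
rewrite -(RintegralD mT If If').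
transitivity (\int[gauss1 R]_x (f x ^+ 2 + 'D_1 f x ^+ 2 + dstar (fun x => x * f x ^+ 2) x)).
  apply: eq_Rintegral => x _; cbv beta.
  have E : 'D_1 (fun x : R => x * f x ^+ 2) x = f x ^+ 2 + 2 * x * f x * 'D_1 f x.
    have hd := smooth_is_derive x sf.
    have h := is_derive1M (is_derive1_id x) (is_derive1M hd hd).
    by have [_ ->] := h; ring.
  by rewrite /dstar E; ring.
rewrite (RintegralD mT If2 (csmooth_integrable mT (csmooth_dstar h2))).
by rewrite (integral_dstar h2) addr0.
Qed.

(** Bootstrapping: the combinations p A + q with smooth p and q are stable
under differentiation, as the equation trades the derivative of A for A and f. *)
Lemma smooth_ode (f A : R -> R) : smooth f ->
  (forall x : R, is_derive x 1 A (x * A x - f x)) -> smooth A.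
Proof.
move=> sf dA; apply: (@smooth_class _ (fun g : R -> R => exists p q : R -> R,
    [/\ smooth p, smooth q & g = fun x : R => p x * A x + q x])); last first.
  exists (fun=> 1), (fun=> 0); split; [exact: smooth_cst|exact: smooth_cst|].
  by apply/funext => x; rewrite mul1r addr0.
move=> _ [p [q [sp sq ->]]].
exists (fun x => ('D_1 p x + p x * x) * A x + ('D_1 q x - p x * f x)).
  eexists; eexists; split; [| |reflexivity].
  - apply: smoothD; first exact: smooth_derive.
    by apply: smoothM => //; exact: smooth_id.
  - by apply: smoothB; [exact: smooth_derive|exact: smoothM].
move=> x; apply: (is_derive_eq (is_derive1D (is_derive1M (smooth_is_derive x sp) (dA x)) (smooth_is_derive x sq))).
by ring.
Qed.

(** The equation [dstar A = f] has the solution A = - F / w, where w is the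
density and F(x) is the integral of f w up to x.  It vanishes before the
support of [f], and after it because [f] has mean zero. *)
Lemma dstar_preimage b c f : csmooth b c f -> \int[gauss1 R]_x f x = 0 ->
  exists2 A, csmooth b c A & forall x, dstar A x = f x.
Proof.
move=> hf f0; have sf := csmooth_smooth hf.
have mT : measurable [set: T1] by [].
pose h x := f x * gw x.
have hh : csmooth b c h.
  have := csmoothM (@smooth_gw R) hf; congr csmooth.
  by apply/funext => x; rewrite mulrC.
have Ih : leb.-integrable setT (EFin \o h) := csmooth_lebesgue_integrable hh.
have IhD (D : set T1) : measurable D -> leb.-integrable D (EFin \o h).
  by move=> mD; exact: (@integrableS _ _ _ _ setT).
pose F x := \int[leb]_(t in `]-oo, x]) h t.
have dF (x : R) : is_derive x 1 F (h x).
  have := @continuous_FTC1 R h -oo%O x (x + 1).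
  rewrite ltrDl ltr01 => /(_ erefl (IhD _ (measurable_itv _)) (ltNyr _)).
  move=> /(_ (@smooth_continuous _ _ _ (csmooth_smooth hh) x)) [d1 d2].
  by apply: DeriveDef; [exact: d1|rewrite -derive1E; exact: d2].
have Fb x : x < b -> F x = 0.
  move=> xb; rewrite /F (@eq_Rintegral _ _ _ _ _ (cst 0)) ?Rintegral_cst ?mul0r//.
  move=> t; rewrite inE/= in_itv/= => tx; rewrite (csmooth_out hh)//.
  by rewrite negb_and -ltNge (le_lt_trans tx).
have Fc x : c < x -> F x = 0.
  move=> cx; rewrite -f0 Rintegral_gauss1//; last exact: smooth_measurable.
  rewrite /F Rintegral_mkcond; apply: eq_Rintegral => t _.
  rewrite patchE; case: ifPn => //; rewrite notin_setE/= in_itv/= => /negP.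
  rewrite -ltNge => xt; apply/esym/(csmooth_out hh).
  by rewrite negb_and -!ltNge (lt_trans cx) ?orbT.
pose A x := - F x / gw x.
have gn0 (x : R) : gw x != 0 by rewrite gt_eqF// gw_gt0.
have dA (x : R) : is_derive x 1 A (x * A x - f x).
  have dV : is_derive x 1 (fun x : R => (gw x)^-1) (x / gw x).
    have h1 := is_derive_gw x; have [h2 h3] := h1.
    apply: DeriveDef; first exact: (@derivableV R R (@gw R) x 1 (gn0 x) h2).
    by rewrite (@deriveV R R (@gw R) x 1 (gn0 x) h2) h3 /GRing.scale/= expr2; field.
  have dN : is_derive x 1 (fun x : R => - F x) (- h x) by exact: is_deriveN.
  by apply: (is_derive_eq (is_derive1M dN dV)); rewrite /A /h; field.
have sA : smooth A := smooth_ode sf dA.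
exists A; last by move=> x; rewrite /dstar; have [_ ->] := dA x; ring.
split => // x; rewrite negb_and -!ltNge /A => /orP[/Fb->|/Fc->];
  by rewrite oppr0 mul0r.
Qed.

End line.

(** * Tensor products in the plane *)

Section product_integrals.
Variable R : realType.
Local Notation T1 := (measurableTypeR R).
Implicit Types (f g : R -> R).

Lemma measurable_tensor f g : measurable_fun [set: T1] f -> measurable_fun [set: T1] g ->
  measurable_fun [set: T1 * T1] (fun z : R * R => f z.1 * g z.2).
Proof.
move=> mf mg; apply: measurable_funM.
  by apply: (measurableT_comp mf).
by apply: (measurableT_comp mg).
Qed.

Lemma integrable_tensorT f g :
  (gauss1 R).-integrable setT (EFin \o f) -> (gauss1 R).-integrable setT (EFin \o g) ->
  (gauss2 R).-integrable setT (EFin \o (fun z : R * R => f z.1 * g z.2)).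
Proof.
move=> If Ig; have [mf ff] := integrableP _ _ _ If; have [mg gg] := integrableP _ _ _ Ig.
move/measurable_EFinP : (mf) => mf'; move/measurable_EFinP : (mg) => mg'.
apply/integrable12ltyP.
  by apply/measurable_EFinP; exact: measurable_tensor.
rewrite (_ : (\int[_]_x _ = \int[gauss1 R]_x (`|(f x)%:E| * \int[gauss1 R]_y `|(g y)%:E|))%E).
  rewrite ge0_integralZr//.
  - by rewrite lte_mul_pinfty// ?integral_ge0// ge0_fin_numE ?integral_ge0.
  - exact: measurableT_comp.
  - exact: integral_ge0.
apply: eq_integral => x _; rewrite -ge0_integralZl//.
- by apply: eq_integral => y _; rewrite /= normrM EFinM.
- exact: measurableT_comp.
Qed.

Lemma Rintegral_tensorT f g :
  (gauss1 R).-integrable setT (EFin \o f) -> (gauss1 R).-integrable setT (EFin \o g) ->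
  \int[gauss2 R]_z (f z.1 * g z.2) = \int[gauss1 R]_x f x * \int[gauss1 R]_y g y.
Proof.
move=> If Ig; have I2 := integrable_tensorT If Ig.
rewrite /Rintegral -integral12_prod_meas1//.
rewrite -fineM; [|exact: integrable_fin_num..]; congr fine.
rewrite -(fineK (integrable_fin_num _ Ig))// -integralZr//.
apply: eq_integral => x _; rewrite /fubini_F (fineK (integrable_fin_num _ Ig))//.
by rewrite -integralZl.
Qed.

Variable I : set R.
Hypothesis mI : measurable (I : set T1).
Local Notation S := (I `*` [set: R]).

Lemma measurable_cylinder : measurable (S : set (T1 * T1)).
Proof. exact: measurableX. Qed.

Let patch_tensor f g (z : R * R) :
  ((fun z => f z.1 * g z.2) \_ S) z = (f \_ I) z.1 * g z.2.
Proof.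
rewrite !patchE (_ : (z \in S) = (z.1 \in I)); last by rewrite in_setX in_setT andbT.
by case: ifPn => // _; rewrite mul0r.
Qed.

Lemma integrable_tensor f g :
  (gauss1 R).-integrable I (EFin \o f) -> (gauss1 R).-integrable setT (EFin \o g) ->
  (gauss2 R).-integrable S (EFin \o (fun z : R * R => f z.1 * g z.2)).
Proof.
move=> If Ig; apply/(integrable_mkcond _ measurable_cylinder).2; rewrite restrict_EFin.
rewrite (_ : _ \_ _ = fun z => (f \_ I) z.1 * g z.2); last by apply/funext => z; rewrite patch_tensor.
by apply: integrable_tensorT => //; rewrite -restrict_EFin; apply/(integrable_mkcond _ mI).1.
Qed.

Lemma Rintegral_tensor f g :
  (gauss1 R).-integrable I (EFin \o f) -> (gauss1 R).-integrable setT (EFin \o g) ->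
  \int[gauss2 R]_(z in S) (f z.1 * g z.2) =
  \int[gauss1 R]_(x in I) f x * \int[gauss1 R]_y g y.
Proof.
move=> If Ig; rewrite Rintegral_mkcond.
under eq_Rintegral do rewrite patch_tensor.
rewrite Rintegral_tensorT// -?Rintegral_mkcond//.
by rewrite -restrict_EFin; apply/(integrable_mkcond _ mI).1.
Qed.

Lemma L2_tensor f g : L2 (gauss1 R) I f -> L2 (gauss1 R) setT g ->
  L2 (gauss2 R) S (fun z : R * R => f z.1 * g z.2).
Proof.
move=> [mf If] [mg Ig]; split.
  apply/(measurable_restrictT _ measurable_cylinder).
  rewrite (_ : _ \_ _ = fun z => (f \_ I) z.1 * g z.2); last by apply/funext => z; rewrite patch_tensor.
  by apply: measurable_tensor => //; exact/(measurable_restrictT _ mI).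
have := @integrable_tensor (fun x => f x ^+ 2) (fun x => g x ^+ 2) If Ig.
by apply: eq_integrable => // [|z _ /=]; [exact: measurable_cylinder|rewrite exprMn].
Qed.

Lemma nsq_tensor f g : L2 (gauss1 R) I f -> L2 (gauss1 R) setT g ->
  \int[gauss2 R]_(z in S) (f z.1 * g z.2) ^+ 2 =
  \int[gauss1 R]_(x in I) (f x ^+ 2) * \int[gauss1 R]_y (g y ^+ 2).
Proof.
move=> [mf If] [mg Ig]; rewrite -(@Rintegral_tensor (fun x => f x ^+ 2) (fun x => g x ^+ 2))//.
by apply: eq_Rintegral => z _; rewrite exprMn.
Qed.

(** Approximating f, then g, uses the splitting f g - al be = (f - al) g + al
(g - be): the second error is chosen once [al] is known. *)
Lemma closure_tensor (A B : (R -> R) -> Prop) (C : (R * R -> R) -> Prop) f g :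
  (forall al be, A al -> B be -> C (fun z => al z.1 * be z.2)) ->
  L2_closure (gauss1 R) I A f -> L2_closure (gauss1 R) setT B g ->
  L2_closure (gauss2 R) S C (fun z => f z.1 * g z.2).
Proof.
move=> ABC [hf cf] [hg cg]; split; first exact: L2_tensor.
have mT : measurable [set: T1] by [].
move=> eps e0.
set Ng := \int[gauss1 R]_x (g x ^+ 2).
have Ng0 : 0 <= Ng by exact: nsq_ge0.
have [al [cal hal fal]] := cf (eps / (4 * (Ng + 1))) (divr_gt0 e0 (mulr_gt0 (ltr0n _ 4) (ltr_wpDl Ng0 ltr01))).
set Na := \int[gauss1 R]_(x in I) (al x ^+ 2).
have Na0 : 0 <= Na by exact: nsq_ge0.
have [be [cbe hbe gbe]] := cg (eps / (4 * (Na + 1))) (divr_gt0 e0 (mulr_gt0 (ltr0n _ 4) (ltr_wpDl Na0 ltr01))).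
exists (fun z => al z.1 * be z.2); split.
- exact: ABC.
- exact: L2_tensor.
have hfa := L2B mI hf hal; have hgb := L2B mT hg hbe.
have E : \int[gauss2 R]_(z in S) (f z.1 * g z.2 - al z.1 * be z.2) ^+ 2 =
    \int[gauss2 R]_(z in S) ((f z.1 - al z.1) * g z.2 + al z.1 * (g z.2 - be z.2)) ^+ 2.
  by apply: eq_Rintegral => z _; congr (_ ^+ 2); ring.
rewrite E; apply: le_lt_trans.
  exact: (nsqD_le measurable_cylinder (L2_tensor hfa hg) (L2_tensor hal hgb)).
rewrite (nsq_tensor hfa hg) (nsq_tensor hal hgb) -/Ng -/Na.
move: fal gbe; rewrite !ltr_pdivlMr ?mulr_gt0 ?ltr_wpDl//.
set X := \int[gauss1 R]_(x in I) (f x - al x) ^+ 2; set Y := \int[gauss1 R]_x (g x - be x) ^+ 2.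
have X0 : 0 <= X by exact: nsq_ge0.
have Y0 : 0 <= Y by exact: nsq_ge0.
by nra.
Qed.

End product_integrals.

Section partial.
Variable R : realType.

Let shiftx (h x y : R) : h *: (1, 0) + (x, y) = (h *: 1 + x, y) :> R * R.
Proof. by apply: injective_projections; rewrite /= ?scaler0 ?add0r. Qed.

Let shifty (h x y : R) : h *: (0, 1) + (x, y) = (x, h *: 1 + y) :> R * R.
Proof. by apply: injective_projections; rewrite /= ?scaler0 ?add0r. Qed.

Lemma derivable_x (f : R * R -> R) (x y : R) :
  derivable f (x, y) (1, 0) <-> derivable (fun t : R => f (t, y)) x 1.
Proof.
rewrite /derivable; set F := (X in cvg (X @ _) <-> _); set G := (X in _ <-> cvg (X @ _)).
by rewrite (_ : F = G)//; apply/funext => h; rewrite /F /G /shift /= shiftx.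
Qed.

Lemma derive_x (f : R * R -> R) (x y : R) :
  'D_(1, 0) f (x, y) = 'D_1 (fun t : R => f (t, y)) x.
Proof.
rewrite /derive; set F := (X in lim (X @ _) = _); set G := (X in _ = lim (X @ _)).
by rewrite (_ : F = G)//; apply/funext => h; rewrite /F /G /shift /= shiftx.
Qed.

Lemma derivable_y (f : R * R -> R) (x y : R) :
  derivable f (x, y) (0, 1) <-> derivable (fun t : R => f (x, t)) y 1.
Proof.
rewrite /derivable; set F := (X in cvg (X @ _) <-> _); set G := (X in _ <-> cvg (X @ _)).
by rewrite (_ : F = G)//; apply/funext => h; rewrite /F /G /shift /= shifty.
Qed.

Lemma derive_y (f : R * R -> R) (x y : R) :
  'D_(0, 1) f (x, y) = 'D_1 (fun t : R => f (x, t)) y.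
Proof.
rewrite /derive; set F := (X in lim (X @ _) = _); set G := (X in _ = lim (X @ _)).
by rewrite (_ : F = G)//; apply/funext => h; rewrite /F /G /shift /= shifty.
Qed.

End partial.

Section tensors.
Variable R : realType.
Local Notation T1 := (measurableTypeR R).
Implicit Types (Omega : set (R * R)) (phi psi : R * R -> R).

(** Test functions on which an operator acting on one variable can be computed
factor by factor, and whose supports stay in [Omega] when a factor is replaced
by another one with the same bounds. *)
Inductive tens Omega : (R * R -> R) -> Prop :=
| tens0 : tens Omega (fun=> 0)
| tensS phi (b c d e : R) (al be : R -> R) :
    tens Omega phi -> csmooth b c al -> csmooth d e be ->
    (forall x y, b <= x <= c -> d <= y <= e -> Omega (x, y)) ->
    tens Omega (fun z => phi z + al z.1 * be z.2).

Lemma tens1 Omega (b c d e : R) (al be : R -> R) :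
  csmooth b c al -> csmooth d e be ->
  (forall x y, b <= x <= c -> d <= y <= e -> Omega (x, y)) ->
  tens Omega (fun z => al z.1 * be z.2).
Proof.
move=> ha hb hO; have := tensS (tens0 Omega) ha hb hO.
by under eq_fun do rewrite add0r.
Qed.

Lemma tensD Omega phi psi : tens Omega phi -> tens Omega psi ->
  tens Omega (fun z => phi z + psi z).
Proof.
move=> hphi; elim=> [|psi' b c d e al be hpsi IH ha hb hO].
  by under eq_fun do rewrite addr0.
by under eq_fun do rewrite addrA; exact: tensS IH ha hb hO.
Qed.

Lemma tensZ Omega k phi : tens Omega phi -> tens Omega (fun z => k * phi z).
Proof.
elim=> [|psi' b c d e al be hpsi IH ha hb hO].
  by under eq_fun do rewrite mulr0; exact: tens0.
under eq_fun do rewrite mulrDr mulrA.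
exact: (tensS IH (csmoothZ k ha) hb hO).
Qed.

Lemma tens_smooth Omega phi : tens Omega phi -> smooth phi.
Proof.
elim=> [|psi' b c d e al be hpsi IH ha hb hO]; first exact: smooth_cst.
apply: smoothD => //; apply: smoothM.
- by apply: smooth_fst; exact: csmooth_smooth ha.
- by apply: smooth_snd; exact: csmooth_smooth hb.
Qed.

Lemma tens_support Omega phi : tens Omega phi ->
  exists K, [/\ compact K, K `<=` Omega & forall z, ~ K z -> phi z = 0].
Proof.
elim=> [|psi' b c d e al be hpsi [K [cK KO K0]] ha hb hO].
  by exists set0; split => //; exact: compact0.
exists (K `|` `[b, c] `*` `[d, e]); split.
- by apply: compactU => //; apply: compact_setX; exact: segment_compact.
- move=> [x y] [/KO//|/= [] /[!in_itv]/= h1 h2]; exact: hO.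
- move=> [x y] /not_orP[/K0 -> nbox]; rewrite add0r /=.
  have [hx|hx] := boolP (b <= x <= c); last by rewrite (csmooth_out ha)// mul0r.
  have [hy|hy] := boolP (d <= y <= e); last by rewrite (csmooth_out hb)// mulr0.
  by exfalso; apply: nbox; split; rewrite /= in_itv.
Qed.

Lemma tens_test Omega phi : tens Omega phi -> test_function Omega phi.
Proof.
move=> hphi; have [K [cK KO K0]] := tens_support hphi.
exact: test_function_compact (tens_smooth hphi) cK KO K0.
Qed.

Lemma tens_out Omega phi z : tens Omega phi -> ~ Omega z -> phi z = 0.
Proof. by move=> /tens_test; exact: test_function_out. Qed.

Lemma tens_bounded Omega phi : tens Omega phi -> exists M, forall z, `|phi z| <= M.
Proof.
elim=> [|psi' b c d e al be hpsi [M HM] ha hb hO]; first by exists 0 => z; rewrite normr0.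
have [Ma Ha] := csmooth_bounded ha; have [Mb Hb] := csmooth_bounded hb.
exists (M + Ma * Mb) => z; rewrite (le_trans (ler_normD _ _))// lerD//.
by rewrite normrM ler_pM.
Qed.

Lemma tens_measurable Omega phi : tens Omega phi -> measurable_fun [set: T1 * T1] phi.
Proof.
elim=> [|psi' b c d e al be hpsi IH ha hb hO]; first exact: measurable_cst.
apply: measurable_funD => //; apply: measurable_tensor.
- by apply: smooth_measurable => //; exact: csmooth_smooth ha.
- by apply: smooth_measurable => //; exact: csmooth_smooth hb.
Qed.

Lemma tens_L2 Omega phi (D : set (T1 * T1)) : measurable D -> tens Omega phi -> L2 (gauss2 R) D phi.
Proof.
move=> mD hphi; have [M HM] := tens_bounded hphi.
apply: (@bounded_L2 _ _ _ _ _ mD (gauss2_fin mD) phi M) => //.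
by apply: measurable_funTS; exact: tens_measurable hphi.
Qed.

(** Multiplying by the weight turns a Gaussian test function into one for the
Lebesgue measure. *)
Lemma tens_gw2 Omega phi : tens Omega phi -> tens Omega (fun z => phi z * gw2 z).
Proof.
elim=> [|psi' b c d e al be hpsi IH ha hb hO].
  by under eq_fun do rewrite mul0r; exact: tens0.
have := tensS IH (csmoothM (@smooth_gw R) ha) (csmoothM (@smooth_gw R) hb) hO.
by congr tens; apply/funext => z; rewrite /gw2; ring.
Qed.

Definition dstar1 phi (z : R * R) : R := z.1 * phi z - 'D_(1, 0) phi z.

Lemma dstar1E phi x y : dstar1 phi (x, y) = dstar (fun t => phi (t, y)) x.
Proof. by rewrite /dstar1 /dstar derive_x. Qed.

Lemma smooth_slice phi y : smooth phi -> smooth (fun x : R => phi (x, y)).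
Proof.
move=> sphi k; have := sphi k; elim: k phi {sphi} => [|k IH] phi Cphi.
  split => // x _; apply: continuous_comp; last exact: (CkT_continuous Cphi).
  by apply: (@cvg_pair _ _ _ (nbhs x) (nbhs x) (nbhs y) _ _ _ (fun t : R => t) (fun=> y)); [exact: cvg_id|exact: cvg_cst].
have [cphi dphi] := Cphi; have [d10 C10] := dphi (1, 0).
have C' := IH _ C10.
have hd (x : R) : is_derive x 1 (fun x : R => phi (x, y)) ('D_(1, 0) phi (x, y)).
  by apply: DeriveDef; [apply/derivable_x; exact: d10|rewrite derive_x].
split.
  by move=> x _; apply/differentiable_continuous/derivable1_diffP; case: (hd x).
move=> v; split; first by move=> z _; case: (derive1_dir v (hd z)).
rewrite (_ : 'D_v _ = fun x : R => v * 'D_(1, 0) phi (x, y)); first exact: CkZ.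
by apply/funext => x; case: (derive1_dir v (hd x)).
Qed.

Lemma smooth_slice2 phi x : smooth phi -> smooth (fun y : R => phi (x, y)).
Proof.
move=> sphi k; have := sphi k; elim: k phi {sphi} => [|k IH] phi Cphi.
  split => // y _; apply: continuous_comp; last exact: (CkT_continuous Cphi).
  by apply: (@cvg_pair _ _ _ (nbhs y) (nbhs x) (nbhs y) _ _ _ (fun=> x) (fun t : R => t)); [exact: cvg_cst|exact: cvg_id].
have [cphi dphi] := Cphi; have [d01 C01] := dphi (0, 1).
have C' := IH _ C01.
have hd (y : R) : is_derive y 1 (fun y : R => phi (x, y)) ('D_(0, 1) phi (x, y)).
  by apply: DeriveDef; [apply/derivable_y; exact: d01|rewrite derive_y].
split.
  by move=> y _; apply/differentiable_continuous/derivable1_diffP; case: (hd y).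
move=> v; split; first by move=> z _; case: (derive1_dir v (hd z)).
rewrite (_ : 'D_v _ = fun y : R => v * 'D_(0, 1) phi (x, y)); first exact: CkZ.
by apply/funext => y; case: (derive1_dir v (hd y)).
Qed.

Lemma dstar1S phi (al be : R -> R) : smooth phi -> smooth al ->
  dstar1 (fun z => phi z + al z.1 * be z.2) = fun z => dstar1 phi z + dstar al z.1 * be z.2.
Proof.
move=> sphi sal; apply/funext => -[x y]; rewrite !dstar1E /=.
rewrite dstarD ?dstarZ//; first exact: smooth_slice.
by apply: smoothM => //; exact: smooth_cst.
Qed.

Lemma tens_dstar1 Omega phi : tens Omega phi -> tens Omega (dstar1 phi).
Proof.
elim=> [|psi' b c d e al be hpsi IH ha hb hO].
  rewrite (_ : dstar1 _ = fun=> 0); first exact: tens0.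
  apply/funext => -[x y]; rewrite dstar1E /dstar mulr0 sub0r.
  by rewrite derive_cst oppr0.
rewrite dstar1S; [|exact: tens_smooth hpsi|exact: csmooth_smooth ha].
exact: (tensS IH (csmooth_dstar ha) hb hO).
Qed.

(** Only the tensors whose second factor lives at height [y] contribute; their
first factors are supported inside the slice of [Omega] at height [y]. *)
Lemma tens_slice Omega (I : set R) phi y : (forall z, Omega z -> I z.1) ->
  tens Omega phi -> test_function I (fun x : R => phi (x, y)) /\
    exists M, csmooth (- M) M (fun x : R => phi (x, y)).
Proof.
move=> OI hphi; have ss := smooth_slice y (tens_smooth hphi).
suff [K [cK KI K0]] : exists K, [/\ compact K, K `<=` I & forall x, ~ K x -> phi (x, y) = 0].
  split; first exact: test_function_compact ss cK KI K0.
  have [M [_ HM]] := compact_bounded cK.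
  exists (`|M| + 1); split => // x; rewrite -ler_norml => hx.
  apply: K0 => Kx; move/negP: hx; apply.
  by apply: (HM (`|M| + 1)) => //; rewrite (le_lt_trans (ler_norm M))// ltrDl.
elim: hphi {ss} => [|psi' b c d e al be hpsi [K [cK KI K0]] ha hb hO].
  by exists set0; split => //; exact: compact0.
have [hy|hy] := boolP (d <= y <= e); last first.
  by exists K; split => // x /K0 ->; rewrite /= (csmooth_out hb)// mulr0 addr0.
exists (K `|` `[b, c]); split.
- by apply: compactU => //; exact: segment_compact.
- by move=> x [/KI//|/= /[!in_itv]/= hx]; exact: (OI _ (hO x y hx hy)).
- move=> x /not_orP[/K0 -> /= hx]; rewrite (csmooth_out ha) ?mul0r ?addr0//.
  by apply/negP => h; apply: hx; rewrite in_itv.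
Qed.

End tensors.

(** * Integration by parts, slices and reflection *)

Section weak.
Variable R : realType.
Local Notation T1 := (measurableTypeR R).
Implicit Types (Omega : set (R * R)) (phi psi u g : R * R -> R).

(** The weak derivative is defined with the Lebesgue measure; testing it with
[phi] times the Gaussian weight gives the Gaussian integration by parts, for
the adjoint [psi] of the derivative of [phi]. *)
Lemma weak_partial_gauss Omega (v : R * R) u g phi psi :
  measurable (Omega : set (T1 * T1)) -> weak_partial Omega v u g ->
  L2 (gauss2 R) Omega u -> L2 (gauss2 R) Omega g ->
  L2 (gauss2 R) Omega phi -> L2 (gauss2 R) Omega psi ->
  test_function Omega (fun z => phi z * gw2 z) ->
  (forall z, 'D_v (fun z => phi z * gw2 z) z = - (psi z * gw2 z)) ->
  \int[gauss2 R]_(z in Omega) (u z * psi z) = \int[gauss2 R]_(z in Omega) (g z * phi z).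
Proof.
move=> mO wu hu hg hphi hpsi tphi Dphi.
have [[mu _] [mg _] [mphi _] [mpsi _]] := And4 hu hg hphi hpsi.
have := wu _ tphi; under eq_Rintegral do rewrite Dphi.
move=> H; rewrite Rintegral_gauss2//; last exact: measurable_funM.
rewrite [RHS]Rintegral_gauss2//; last exact: measurable_funM.
under [RHS]eq_Rintegral do rewrite -mulrA.
apply: oppr_inj; rewrite -H.
have := @Rintegral_gauss2 R Omega (fun z => -1 * (u z * psi z)) mO _.
rewrite (RintegralZl (-1) mO (L2_integrableM mO hu hpsi)) => H2.
have := @Rintegral_gauss2 R Omega (fun z => u z * psi z) mO _.
move: H2 => /[swap] <-; last exact: measurable_funM.
move=> H2; rewrite -mulN1r H2; last first.
  by apply: measurable_funM => //; exact: measurable_funM.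
by apply: eq_Rintegral => z _; ring.
Qed.

Lemma weak_dstar1 Omega u g phi :
  measurable (Omega : set (T1 * T1)) -> weak_partial Omega (1, 0) u g ->
  L2 (gauss2 R) Omega u -> L2 (gauss2 R) Omega g -> tens Omega phi ->
  \int[gauss2 R]_(z in Omega) (u z * dstar1 phi z) = \int[gauss2 R]_(z in Omega) (g z * phi z).
Proof.
move=> mO wu hu hg hphi; apply: (weak_partial_gauss mO wu) => //.
- exact: tens_L2 hphi.
- exact: tens_L2 (tens_dstar1 hphi).
- exact: tens_test (tens_gw2 hphi).
- move=> [x y]; rewrite derive_x dstar1E /dstar /gw2/=.
  have sphi := smooth_slice y (tens_smooth hphi).
  have h := is_derive1M (smooth_is_derive x sphi) (is_derive1M (is_derive_gw x) (is_derive1_cst x (gw y))).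
  by have [_ ->] := h; ring.
Qed.

Lemma weak_dstar2 Omega u g (b c d e : R) (al be : R -> R) :
  measurable (Omega : set (T1 * T1)) -> weak_partial Omega (0, 1) u g ->
  L2 (gauss2 R) Omega u -> L2 (gauss2 R) Omega g ->
  csmooth b c al -> csmooth d e be ->
  (forall x y, b <= x <= c -> d <= y <= e -> Omega (x, y)) ->
  \int[gauss2 R]_(z in Omega) (u z * (al z.1 * dstar be z.2)) =
  \int[gauss2 R]_(z in Omega) (g z * (al z.1 * be z.2)).
Proof.
move=> mO wu hu hg ha hb hO; have hphi := tens1 ha hb hO.
apply: (@weak_partial_gauss _ _ _ _ (fun z => al z.1 * be z.2) (fun z => al z.1 * dstar be z.2) mO wu) => //.
- exact: tens_L2 hphi.
- exact: tens_L2 (tens1 ha (csmooth_dstar hb) hO).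
- exact: tens_test (tens_gw2 hphi).
- move=> [x y]; rewrite derive_y /dstar /gw2/=.
  have h := is_derive1M (is_derive1Z (al x) (smooth_is_derive y (csmooth_smooth hb)))
    (is_derive1Z (gw x) (is_derive_gw y)).
  by have [_ ->] := h; ring.
Qed.

(** Tonelli: the inequality on the line is integrated over the slices. *)
Lemma slice_inequality Omega (I : set R) (kappa : R) phi : 0 <= kappa ->
  (forall z, Omega z -> I z.1) ->
  (forall f (M : R), test_function I f -> csmooth (- M) M f ->
     kappa * \int[gauss1 R]_x (f x ^+ 2) <= \int[gauss1 R]_x (dstar f x ^+ 2)) ->
  tens Omega phi ->
  kappa * \int[gauss2 R]_z (phi z ^+ 2) <= \int[gauss2 R]_z (dstar1 phi z ^+ 2).
Proof.
move=> k0 OI H hphi.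
have mT : measurable [set: T1 * T1] by [].
have mT1 : measurable [set: T1] by [].
have hd := tens_dstar1 hphi.
have [mphi Iphi] := tens_L2 mT hphi; have [md Id] := tens_L2 mT hd.
have mphi2 : measurable_fun [set: T1 * T1] (fun z => (phi z ^+ 2)%:E).
  exact: (measurable_int (gauss2 R)).
have md2 : measurable_fun [set: T1 * T1] (fun z => (dstar1 phi z ^+ 2)%:E).
  exact: (measurable_int (gauss2 R)).
have p0 z : (0 <= (phi z ^+ 2)%:E)%E by rewrite lee_fin sqr_ge0.
have d0 z : (0 <= (dstar1 phi z ^+ 2)%:E)%E by rewrite lee_fin sqr_ge0.
rewrite -lee_fin EFinM /Rintegral !fineK; [|exact: integrable_fin_num..].
rewrite (fubini_tonelli2 _ mphi2 p0) (fubini_tonelli2 _ md2 d0).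
rewrite -ge0_integralZl//; last 2 first.
- exact: (measurable_fun_fubini_tonelli_G _ mphi2 p0).
- by move=> y _; apply: integral_ge0.
apply: ge0_le_integral => //.
- by move=> y _; apply: mule_ge0; [rewrite lee_fin|exact: integral_ge0].
- by apply: measurable_funeM; exact: (measurable_fun_fubini_tonelli_G _ mphi2 p0).
- exact: (measurable_fun_fubini_tonelli_G _ md2 d0).
move=> y _; rewrite /fubini_G.
have [tf [M cf]] := tens_slice y OI hphi.
have [_ If] := csmooth_L2 mT1 cf; have [_ Id'] := csmooth_L2 mT1 (csmooth_dstar cf).
have := H _ _ tf cf; rewrite -lee_fin EFinM /Rintegral !fineK; [|exact: integrable_fin_num..].
by move/le_trans; apply; rewrite le_eqVlt; apply/orP; left; apply/eqP/eq_integral => x _; rewrite dstar1E.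
Qed.

End weak.

Section reflection.
Variable R : realType.
Local Notation T1 := (measurableTypeR R).
Local Notation leb := (@lebesgue_measure R).

Lemma gwN (x : R) : gw (- x) = gw x.
Proof. by rewrite !gwE sqrrN. Qed.

Let mopp : measurable_fun [set: T1] (-%R : T1 -> T1).
Proof. by apply: continuous_measurable_fun => x; exact: opp_continuous. Qed.

Lemma ge0_integral_gauss1N (f : R -> \bar R) : measurable_fun [set: T1] f ->
  (forall x, 0 <= f x)%E -> (\int[gauss1 R]_x f (- x)%R = \int[gauss1 R]_x f x)%E.
Proof.
move=> mf f0.
have mfN : measurable_fun [set: T1] (fun x : R => f (- x)) by exact: (measurableT_comp mf mopp).
rewrite !ge0_integral_gauss1//.
have mg : measurable_fun [set: T1] (fun x => f x * (gw x)%:E)%E.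
  by apply: emeasurable_funM => //; apply/measurable_EFinP; exact: measurable_gw.
transitivity (\int[pushforward leb (-%R : T1 -> T1)]_x (f x * (gw x)%:E))%E; last first.
  by apply: eq_measure_integral => A mA _; exact: lebesgue_measureN.
have fg0 : {in [set: T1], forall x, (0 <= f x * (gw x)%:E)%E}.
  by move=> x _; rewrite mule_ge0// lee_fin ltW// gw_gt0.
apply: etrans (esym (ge0_integral_pushforward mopp leb measurableT mg fg0)).
by rewrite preimage_setT; apply: eq_integral => x _; rewrite /= gwN.
Qed.

Definition refl (z : R * R) : R * R := (- z.1, z.2).

Lemma measurable_refl : measurable_fun [set: T1 * T1] (refl : T1 * T1 -> T1 * T1).
Proof.
by apply: measurable_fun_pair => //; exact: (measurableT_comp mopp).
Qed.

Lemma ge0_integral_gauss2_refl (f : R * R -> \bar R) : measurable_fun [set: T1 * T1] f ->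
  (forall x, 0 <= f x)%E -> (\int[gauss2 R]_z f (refl z) = \int[gauss2 R]_z f z)%E.
Proof.
move=> mf f0.
have mfr : measurable_fun [set: T1 * T1] (fun z => f (refl z)) by exact: (measurableT_comp mf measurable_refl).
rewrite (fubini_tonelli2 _ mf f0) (fubini_tonelli2 _ mfr)//.
apply: eq_integral => y _; rewrite /fubini_G.
rewrite -(@ge0_integral_gauss1N (fun x => f (x, y)))//.
exact: measurableT_comp.
Qed.

(** Real integrals are compared through positive and negative parts, which the
sign [s] treats together. *)
Lemma Rintegral_signed d (T : measurableType d) (m : {measure set T -> \bar R}) (F G : T -> R) :
  (forall s : R, (\int[m]_x (Num.max (s * F x) 0)%:E = \int[m]_x (Num.max (s * G x) 0)%:E)%E) ->
  \int[m]_x F x = \int[m]_x G x.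
Proof.
move=> H; rewrite /Rintegral (integralE _ _ (EFin \o F)) (integralE _ _ (EFin \o G)); congr (fine (_ - _)).
  have := H 1; congr (_ = _); apply: eq_integral => x _;
  by rewrite funeposE mul1r EFin_max.
have := H (-1); congr (_ = _); apply: eq_integral => x _;
by rewrite funenegE mulN1r EFin_max.
Qed.

Lemma Rintegral_gauss1N (F : R -> R) : measurable_fun [set: T1] F ->
  \int[gauss1 R]_x F (- x) = \int[gauss1 R]_x F x.
Proof.
move=> mF; apply: Rintegral_signed => s.
apply: (@ge0_integral_gauss1N (fun x => (Num.max (s * F x) 0)%:E)).
  apply/measurable_EFinP; apply: measurable_maxr => //.
  by apply: measurable_funM => //; exact: measurable_cst.
by move=> x; rewrite lee_fin le_max lexx orbT.
Qed.

Lemma Rintegral_gauss2_refl (F : R * R -> R) : measurable_fun [set: T1 * T1] F ->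
  \int[gauss2 R]_z F (refl z) = \int[gauss2 R]_z F z.
Proof.
move=> mF; apply: Rintegral_signed => s.
apply: (@ge0_integral_gauss2_refl (fun x => (Num.max (s * F x) 0)%:E)).
  apply/measurable_EFinP; apply: measurable_maxr => //.
  by apply: measurable_funM => //; exact: measurable_cst.
by move=> x; rewrite lee_fin le_max lexx orbT.
Qed.

Lemma Rintegral_gauss2_refl_in (Omega : set (R * R)) (F : R * R -> R) :
  measurable (Omega : set (T1 * T1)) -> symmetric_wrt_y_axis Omega ->
  measurable_fun (Omega : set (T1 * T1)) F ->
  \int[gauss2 R]_(z in Omega) F (refl z) = \int[gauss2 R]_(z in Omega) F z.
Proof.
move=> mO symO mF; rewrite Rintegral_mkcond [RHS]Rintegral_mkcond.
have mFO : measurable_fun [set: T1 * T1] (F \_ Omega) by exact/(measurable_restrictT _ mO).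
rewrite -(Rintegral_gauss2_refl mFO); apply: eq_Rintegral => z _.
rewrite !patchE; congr (if _ then _ else _); apply/idP/idP; rewrite !inE.
  exact: symO.
by move=> /symO; rewrite /refl/= opprK -surjective_pairing.
Qed.

End reflection.

(** * Density of the sums of tensors *)

Section density_R.
Variable R : realType.
Local Notation T1 := (measurableTypeR R).

Lemma L2_closureS d (T : measurableType d) (m : {measure set T -> \bar R}) (D : set T)
    (P : (T -> R) -> Prop) f :
  measurable D -> L2_closure m setT P f -> L2_closure m D P f.
Proof.
move=> mD [[mf If] cl].
have L2S g : L2 m setT g -> L2 m D g.
  move=> [mg Ig]; split; first exact: measurable_funTS.
  exact: (@integrableS _ _ _ _ setT).
split; first exact: L2S.
move=> e e0; have [v [Pv hv fv]] := cl _ e0; exists v; split => //; first exact: L2S.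
apply: le_lt_trans fv; rewrite Rintegral_mkcond.
have [_ Iv] := L2B measurableT (conj mf If) hv.
apply: le_Rintegral => //.
- rewrite -restrict_EFin; apply/(integrable_mkcond _ mD).1.
  exact: (@integrableS _ _ _ _ setT).
- by move=> x _; rewrite patchE; case: ifPn => // _; exact: sqr_ge0.
Qed.

(** The half-lines generate the Borel sets, and the trace of a half-line on ]b,
c[ is an interval, which plateaus approximate from inside. *)
Lemma closure_csmooth_indic (b c : R) (A : set T1) : measurable A ->
  L2_closure (gauss1 R) setT (csmooth b c) (\1_(A `&` `]b, c[)).
Proof.
have mT : measurable [set: T1] by [].
have fT : (gauss1 R setT < +oo)%E by exact: gauss1_fin.
have oo (b' : R) : b <= b' -> L2_closure (gauss1 R) setT (csmooth b c) (\1_(`]b', c[%classic : set T1)).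
  move=> bb; apply: (@L2_closure_lim _ _ _ _ _ mT _ (fun n => plateau n b' c) _ (fun=> 1)).
  - exact: L2_indic.
  - by apply: (@bounded_L2 _ _ _ _ _ mT fT _ 1) => // x _; rewrite normr1.
  - by move=> n x _; rewrite ger0_norm ?plateau_ge0 ?plateau_le1.
  - move=> x _; rewrite indicE; have [xb|xb] := boolP (b' < x < c).
      by rewrite mem_set; [exact: cvg_plateau|rewrite /= in_itv].
    rewrite memNset; last by rewrite /= in_itv /=; exact/negP.
    by apply: cvg_near_cst; apply: nearW => n; rewrite plateau_out.
  - move=> n; have h : csmooth b c (plateau n b' c).
      exact: csmooth_widen (csmooth_plateau n b' c).
    by apply: L2_closure_incl => //; exact: csmooth_L2 h.
apply: (@L2_closure_dynkin _ _ _ _ _ mT fT _ _ _ (@RGenOInfty.G R)) => //.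
- by move=> f g; exact: csmoothD.
- by move=> k f; exact: csmoothZ.
- exact: RGenOInfty.measurableE.
- move=> _ _ [x ->] [y ->]; exists (Num.max x y).
  by apply/seteqP; split => z /=; rewrite !in_itv/= !andbT gt_max; [case=> -> ->|move=> /andP[]].
- exact: oo.
- move=> _ [x ->]; rewrite (_ : _ `&` _ = `]Num.max b x, c[%classic).
    by apply: oo; rewrite le_max lexx.
  apply/seteqP; split => z /=; rewrite !in_itv/= !andbT gt_max.
    by move=> [-> /andP[-> ->]].
  by move=> /andP[/andP[-> ->] ->].
Qed.

Definition obox (b c d e : R) : set (R * R) := [set z | b < z.1 < c /\ d < z.2 < e].

Lemma oboxE b c d e : obox b c d e = `]b, c[ `*` `]d, e[.
Proof. by apply/seteqP; split => z /=; rewrite !in_itv. Qed.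

Lemma measurable_obox b c d e : measurable (obox b c d e : set (T1 * T1)).
Proof. by rewrite oboxE; apply: measurableX. Qed.

Lemma indic_setX (A B : set R) (z : R * R) : \1_(A `*` B) z = \1_A z.1 * \1_B z.2 :> R.
Proof.
rewrite !indicE -natrM mulnb; congr (nat_of_bool _)%:R.
by apply/idP/andP => [|[]]; rewrite !inE.
Qed.

(** Rectangles generate the product sigma-algebra, and tensor products of
approximations settle the case of a rectangle. *)
Lemma closure_tens_indic Omega (b c d e : R) (A : set (T1 * T1)) :
  (forall x y, b <= x <= c -> d <= y <= e -> Omega (x, y)) -> measurable A ->
  L2_closure (gauss2 R) setT (tens Omega) (\1_(A `&` obox b c d e)).
Proof.
move=> hO; have mT2 : measurable [set: T1 * T1] by [].
have fT2 := gauss2_fin mT2.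
have rect (A1 A2 : set T1) : measurable A1 -> measurable A2 ->
    L2_closure (gauss2 R) setT (tens Omega) (\1_((A1 `*` A2) `&` obox b c d e)).
  move=> m1 m2.
  have := closure_tensor measurableT (fun al be ha hb => tens1 ha hb hO)
    (closure_csmooth_indic b c m1) (closure_csmooth_indic d e m2).
  rewrite setXTT; congr L2_closure; apply/funext => z; rewrite -indic_setX; congr (\1_ _ z).
  by rewrite oboxE setXI.
apply: (@L2_closure_dynkin _ _ _ _ _ mT2 fT2 _ _ _ [set A1 `*` A2 | A1 in measurable & A2 in measurable]).
- by move=> f g; exact: tensD.
- by move=> k f; exact: tensZ.
- exact: measurable_obox.
- exact: measurable_prod_measurableType.
- move=> _ _ [A1 m1 [A2 m2 <-]] [B1 n1 [B2 n2 <-]].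
  by exists (A1 `&` B1); [exact: measurableI|exists (A2 `&` B2); [exact: measurableI|rewrite setXI]].
- by have := rect setT setT measurableT measurableT; rewrite setXTT setTI.
- by move=> _ [A1 m1 [A2 m2 <-]]; exact: rect.
Qed.

(** The boxes with rational bounds whose closures lie in [Omega] are countably
many. *)
Lemma open_box_cover (Omega : set (R * R)) : open Omega ->
  exists Q : nat -> set (T1 * T1), Omega = \bigcup_n Q n /\
    forall n, Q n = set0 \/ exists b c d e, Q n = obox b c d e /\
      (forall x y, b <= x <= c -> d <= y <= e -> Omega (x, y)).
Proof.
move=> oO.
pose good (q : rat * rat * rat * rat) : Prop := forall x y : R,
  ratr q.1.1.1 <= x <= ratr q.1.1.2 -> ratr q.1.2 <= y <= ratr q.2 -> Omega (x, y).
pose box (q : rat * rat * rat * rat) := obox (ratr q.1.1.1) (ratr q.1.1.2) (ratr q.1.2) (ratr q.2).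
pose Q n := if (choice.unpickle n : option (rat * rat * rat * rat)) is Some q then (if `[< good q >] then box q else set0) else set0.
exists Q; split; last first.
  move=> n; rewrite /Q; case: choice.unpickle => [q|]; last by left.
  case: asboolP => gq; last by left.
  by right; exists (ratr q.1.1.1), (ratr q.1.1.2), (ratr q.1.2), (ratr q.2).
apply/seteqP; split => [[x y] Oxy|z [n _]]; last first.
  rewrite /Q; case: choice.unpickle => [q|//]; case: asboolP => // gq [h1 h2].
  rewrite (surjective_pairing z); apply: gq.
    by case/andP: h1 => /ltW -> /ltW ->.
  by case/andP: h2 => /ltW -> /ltW ->.
have /nbhs_ballP[e /= e0 he] := open_nbhs_nbhs (conj oO Oxy).
have rat_near (t s : R) : t < s -> exists q : rat, t < ratr q < s.
  by move=> ts; have [q] := rat_in_itvoo ts; rewrite in_itv/= => h; exists q.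
have [b /andP[b1 b2]] := rat_near (x - e) x ltac:(by rewrite ltrBlDr ltrDl).
have [c /andP[c1 c2]] := rat_near x (x + e) ltac:(by rewrite ltrDl).
have [d /andP[d1 d2]] := rat_near (y - e) y ltac:(by rewrite ltrBlDr ltrDl).
have [f /andP[f1 f2]] := rat_near y (y + e) ltac:(by rewrite ltrDl).
exists (choice.pickle (b, c, d, f)); [exact: I|rewrite /Q choice.pickleK].
case: asboolP => [_|]; first by split; rewrite /= ?b2 ?c1 ?d2 ?f1.
case; move=> x' y' /= /andP[h1 h2] /andP[h3 h4]; apply: he; split => /=.
  by rewrite /ball/= ltr_distlC; apply/andP; split; lra.
by rewrite /ball/= ltr_distlC; apply/andP; split; lra.
Qed.

Lemma open_measurable2 (Omega : set (R * R)) : open Omega -> measurable (Omega : set (T1 * T1)).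
Proof.
move=> /open_box_cover[Q [-> HQ]]; apply: bigcupT_measurable => n.
by have [->//|[b [c [d [e [-> _]]]]]] := HQ n; exact: measurable_obox.
Qed.

(** Inside one box of the countable cover, indicators are limits of tensors; a
measurable set is an increasing union of finite disjoint unions of pieces lying
in boxes, and indicators are enough. *)
Theorem tens_dense (Omega : set (R * R)) u : open Omega ->
  L2 (gauss2 R) Omega u -> L2_closure (gauss2 R) Omega (tens Omega) u.
Proof.
move=> oO; have mO := open_measurable2 oO; have fO := gauss2_fin mO.
have PD f g : tens Omega f -> tens Omega g -> tens Omega (fun z => f z + g z) by exact: tensD.
have PZ k f : tens Omega f -> tens Omega (fun z => k * f z) by exact: tensZ.
apply: (@L2_closure_all _ _ _ _ _ mO fO _ (tens0 Omega) PD PZ) => A mA AO.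
have [Q [OQ HQ]] := open_box_cover oO.
have mQ n : measurable (Q n).
  by have [->//|[b [c [d [e [-> _]]]]]] := HQ n; exact: measurable_obox.
pose V n : set (T1 * T1) := \bigcup_(i in `I_n) Q i.
have mV n : measurable (V n) by exact: bigcup_measurable.
pose U n : set (T1 * T1) := A `&` V n.
have mU n : measurable (U n) by exact: measurableI.
have ndU : nondecreasing_seq U.
  move=> i j ij; apply/subsetPset => z [Az [k /= ki Qz]]; split => //.
  by exists k => //=; exact: leq_trans ij.
have -> : A = \bigcup_n U n.
  apply/seteqP; split => [z Az|z [n _ []]//].
  have := AO _ Az; rewrite OQ => -[n _ Qz]; exists n.+1 => //; split => //.
  by exists n => //=.
apply: (@L2_closure_indic_nd _ _ _ _ _ mO fO) => // n.
elim: n => [|n IH].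
  rewrite /U /V II0 bigcup_set0 setI0 indic0; exact: (L2_closure0 mO fO (tens0 Omega)).
rewrite (_ : U n.+1 = U n `|` ((A `\` V n) `&` Q n)); last first.
  apply/seteqP; split => z.
    move=> [Az [k /= kn Qz]]; have [Vz|Vz] := pselect (V n z); first by left.
    right; split => //; suff -> : n = k by [].
    apply/eqP; rewrite eqn_leq; apply/andP; split; last exact: kn.
    rewrite leqNgt; apply/negP => kn'.
    by apply: Vz; exists k.
  move=> [[Az [k /= kn Qz]]|[[Az _] Qz]]; split => //.
    by exists k => //=; exact: ltnW.
  by exists n => /=.
rewrite indic_setU; last by apply/seteqP; split => z //=; rewrite /U /=; tauto.
apply: L2_closureD => //.
have mAn : measurable (A `\` V n) by exact: measurableD.
have [->|[b [c [d [e [-> hO]]]]]] := HQ n.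
  by rewrite setI0 indic0; exact: (L2_closure0 mO fO (tens0 Omega)).
by apply: L2_closureS => //; exact: closure_tens_indic.
Qed.

End density_R.

(** * Odd functions on symmetric domains with symmetric slices *)

Section odd_functions.
Variable R : realType.
Local Notation T1 := (measurableTypeR R).
Variables (Omega : set (R * R)) (I : set R) (kappa : R).
Hypothesis oO : open Omega.
Hypothesis symO : symmetric_wrt_y_axis Omega.
Hypothesis fibO : forall x y x', Omega (x, y) -> `|x'| <= `|x| -> Omega (x', y).
Hypothesis OI : forall z, Omega z -> I z.1.
Hypothesis k0 : 0 <= kappa.
Hypothesis Hk : forall f (M : R), test_function I f -> csmooth (- M) M f ->
  kappa * \int[gauss1 R]_x (f x ^+ 2) <= \int[gauss1 R]_x (dstar f x ^+ 2).

Let mO : measurable (Omega : set (T1 * T1)) := open_measurable2 oO.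

(** The odd part of [al] has mean zero, hence is [dstar A]; the support of [A]
stays in the slices of [Omega] because they are symmetric and contain both ends
of the support of [al]. *)
Lemma odd_part_preimage v : tens Omega v ->
  exists2 phi, tens Omega phi & forall z, dstar1 phi z = 2^-1 * v z - 2^-1 * v (refl z).
Proof.
elim=> [|psi b c d e al be hpsi [phi hphi Hphi] ha hb hO].
  exists (fun=> 0); first exact: tens0.
  move=> [x y]; rewrite dstar1E /dstar mulr0 derive_cst; ring.
have [bc|cb] := leP b c; last first.
  exists phi => // z; rewrite Hphi.
  by rewrite !(csmooth_empty _ cb ha) !mul0r !addr0.
pose M := Num.max `|b| `|c|.
pose alo x := 2^-1 * al x - 2^-1 * al (- x).
have bM : - M <= b <= M by rewrite -ler_norml le_max lexx.
have cM : - M <= c <= M by rewrite -ler_norml le_max lexx orbT.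
case/andP : bM => b1 b2; case/andP : cM => c1 c2.
have halr : csmooth (- M) M (fun x : R => al (- x)).
  by apply: csmooth_widen (csmooth_opp ha); rewrite ?lerN2// lerNl.
have hal : csmooth (- M) M al by exact: csmooth_widen ha.
have halo : csmooth (- M) M alo by apply: csmoothB; exact: csmoothZ.
have mal : measurable_fun [set: T1] al by apply: smooth_measurable => //; exact: csmooth_smooth ha.
have alo0 : \int[gauss1 R]_x alo x = 0.
  have Ial := csmooth_integrable measurableT hal.
  have Ialr := csmooth_integrable measurableT halr.
  have Ial2 := csmooth_integrable measurableT (csmoothZ 2^-1 hal).
  have Ialr2 := csmooth_integrable measurableT (csmoothZ 2^-1 halr).
  rewrite (RintegralB measurableT Ial2 Ialr2).
  rewrite (RintegralZl _ measurableT Ial) (RintegralZl _ measurableT Ialr).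
  by rewrite (Rintegral_gauss1N mal) subrr.
have [A hA HA] := dstar_preimage halo alo0.
exists (fun z => phi z + A z.1 * be z.2).
  apply: tensS hphi hA hb _ => x y hx hy.
  have hx' : `|x| <= M by rewrite ler_norml.
  move: hx'; rewrite le_max => /orP[hx'|hx'].
    by apply: fibO hx'; apply: hO => //; rewrite lexx.
  by apply: fibO hx'; apply: hO => //; rewrite lexx andbT.
move=> z; rewrite dstar1S; [|exact: tens_smooth hphi|exact: csmooth_smooth hA].
by rewrite Hphi HA /alo /refl/=; ring.
Qed.

(** An odd [u] sees only the odd part of [v], which is [dstar1 phi]; the
derivative is then moved to [u], and the norm of [phi] is controlled on slices. *)
Lemma odd_bound u ux v :
  L2 (gauss2 R) Omega u -> L2 (gauss2 R) Omega ux -> weak_partial Omega (1, 0) u ux ->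
  odd_wrt_y_axis Omega u -> tens Omega v ->
  kappa * (\int[gauss2 R]_(z in Omega) (u z * v z)) ^+ 2 <=
  \int[gauss2 R]_(z in Omega) (ux z ^+ 2) * \int[gauss2 R]_(z in Omega) (v z ^+ 2).
Proof.
move=> hu hux wu oddu hv.
have [phi hphi Hphi] := odd_part_preimage hv.
have hvO := tens_L2 mO hv.
have mv := tens_measurable hv.
have mvr : measurable_fun [set: T1 * T1] (fun z => v (refl z)).
  exact: (measurableT_comp mv (@measurable_refl R)).
have hvr : L2 (gauss2 R) Omega (fun z => v (refl z)).
  have [M HM] := tens_bounded hv.
  apply: (@bounded_L2 _ _ _ _ _ mO (gauss2_fin mO) _ M) => //.
  exact: measurable_funTS.
have murO : measurable_fun (Omega : set (T1 * T1)) (fun z => u (refl z)).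
  apply: (@measurable_comp _ _ _ _ _ _ Omega) => //.
  - by move=> _ [z Oz <-]; exact: symO.
  - by case: hu.
  - by apply: measurable_funTS; exact: measurable_refl.
have muO : measurable_fun (Omega : set (T1 * T1)) u by case: hu.
have uvr : \int[gauss2 R]_(z in Omega) (u z * v (refl z)) = - \int[gauss2 R]_(z in Omega) (u z * v z).
  rewrite -(@Rintegral_gauss2_refl_in R Omega (fun z => u z * v (refl z)))//; last first.
    by apply: measurable_funM => //; exact: measurable_funTS.
  rewrite -mulN1r -RintegralZl//; last exact: L2_integrableM.
  rewrite /Rintegral; congr fine; apply: ae_eq_integral => //.
  - apply/measurable_EFinP; apply: measurable_funM => //.
    apply: measurable_funTS; apply: (measurableT_comp mvr (@measurable_refl R)).
  - apply/measurable_EFinP; apply: measurable_funM => //.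
    by apply: measurable_funM => //; exact: measurable_funTS.
  - move: oddu; apply: negligibleS => z /= nQ H; apply: nQ => Oz; congr EFin; rewrite (H Oz).
    by rewrite /refl/= opprK -surjective_pairing mulN1r mulNr.
have E : \int[gauss2 R]_(z in Omega) (u z * v z) = \int[gauss2 R]_(z in Omega) (ux z * phi z).
  rewrite -(weak_dstar1 mO wu hu hux hphi).
  under [RHS]eq_Rintegral do rewrite Hphi.
  rewrite (ipBr mO hu (L2Z mO _ hvO) (L2Z mO _ hvr)) !(ipZr mO)// uvr.
  by field.
have N : \int[gauss2 R]_(z in Omega) (dstar1 phi z ^+ 2) <= \int[gauss2 R]_(z in Omega) (v z ^+ 2).
  under eq_Rintegral do rewrite Hphi -mulNr.
  apply: le_trans (nsqD_le mO (L2Z mO _ hvO) (L2Z mO _ hvr)) _.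
  rewrite !nsqZ//.
  have -> : \int[gauss2 R]_(z in Omega) (v (refl z) ^+ 2) = \int[gauss2 R]_(z in Omega) (v z ^+ 2).
    apply: (@Rintegral_gauss2_refl_in R Omega (fun z => v z ^+ 2)) => //.
    by apply: measurable_funTS; exact: measurable_funX.
  set V := \int[_]_(_ in _) _; rewrite sqrrN; lra.
have S := slice_inequality k0 OI Hk hphi.
have S' : kappa * \int[gauss2 R]_(z in Omega) (phi z ^+ 2) <= \int[gauss2 R]_(z in Omega) (dstar1 phi z ^+ 2).
  have O1 : \int[gauss2 R]_(z in Omega) (phi z ^+ 2) = \int[gauss2 R]_z (phi z ^+ 2).
    by apply: Rintegral_out => z Oz; rewrite (tens_out hphi Oz) expr0n.
  have O2 : \int[gauss2 R]_(z in Omega) (dstar1 phi z ^+ 2) = \int[gauss2 R]_z (dstar1 phi z ^+ 2).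
    by apply: Rintegral_out => z Oz; rewrite (tens_out (tens_dstar1 hphi) Oz) expr0n.
  by rewrite O1 O2.
rewrite E; have CS := cauchy_schwarz mO hux (tens_L2 mO hphi).
apply: (le_trans (ler_wpM2l k0 CS)); rewrite mulrCA ler_wpM2l ?nsq_ge0//.
exact: le_trans S' N.
Qed.

(** Density lets [v] tend to [u] in [odd_bound]. *)
Theorem odd_poincare u ux :
  L2 (gauss2 R) Omega u -> L2 (gauss2 R) Omega ux -> weak_partial Omega (1, 0) u ux ->
  odd_wrt_y_axis Omega u ->
  kappa * \int[gauss2 R]_(z in Omega) (u z ^+ 2) <= \int[gauss2 R]_(z in Omega) (ux z ^+ 2).
Proof.
move=> hu hux wu oddu.
have [->|kn0] := eqVneq kappa 0; first by rewrite mul0r nsq_ge0.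
have kp : 0 < kappa by rewrite lt_neqAle eq_sym kn0.
set X := \int[gauss2 R]_(z in Omega) (ux z ^+ 2).
have X0 : 0 <= X / kappa by rewrite divr_ge0 ?nsq_ge0.
have B := L2_closure_bound mO X0 hu _ (tens_dense oO hu).
set U := \int[gauss2 R]_(z in Omega) (u z ^+ 2) in B *.
have U0 : 0 <= U by exact: nsq_ge0.
have {}B : U ^+ 2 <= X / kappa * U.
  apply: B => v hv _.
  rewrite mulrAC ler_pdivlMr// mulrC; exact: odd_bound.
move: U0; rewrite le_eqVlt => /orP[/eqP <-|U0].
  by rewrite mulr0 nsq_ge0.
by move: B; rewrite expr2 ler_pM2r// ler_pdivlMr// mulrC.
Qed.

End odd_functions.

(** * Lower bound for the eigenvalues with an odd eigenfunction *)

Section intervals.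
Variable R : realType.
Local Notation T1 := (measurableTypeR R).

Lemma sym_itvP (a : \bar R) : (0 < a)%E ->
  (exists2 r : R, 0 < r & a = r%:E /\ sym_itv a = `]-r, r[%classic) \/ (a = +oo%E /\ sym_itv a = setT).
Proof.
case: a => [r r0||//]; [left|right].
  by exists r.
by split => //; apply/seteqP; split => x //= _; rewrite /sym_itv/= ltNyr ltry.
Qed.

Lemma sym_itv_open (a : \bar R) : (0 < a)%E -> open (sym_itv a).
Proof.
by move=> /sym_itvP[[r _ [_ ->]]|[_ ->]]; [exact: interval_open|exact: openT].
Qed.

Lemma sym_itv_measurable (a : \bar R) : (0 < a)%E -> measurable (sym_itv a : set T1).
Proof. by move=> a0; apply: open_measurable; exact: sym_itv_open. Qed.

Lemma test_function_derive_out (I : set R) (f : R -> R) (x : R) :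
  test_function I f -> ~ I x -> 'D_1 f x = 0.
Proof.
move=> [_ _ sI] Ix; rewrite (@near_eq_derive _ _ _ f (cst 0)) ?derive_cst//.
have : open_nbhs x (~` closure [set z | f z != 0]).
  by split; [apply: closed_openC; exact: closed_closure|move=> /sI].
move/open_nbhs_nbhs; apply: filterS => y /= ny; apply: contrapT => /eqP fy; apply: ny.
exact: subset_closure.
Qed.

Lemma csmooth_H10 (I : set R) f (M : R) : measurable (I : set T1) ->
  test_function I f -> csmooth (- M) M f -> H10 I f ('D_1 f).
Proof.
move=> mI tf hf; have hf' := csmooth_derive hf; split.
- exact: csmooth_L2 hf.
- exact: csmooth_L2 hf'.
- move=> phi [sphi _ _].
  have sphi' : smooth phi by [].
  have h1 : csmooth (- M) M (fun x => f x * 'D_1 phi x).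
    have := csmoothM (smooth_derive (1 : R) sphi') hf.
    by congr csmooth; apply/funext => x; rewrite mulrC.
  have h2 : csmooth (- M) M (fun x => 'D_1 f x * phi x).
    have := csmoothM sphi' hf'.
    by congr csmooth; apply/funext => x; rewrite mulrC.
  have h3 : csmooth (- M) M (fun x => f x * phi x).
    have := csmoothM sphi' hf.
    by congr csmooth; apply/funext => x; rewrite mulrC.
  rewrite Rintegral_out => [|x Ix]; last by rewrite (test_function_out tf Ix) mul0r.
  have -> : \int[lebesgue_measure]_(x in I) ('D_1 f x * phi x) = \int[lebesgue_measure]_x ('D_1 f x * phi x).
    by apply: Rintegral_out => x Ix; rewrite (test_function_derive_out tf Ix) mul0r.
  apply/eqP; rewrite -addr_eq0; apply/eqP.
  rewrite -(RintegralD measurableT (csmooth_lebesgue_integrable h1) (csmooth_lebesgue_integrable h2)).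
  suff H : (\int[lebesgue_measure]_x (f x * 'D_1 phi x + 'D_1 f x * phi x)%:E = 0)%E.
    by rewrite /Rintegral H.
  apply: (@integral_derive_compact _ (fun x => f x * phi x) _ `|M|).
  + move=> x; apply: (is_derive_eq (is_derive1M (smooth_is_derive x (csmooth_smooth hf)) (smooth_is_derive x sphi'))).
    by rewrite [phi x * _]mulrC.
  + apply: smooth_continuous; apply: smoothD; [exact: csmooth_smooth h1|exact: csmooth_smooth h2].
  + move=> x Mx; rewrite (csmooth_out h3)// -ler_norml -ltNge.
    exact: le_lt_trans (ler_norm M) Mx.
- move=> e e0; exists f => //.
  under eq_Rintegral do rewrite subrr expr0n/=.
  under [X in _ + X]eq_Rintegral do rewrite subrr expr0n/=.
  by rewrite !Rintegral_cst// mul0r addr0.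
Qed.

Lemma lambda1_ge0 (a : \bar R) : (0 <= lambda1 a)%E.
Proof.
apply: le_ereal_inf_tmp => _ [l [z [g [_ _ ->]]] <-].
by rewrite lee_fin divr_ge0// nsq_ge0.
Qed.

(** A nonzero test function is its own approximation, hence a competitor in the
Rayleigh quotients. *)
Lemma lambda1_test (a : \bar R) (lam : R) f (M : R) : (0 < a)%E -> (lam%:E <= lambda1 a)%E ->
  test_function (sym_itv a) f -> csmooth (- M) M f ->
  lam * \int[gauss1 R]_x (f x ^+ 2) <= \int[gauss1 R]_x ('D_1 f x ^+ 2).
Proof.
move=> a0 lam1 tf hf; have mI := sym_itv_measurable a0.
have O1 : \int[gauss1 R]_(x in sym_itv a) (f x ^+ 2) = \int[gauss1 R]_x (f x ^+ 2).
  by apply: Rintegral_out => x Ix; rewrite (test_function_out tf Ix) expr0n.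
have O2 : \int[gauss1 R]_(x in sym_itv a) ('D_1 f x ^+ 2) = \int[gauss1 R]_x ('D_1 f x ^+ 2).
  by apply: Rintegral_out => x Ix; rewrite (test_function_derive_out tf Ix) expr0n.
rewrite -O1 -O2; set F := \int[_]_(_ in _) (f _ ^+ 2); set F' := \int[_]_(_ in _) _.
have [F0|F0] := eqVneq F 0; first by rewrite F0 mulr0 /F' nsq_ge0.
have Fp : 0 < F by rewrite lt_neqAle eq_sym F0 nsq_ge0.
rewrite -ler_pdivlMr// -lee_fin; apply: (le_trans lam1).
apply: ereal_inf_lbound; exists (F' / F) => //; exists f, ('D_1 f); split => //.
- exact: csmooth_H10 hf.
- move=> ae0; move/eqP : F0; apply; rewrite /F /Rintegral.
  rewrite (_ : (\int[_]_(_ in _) _)%E = 0%E)//.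
  rewrite -[RHS](integral0 (gauss1 R) (sym_itv a)); apply: ae_eq_integral => //.
    by apply/measurable_EFinP; apply: measurable_funX; have [] := csmooth_L2 mI hf.
  by move: ae0; apply: negligibleS => x /= nQ K; apply: nQ => Ix; rewrite K// expr0n.
Qed.

End intervals.

Section symmetric_domain.
Variable R : realType.
Local Notation T1 := (measurableTypeR R).

(** The point (x', y) lies on the segment between (x, y) and its mirror image. *)
Lemma convex_fiber (Omega : set (R * R)) :
  convex_set (Omega : set (convex_lmodType (R^o * R^o)%type)) -> symmetric_wrt_y_axis Omega ->
  forall x y x', Omega (x, y) -> `|x'| <= `|x| -> Omega (x', y).
Proof.
move=> cO sO x y x' Oxy xx.
have [x0|x0] := eqVneq x 0.
  by move: xx; rewrite x0 normr0 normr_le0 => /eqP ->; rewrite -x0.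
have Omxy := sO _ Oxy.
(* The weight of (x, y) in the convex combination equal to (x', y). *)
pose t : R := (1 + x' / x) / 2.
have xr : `|x' / x| <= 1 by rewrite normf_div ler_pdivrMr ?mul1r ?normr_gt0.
have : 0 <= t <= 1 by move: xr; rewrite ler_norml /t => /andP[h1 h2]; apply/andP; split; lra.
move=> t01.
have [h0 h1] := andP t01.
pose T : {i01 R} := Itv01 h0 h1.
have := cO (x, y) (- x, y) T (mem_set Oxy) (mem_set Omxy).
rewrite inE; congr Omega; apply: injective_projections => /=.
  by rewrite /GRing.scale/= /unstable.onem /t; field.
by rewrite /GRing.scale/= /unstable.onem; ring.
Qed.

(** Testing the eigenvalue equation with [u] gives |ux|^2 + |uy|^2 = m |u|^2,
to be compared with [odd_poincare] for kappa = 1 + lambda1 a. *)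
Theorem odd_eigenvalue_bound (Omega : set (R * R)) (a : \bar R) (m : R) u :
  (0 < a)%E -> open Omega -> symmetric_wrt_y_axis Omega ->
  (forall x y x', Omega (x, y) -> `|x'| <= `|x| -> Omega (x', y)) ->
  (forall z, Omega z -> sym_itv a z.1) ->
  neumann_eigenpair Omega m u -> odd_wrt_y_axis Omega u ->
  (lambda1 a <= (m - 1)%:E)%E.
Proof.
move=> a0 oO sO fO OI [ux [uy [[hu [hux huy] wx wy] u0 eig]]] oddu.
have mO := open_measurable2 oO.
rewrite leNgt; apply/negP => lt.
(* [lambda1 a] is an extended real: [lam] stands for it, or for any large real
number if it is infinite. *)
have [lam [lam0 lam1 lam2]] : exists lam : R, [/\ 0 <= lam, m - 1 < lam & (lam%:E <= lambda1 a)%E].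
  have := lambda1_ge0 a; move: lt; case: (lambda1 a) => [l||//].
    by rewrite lte_fin lee_fin => h1 h2; exists l; split.
  move=> _ _; exists `|m|; split => //; last exact: leey.
  by have := ler_norm m; lra.
have Hk f (M : R) : test_function (sym_itv a) f -> csmooth (- M) M f ->
    (1 + lam) * \int[gauss1 R]_x (f x ^+ 2) <= \int[gauss1 R]_x (dstar f x ^+ 2).
  move=> tf hf; rewrite (nsq_dstar hf) mulrDl mul1r lerD2l.
  exact: lambda1_test lam2 tf hf.
have k0 : 0 <= 1 + lam by rewrite addr_ge0.
have P := odd_poincare oO sO fO OI k0 Hk hu hux wx oddu.
have E := eig _ _ _ (And4 hu (conj hux huy) wx wy).
have [_ Iux] := hux; have [_ Iuy] := huy.
have E2 : \int[gauss2 R]_(z in Omega) (ux z ^+ 2) + \int[gauss2 R]_(z in Omega) (uy z ^+ 2) =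
    m * \int[gauss2 R]_(z in Omega) (u z ^+ 2).
  by rewrite -(RintegralD mO Iux Iuy); exact: E.
have Y0 : 0 <= \int[gauss2 R]_(z in Omega) (uy z ^+ 2) by exact: nsq_ge0.
have U0 : 0 <= \int[gauss2 R]_(z in Omega) (u z ^+ 2) by exact: nsq_ge0.
have [U1|U1] := eqVneq (\int[gauss2 R]_(z in Omega) (u z ^+ 2)) 0.
  by apply: u0; exact: L2_ae0 U1.
have Up : 0 < \int[gauss2 R]_(z in Omega) (u z ^+ 2) by rewrite lt_neqAle eq_sym U1.
have : (1 + lam) <= m.
  by rewrite -(ler_pM2r Up) -E2; apply: (le_trans P); rewrite lerDl.
by lra.
Qed.

End symmetric_domain.

(** * Mean-zero functions on a symmetric interval *)

Section itest.
Variable R : realType.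
Local Notation T1 := (measurableTypeR R).
Variable I : set R.

(** Symmetric supports make the class stable under addition without any
convexity of [I]. *)
Definition itest (f : R -> R) : Prop :=
  exists r, (forall x, `|x| <= r -> I x) /\ csmooth (- r) r f.

Lemma itest_smooth f : itest f -> smooth f.
Proof. by move=> [r [_ []]]. Qed.

Lemma itest_out f x : itest f -> ~ I x -> f x = 0.
Proof.
move=> [r [rI hf]] Ix; rewrite (csmooth_out hf)//; apply/negP; rewrite -ler_norml.
by move/rI.
Qed.

Lemma itest_pair f g : itest f -> itest g ->
  exists r, [/\ forall x, `|x| <= r -> I x, csmooth (- r) r f & csmooth (- r) r g].
Proof.
move=> [r [rI hf]] [s [sI hg]]; exists (Num.max r s); split.
- by move=> x; rewrite le_max => /orP[/rI|/sI].
- by apply: csmooth_widen hf; rewrite ?lerN2 le_max lexx.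
- by apply: csmooth_widen hg; rewrite ?lerN2 le_max lexx orbT.
Qed.

Lemma itestD f g : itest f -> itest g -> itest (fun x => f x + g x).
Proof.
by move=> /itest_pair /[apply] -[r [rI hf hg]]; exists r; split => //; exact: csmoothD.
Qed.

Lemma itestZ k f : itest f -> itest (fun x => k * f x).
Proof. by move=> [r [rI hf]]; exists r; split => //; exact: csmoothZ. Qed.

Lemma itestB f g : itest f -> itest g -> itest (fun x => f x - g x).
Proof.
by move=> /itest_pair /[apply] -[r [rI hf hg]]; exists r; split => //; exact: csmoothB.
Qed.

Lemma itest_dstar f : itest f -> itest (dstar f).
Proof. by move=> [r [rI hf]]; exists r; split => //; exact: csmooth_dstar. Qed.

Lemma itest_L2 (D : set T1) f : measurable D -> itest f -> L2 (gauss1 R) D f.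
Proof. by move=> mD [r [_ hf]]; exact: csmooth_L2 hf. Qed.

Lemma itest_integrable (D : set T1) f : measurable D -> itest f ->
  (gauss1 R).-integrable D (EFin \o f).
Proof. by move=> mD [r [_ hf]]; exact: csmooth_integrable hf. Qed.

Lemma itest_Rintegral f : itest f -> \int[gauss1 R]_(x in I) f x = \int[gauss1 R]_x f x.
Proof. by move=> hf; apply: Rintegral_out => x; exact: itest_out. Qed.

Lemma itest_nsq_le_dstar f : itest f ->
  \int[gauss1 R]_x (f x ^+ 2) <= \int[gauss1 R]_x (dstar f x ^+ 2).
Proof.
by move=> [r [_ hf]]; rewrite (nsq_dstar hf) lerDl nsq_ge0.
Qed.

Lemma itest_preimage f : itest f -> \int[gauss1 R]_(x in I) f x = 0 ->
  exists2 A, itest A & forall x, dstar A x = f x.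
Proof.
move=> hf; rewrite itest_Rintegral//; move: hf => [r [rI hf]] f0.
by have [A hA HA] := dstar_preimage hf f0; exists A => //; exists r.
Qed.

(** Along the segments of radius [r_ n] the bumps increase with [n], so that
the powers defining the plateaus still tend to 0 at each point. *)
Lemma cutoffs_of_radii (r_ : nat -> R) : {homo r_ : m n / (m <= n)%N >-> m <= n} ->
  (forall n x, `|x| <= r_ n -> I x) -> (forall x, I x -> exists n, `|x| < r_ n) ->
  exists chi : nat -> R -> R, [/\ forall n, itest (chi n),
    forall n x, 0 <= chi n x <= 1 &
    forall x, I x -> chi n x @[n --> \oo] --> (1 : R)].
Proof.
move=> nd rI Ir; exists (fun n => plateau n (- r_ n) (r_ n)); split.
- by move=> n; exists (r_ n); split; [exact: rI|exact: csmooth_plateau].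
- by move=> n x; rewrite plateau_ge0 plateau_le1.
- move=> x /Ir [N xN].
  pose dl := itv_bump (- r_ N) (r_ N) x.
  have dl0 : 0 < dl by apply: bump_gt0; rewrite -ltr_norml.
  have dl1 : dl <= 1 by exact: bump_le1.
  have cl : 1 - (1 - dl) ^+ n @[n --> \oo] --> (1 : R).
    rewrite -[X in _ --> X]subr0; apply: cvgB; first exact: cvg_cst.
    by apply: cvg_expr; rewrite ger0_norm ?subr_ge0// ltrBlDr ltrDl.
  have c1 : (fun _ : nat => 1 : R) @ \oo --> (1 : R) by exact: cvg_cst.
  apply: squeeze_cvgr cl c1; near=> n; rewrite plateau_le1 andbT /plateau lerB//.
  have Nn : (N <= n)%N by near: n; exact: nbhs_infty_ge.
  have hb : dl <= itv_bump (- r_ n) (r_ n) x by apply: bump_incl; rewrite ?lerN2 nd.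
  by rewrite lerXn2r ?nnegrE ?subr_ge0 ?bump_le1// lerB.
Unshelve. all: by end_near. Qed.

End itest.

Section strip1.
Variable R : realType.
Local Notation T1 := (measurableTypeR R).
Variable a : \bar R.
Hypothesis a0 : (0 < a)%E.
Local Notation I := (sym_itv a).
Let mI := sym_itv_measurable a0.

(** Radii which increase to the half-length of [I], or to infinity. *)
Lemma cutoffs : exists chi : nat -> R -> R, [/\ forall n, itest I (chi n),
    forall n x, 0 <= chi n x <= 1 &
    forall x, I x -> chi n x @[n --> \oo] --> (1 : R)].
Proof.
have [[r r0 [_ ->]]|[_ ->]] := sym_itvP a0.
  apply: (@cutoffs_of_radii _ _ (fun n => r - r / n.+2%:R)).
  - move=> m n mn; rewrite lerB// ler_pM2l// lef_pV2 ?posrE ?ltr0n//.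
    by rewrite ler_nat.
  - move=> n x xr /=; rewrite in_itv/= -ltr_norml (le_lt_trans xr)//.
    by rewrite ltrBlDr ltrDl divr_gt0.
  - move=> x /=; rewrite in_itv/= -ltr_norml => xr.
    have d0 : 0 < r - `|x| by rewrite subr_gt0.
    have /archi_boundP := ltW (divr_gt0 r0 d0); set n := Num.bound _ => hn.
    exists n; rewrite ltrBrDr -ltrBrDl ltr_pdivrMr ?ltr0n//.
    move: hn; rewrite ltr_pdivrMr// => /lt_le_trans; apply.
    by rewrite mulrC ler_pM2l// ler_nat; apply: leq_trans (leqnSn _); exact: leqnSn.
apply: (@cutoffs_of_radii _ _ (fun n => n%:R)) => //.
- by move=> m n mn; rewrite ler_nat.
- move=> x _; exists (Num.bound `|x|); exact: archi_boundP.
Qed.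

Local Notation G := (\int[gauss1 R]_(x in I) (1 : R)).

Lemma one_closure : L2_closure (gauss1 R) I (itest I) (fun=> 1).
Proof.
have [chi [hchi chi01 cchi]] := cutoffs.
apply: (@L2_closure_lim _ _ _ _ _ mI _ chi _ (fun=> 1)).
- exact: L2_cst.
- exact: L2_cst.
- by move=> n x _; have /andP[h0 h1] := chi01 n x; rewrite ger0_norm.
- by move=> x Ix; exact: cchi.
- by move=> n; apply: L2_closure_incl => //; exact: itest_L2.
Qed.

(** The density is bounded below on a segment. *)
Lemma gauss1_sym_itv_gt0 : 0 < G.
Proof.
have [s [s0 sI]] : exists s : R, 0 < s /\ `[- s, s]%classic `<=` I.
  have [[r r0 [_ ->]]|[_ ->]] := sym_itvP a0; last by exists 1.
  exists (r / 2); split; first by rewrite divr_gt0.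
  by apply: subset_itv; rewrite bnd_simp; lra.
have mJ : measurable (`[- s, s]%classic : set T1) by [].
have Jp : (0 < gauss1 R `[(- s)%R, s]%classic)%E.
  apply: (@lt_le_trans _ _ (\int[lebesgue_measure]_(x in `[(- s)%R, s]) (gw s)%:E)%E).
    rewrite integral_cst// mule_gt0// ?lte_fin ?gw_gt0//.
    rewrite [X in (_ < X)%E]lebesgue_measure_itv/= lte_fin ifT; last lra.
    by rewrite -EFinB lte_fin; lra.
  rewrite /gauss1 /= /normal_prob; apply: ge0_le_integral => //.
  - by move=> x _; rewrite lee_fin ltW// gw_gt0.
  - by apply/measurable_EFinP; apply: measurable_funTS; exact: measurable_gw.
  - move=> x /=; rewrite in_itv/= -ler_norml => xs.
    rewrite lee_fin -/(gw x) !gwE ler_pM2l ?normal_peak_gt0 ?oner_neq0//.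
    rewrite ler_expR !mulNr lerN2 ler_pM2l ?invr_gt0//.
    by rewrite -[x ^+ 2]real_normK ?num_real// lerXn2r ?nnegrE// ltW.
rewrite Rintegral_cst// mul1r fine_gt0//; apply/andP; split.
  by apply: (lt_le_trans Jp); apply: le_measure; rewrite ?inE.
exact: gauss1_fin.
Qed.

(** A test function of mean zero is in the range of [dstar].  To correct the
mean of [f], one subtracts a multiple of the constant 1, itself a limit of
cutoffs whose means are corrected by a fixed test function [rho]. *)
Lemma mean_zero_closure f : itest I f ->
  L2_closure (gauss1 R) I (fun g => exists2 A, itest I A & g = dstar A)
    (fun x => f x - (\int[gauss1 R]_(x in I) f x) / G).
Proof.
move=> hf; set P := (X in L2_closure _ _ X _).
have G0 := gauss1_sym_itv_gt0.
have [chi [hchi chi01 cchi]] := cutoffs.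
have PD g h : P g -> P h -> P (fun x => g x + h x).
  move=> [A hA ->] [B hB ->]; exists (fun x => A x + B x); first exact: itestD.
  by apply/funext => x; rewrite (dstarD _ (itest_smooth hA) (itest_smooth hB)).
have PZ k g : P g -> P (fun x => k * g x).
  move=> [A hA ->]; exists (fun x => A x * k).
    by under eq_fun do rewrite mulrC; exact: itestZ.
  by apply/funext => x; rewrite (dstarZ k x (itest_smooth hA)) mulrC.
have Pmean g : itest I g -> \int[gauss1 R]_(x in I) g x = 0 -> L2_closure (gauss1 R) I P g.
  move=> hg g0; apply: (L2_closure_incl mI); last exact: (itest_L2 mI hg).
  by have [A hA HA] := itest_preimage hg g0; exists A => //; apply/funext => x; rewrite HA.
pose c n := \int[gauss1 R]_(x in I) chi n x.
have cG : c n @[n --> \oo] --> G.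
  have h1 := L2_cst 1 mI.
  have lex n x : I x -> `|chi n x| <= 1.
    by move=> _; have /andP[h0 h2] := chi01 n x; rewrite ger0_norm.
  have H := cvg_ip_L2 mI h1 h1 (fun n => itest_L2 mI (hchi n)) h1 lex cchi.
  have -> : c = fun n => \int[gauss1 R]_(x in I) (1 * chi n x).
    by apply/funext => n; apply: eq_Rintegral => x _; rewrite mul1r.
  have -> : G = \int[gauss1 R]_(x in I) (1 * 1) by apply: eq_Rintegral => x _; rewrite mul1r.
  exact: H.
have [N cN] : exists N, c N != 0.
  have /cvgr_gt /(_ _ G0) [N _ /(_ N (leqnn N)) h] := cG.
  by exists N; rewrite gt_eqF.
(* [rho] has integral 1: [G * rho - 1] is the limit of the mean-zero functions
[c n * rho - chi n], and [f - mf * rho] is a mean-zero test function. *)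
pose rho x := (c N)^-1 * chi N x.
have hrho : itest I rho by exact: itestZ.
have Irho : \int[gauss1 R]_(x in I) rho x = 1.
  rewrite /rho (RintegralZl _ mI); last exact: itest_integrable.
  by rewrite -/(c N) mulVf.
have [M HM] : exists M, forall x, `|rho x| <= M.
  by move: hrho => [r [_ h]]; exact: csmooth_bounded h.
have c01 n : `|c n| <= G.
  rewrite ger0_norm; last by apply: Rintegral_ge0 => x _; have /andP[] := chi01 n x.
  apply: le_Rintegral => //; [exact: itest_integrable|exact: integrable_cst1|].
  by move=> x _; have /andP[] := chi01 n x.
have K : L2_closure (gauss1 R) I P (fun x => G * rho x - 1).
  apply: (@L2_closure_lim _ _ _ _ _ mI _ (fun n x => c n * rho x - chi n x) _ (fun=> G * M + 1)).
  - by apply: (L2B mI); [exact: (L2Z mI _ (itest_L2 mI hrho))|exact: L2_cst].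
  - exact: L2_cst.
  - move=> n x _; rewrite (le_trans (ler_normB _ _))// lerD//.
      by rewrite normrM ler_pM.
    by have /andP[h0 h1] := chi01 n x; rewrite ger0_norm.
  - move=> x Ix; apply: cvgB; last exact: cchi.
    by apply: cvgM; [exact: cG|exact: cvg_cst].
  - move=> n; apply: Pmean; first by apply: itestB => //; exact: itestZ.
    rewrite (RintegralB mI (itest_integrable mI (itestZ _ hrho)) (itest_integrable mI (hchi n))).
    by rewrite (RintegralZl _ mI (itest_integrable mI hrho)) Irho mulr1 subrr.
set mf := \int[gauss1 R]_(x in I) f x.
have -> : (fun x => f x - mf / G) = (fun x => (f x - mf * rho x) + mf / G * (G * rho x - 1)).
  by apply/funext => x; field; rewrite gt_eqF.
apply: (L2_closureD mI PD); last exact: (L2_closureZ mI (fun f => @PZ _ f) K).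
apply: Pmean; first by apply: itestB => //; exact: itestZ.
rewrite (RintegralB mI (itest_integrable mI hf) (itest_integrable mI (itestZ _ hrho))).
by rewrite (RintegralZl _ mI (itest_integrable mI hrho)) Irho mulr1 subrr.
Qed.

End strip1.

(** * Weak derivatives of functions of the second variable *)

Section compact_support.
Variable R : realType.
Local Notation T1 := (measurableTypeR R).
Local Notation leb := (@lebesgue_measure R).
Implicit Types (F psi : R * R -> R).

Lemma continuous_measurable2 F : continuous F -> measurable_fun [set: T1 * T1] F.
Proof.
move=> cF; apply: (measurability (@RGenOInfty.G R) (@RGenOInfty.measurableE R)).
move=> _ [_ [x ->] <-]; rewrite setTI; apply: open_measurable2.
apply: open_comp; first by move=> z _; exact: cF.
exact: interval_open.
Qed.

Lemma compact_support_bounded (V : topologicalType) (F : V -> R) (K : set V) :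
  continuous F -> compact K ->
  (forall z, ~ K z -> F z = 0) -> exists M, forall z, `|F z| <= M.
Proof.
move=> cF cK F0.
have := compact_bounded (continuous_compact (continuous_subspaceT cF) cK).
move=> [M [_ HM]]; exists (Num.max 0 (M + 1)) => z.
have [Kz|Kz] := pselect (K z); last by rewrite F0// normr0 le_max lexx.
by rewrite le_max; apply/orP; right; apply: (HM (M + 1)); rewrite ?ltrDl//; exists z.
Qed.

Lemma smooth_gw2 : smooth (@gw2 R).
Proof. by apply: smoothM; [apply: smooth_fst|apply: smooth_snd]; exact: smooth_gw. Qed.

(** Dividing by the weight turns Lebesgue integrals of compactly supported
functions into Gaussian integrals of bounded functions, for which integrability
and Fubini are immediate because the measure is finite. *)
Lemma compact_support_div_gw2 F K : continuous F -> compact K ->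
  (forall z, ~ K z -> F z = 0) ->
  measurable_fun [set: T1 * T1] (fun z => F z / gw2 z) /\
  exists M, forall z, `|F z / gw2 z| <= M.
Proof.
move=> cF cK F0.
have cG : continuous (fun z => F z / gw2 z).
  move=> z; apply: cvgM; first exact: cF.
  by apply: cvgV; [rewrite gt_eqF// gw2_gt0|exact: (smooth_continuous smooth_gw2)].
split; first exact: continuous_measurable2.
by apply: (compact_support_bounded cG cK) => z /F0 ->; rewrite mul0r.
Qed.

Lemma compact_support_integrable F K : continuous F -> compact K ->
  (forall z, ~ K z -> F z = 0) -> (lebesgue2 R).-integrable setT (EFin \o F).
Proof.
move=> cF cK F0; have [mG [M HM]] := compact_support_div_gw2 cF cK F0.
have mT : measurable [set: T1 * T1] by [].
have := bounded_integrable mT (gauss2_fin mT) mG (fun z _ => HM z).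
move=> /integrableP[_ fin]; apply/integrableP; split.
  by apply/measurable_EFinP; exact: continuous_measurable2.
apply: le_lt_trans fin; rewrite ge0_integral_gauss2//; last first.
  by apply/measurable_EFinP; exact: measurableT_comp.
rewrite le_eqVlt; apply/orP; left; apply/eqP; apply: eq_integral => z _ /=.
rewrite -EFinM normrM normfV (gtr0_norm (gw2_gt0 z)) divfK//.
by rewrite gt_eqF// gw2_gt0.
Qed.

Lemma derive_out (V : normedModType R) (f : V -> R) (K : set V) z v : closed K ->
  (forall z, ~ K z -> f z = 0) -> ~ K z -> 'D_v f z = 0.
Proof.
move=> cK f0 Kz; rewrite (@near_eq_derive _ _ _ f (cst 0)) ?derive_cst//.
have : open_nbhs z (~` K) by split => //; exact: closed_openC.
by move/open_nbhs_nbhs; apply: filterS => y /= /f0.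
Qed.

Lemma compact_box (K : set (R * R)) : compact K ->
  exists M : R, forall x y, K (x, y) -> `|x| <= M /\ `|y| <= M.
Proof.
move=> cK; have [M [_ HM]] := compact_bounded cK.
exists (M + 1) => x y Kxy; have := HM (M + 1); rewrite ltrDl ltr01 => /(_ isT _ Kxy).
by rewrite /= prod_normE/= ge_max => /andP[].
Qed.

(** Fubini, in its Gaussian form, and the vanishing of the integral of the
derivative on each slice. *)
Lemma integral_derive_x psi K : smooth psi -> compact K ->
  (forall z, ~ K z -> psi z = 0) -> \int[lebesgue2 R]_z 'D_(1, 0) psi z = 0.
Proof.
move=> spsi cK psi0.
have clK : closed K by apply: compact_closed => //; exact: norm_hausdorff.
pose F := 'D_(1, 0) psi.
have sF : smooth F := smooth_derive _ spsi.
have F0 z : ~ K z -> F z = 0 by exact: derive_out.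
have [mG [M HM]] := compact_support_div_gw2 (smooth_continuous sF) cK F0.
have mT : measurable [set: T1 * T1] by [].
have IG := bounded_integrable mT (gauss2_fin mT) mG (fun z _ => HM z).
transitivity (\int[gauss2 R]_z (F z / gw2 z)).
  rewrite Rintegral_gauss2//; apply: eq_Rintegral => z _.
  by rewrite divfK// gt_eqF// gw2_gt0.
rewrite /Rintegral -integral21_prod_meas1//.
rewrite (_ : (\int[_]_x _ = 0)%E)//.
rewrite -[RHS](integral0 (gauss1 R) setT); apply: eq_integral => y _.
rewrite /fubini_G.
have mGy : measurable_fun [set: T1] (fun x => F (x, y) / gw2 (x, y)).
  exact: (measurableT_comp mG (pair2_measurable y)).
have mT1 : measurable [set: T1] by [].
have IGy := bounded_integrable mT1 (gauss1_fin mT1) mGy (fun x _ => HM (x, y)).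
rewrite -(fineK (integrable_fin_num mT1 IGy)); congr EFin.
transitivity (\int[gauss1 R]_x (F (x, y) / gw2 (x, y))) => //.
rewrite Rintegral_gauss1//.
have [N HN] := compact_box cK.
suff H : (\int[leb]_x (F (x, y) / gw2 (x, y) * gw x)%:E = 0)%E by rewrite /Rintegral H.
have gx0 (x : R) : gw x != 0 by rewrite gt_eqF// gw_gt0.
rewrite (_ : (fun x => _) = fun x => (F (x, y) * (gw y)^-1)%:E); last first.
  by apply/funext => x; congr EFin; rewrite /gw2/=; field; rewrite !gx0.
apply: (@integral_derive_compact _ (fun x => psi (x, y) * (gw y)^-1) _ N).
- move=> x; have h := is_derive1M (smooth_is_derive x (smooth_slice y spsi)) (is_derive1_cst x (gw y)^-1).
  by apply: (is_derive_eq h); rewrite /F derive_x mulr0 add0r mulrC.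
- apply: smooth_continuous; apply: smoothM; last exact: smooth_cst.
  exact: smooth_slice.
- move=> x Nx; rewrite psi0 ?mul0r// => /HN[h _].
  by move: Nx; rewrite ltNge h.
Qed.

Lemma integral_derive_y psi K : smooth psi -> compact K ->
  (forall z, ~ K z -> psi z = 0) -> \int[lebesgue2 R]_z 'D_(0, 1) psi z = 0.
Proof.
move=> spsi cK psi0.
have clK : closed K by apply: compact_closed => //; exact: norm_hausdorff.
pose F := 'D_(0, 1) psi.
have sF : smooth F := smooth_derive _ spsi.
have F0 z : ~ K z -> F z = 0 by exact: derive_out.
have [mG [M HM]] := compact_support_div_gw2 (smooth_continuous sF) cK F0.
have mT : measurable [set: T1 * T1] by [].
have IG := bounded_integrable mT (gauss2_fin mT) mG (fun z _ => HM z).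
transitivity (\int[gauss2 R]_z (F z / gw2 z)).
  rewrite Rintegral_gauss2//; apply: eq_Rintegral => z _.
  by rewrite divfK// gt_eqF// gw2_gt0.
rewrite /Rintegral -integral12_prod_meas1//.
rewrite (_ : (\int[_]_x _ = 0)%E)//.
rewrite -[RHS](integral0 (gauss1 R) setT); apply: eq_integral => x _.
rewrite /fubini_F.
have mGy : measurable_fun [set: T1] (fun y => F (x, y) / gw2 (x, y)).
  exact: (measurableT_comp mG (pair1_measurable x)).
have mT1 : measurable [set: T1] by [].
have IGy := bounded_integrable mT1 (gauss1_fin mT1) mGy (fun y _ => HM (x, y)).
rewrite -(fineK (integrable_fin_num mT1 IGy)); congr EFin.
transitivity (\int[gauss1 R]_y (F (x, y) / gw2 (x, y))) => //.
rewrite Rintegral_gauss1//.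
have [N HN] := compact_box cK.
suff H : (\int[leb]_y (F (x, y) / gw2 (x, y) * gw y)%:E = 0)%E by rewrite /Rintegral H.
have gx0 (t : R) : gw t != 0 by rewrite gt_eqF// gw_gt0.
rewrite (_ : (fun y => _) = fun y => (F (x, y) * (gw x)^-1)%:E); last first.
  by apply/funext => y; congr EFin; rewrite /gw2/=; field; rewrite !gx0.
apply: (@integral_derive_compact _ (fun y => psi (x, y) * (gw x)^-1) _ N).
- move=> y; have h := is_derive1M (smooth_is_derive y (smooth_slice2 x spsi)) (is_derive1_cst y (gw x)^-1).
  by apply: (is_derive_eq h); rewrite /F derive_y mulr0 add0r mulrC.
- apply: smooth_continuous; apply: smoothM; last exact: smooth_cst.
  exact: smooth_slice2.
- move=> y Ny; rewrite psi0 ?mul0r// => /HN[_ h].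
  by move: Ny; rewrite ltNge h.
Qed.

(** The product of [h z.2] and of a test function is a compactly supported
smooth function, so the integrals of its partial derivatives vanish. *)
Lemma weak_partial_snd (Omega : set (R * R)) (h : R -> R) : smooth h ->
  weak_partial Omega (1, 0) (fun z => h z.2) (fun=> 0) /\
  weak_partial Omega (0, 1) (fun z => h z.2) (fun z => 'D_1 h z.2).
Proof.
move=> sh; split => phi [sphi cK sK]; set K := closure _ in cK sK.
  have sphi' : smooth phi by [].
  have phi0 z : ~ K z -> phi z = 0.
    by move=> Kz; apply: contrapT => /eqP phiz; apply: Kz; exact: subset_closure.
  have cl : closed K by exact: closed_closure.
  under [X in _ = - X]eq_Rintegral do rewrite mul0r.
  rewrite [in RHS](_ : \int[_]_(_ in _) 0 = 0) ?oppr0; last first.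
    by rewrite /Rintegral integral0.
  rewrite Rintegral_out => [|z Oz]; last by rewrite (derive_out _ cl phi0) ?mulr0// => /sK.
  transitivity (\int[lebesgue2 R]_z 'D_(1, 0) (fun z => h z.2 * phi z) z); last first.
    apply: (integral_derive_x _ cK); first by apply: smoothM => //; exact: smooth_snd.
    by move=> z /phi0 ->; rewrite mulr0.
  apply: eq_Rintegral => -[x y] _; rewrite !derive_x/=.
  have [_ ->] := is_derive1Z (h y) (smooth_is_derive x (smooth_slice y sphi')).
  by [].
have sphi' : smooth phi by [].
have phi0 z : ~ K z -> phi z = 0.
  by move=> Kz; apply: contrapT => /eqP phiz; apply: Kz; exact: subset_closure.
have cl : closed K by exact: closed_closure.
rewrite Rintegral_out => [|z Oz]; last by rewrite (derive_out _ cl phi0) ?mulr0// => /sK.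
rewrite [X in _ = - X]Rintegral_out => [|z Oz]; last by rewrite phi0 ?mulr0// => /sK.
have sh2 : smooth (fun z : R * R => h z.2) by exact: smooth_snd.
have sh2' : smooth (fun z : R * R => 'D_1 h z.2) by exact: (@smooth_snd R ('D_1 h) (smooth_derive (1 : R) sh)).
have I1 : (lebesgue2 R).-integrable setT (EFin \o (fun z => h z.2 * 'D_(0, 1) phi z)).
  apply: (compact_support_integrable _ cK).
    by apply: smooth_continuous; apply: smoothM => //; exact: smooth_derive.
  by move=> z Kz; rewrite (derive_out _ cl phi0) ?mulr0.
have I2 : (lebesgue2 R).-integrable setT (EFin \o (fun z => 'D_1 h z.2 * phi z)).
  apply: (compact_support_integrable _ cK).
    by apply: smooth_continuous; exact: smoothM.
  by move=> z Kz; rewrite phi0 ?mulr0.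
apply/eqP; rewrite -addr_eq0; apply/eqP.
rewrite -(RintegralD _ I1 I2)//.
transitivity (\int[lebesgue2 R]_z 'D_(0, 1) (fun z => h z.2 * phi z) z); last first.
  apply: (integral_derive_y _ cK); first exact: smoothM.
  by move=> z /phi0 ->; rewrite mulr0.
apply: eq_Rintegral => -[x y] _; rewrite !derive_y/=.
have [_ ->] := is_derive1M (smooth_is_derive y sh) (smooth_is_derive y (smooth_slice2 x sphi')).
by rewrite [phi (x, y) * _]mulrC.
Qed.

End compact_support.

(** * The eigenvalue 1 of a strip *)

Section second_moment.
Variable R : realType.
Local Notation T1 := (measurableTypeR R).

Lemma gauss1_L2_id : L2 (gauss1 R) setT (fun y : R => y).
Proof.
have mid : measurable_fun [set: T1] (fun y : R => y) by exact: measurable_id.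
have mf2 : measurable_fun [set: T1] (fun y : R => (y ^+ 2)%:E).
  by apply/measurable_EFinP; exact: measurable_funX.
split => //; apply/integrableP; split => //.
under eq_integral do rewrite gee0_abs ?lee_fin ?sqr_ge0//.
rewrite ge0_integral_gauss1//; last by move=> x; rewrite lee_fin sqr_ge0.
(* As y^2/4 <= exp(y^2/4), the integrand y^2 exp(-y^2/2) is at most
4 exp(-y^2/4), a multiple of the normal density of variance 2. *)
pose s : R := Num.sqrt 2.
have s2 : s ^+ 2 = 2 by rewrite sqr_sqrtr.
have s0 : s != 0 by rewrite gt_eqF// sqrtr_gt0.
have ps0 : 0 < normal_peak s by exact: normal_peak_gt0.
have p10 : 0 < normal_peak (1 : R) by rewrite normal_peak_gt0 ?oner_neq0.
pose C := 4 * normal_peak 1 / normal_peak s.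
have C0 : 0 <= C by rewrite divr_ge0 ?mulr_ge0// ltW.
have mn : measurable_fun [set: T1] (fun x => (normal_pdf 0 s x)%:E).
  by apply/measurable_EFinP; exact: measurable_normal_pdf.
apply: (@le_lt_trans _ _ (\int[lebesgue_measure]_x (C%:E * (normal_pdf 0 s x)%:E))%E); last first.
  rewrite ge0_integralZl//.
  - by rewrite integral_normal_pdf mule1 ltry.
  - by move=> x _; rewrite lee_fin normal_pdf_ge0.
apply: ge0_le_integral => //.
- by move=> x _; rewrite -EFinM lee_fin mulr_ge0 ?sqr_ge0// ltW// gw_gt0.
- by apply: emeasurable_funM => //; apply/measurable_EFinP; exact: measurable_gw.
- by apply: measurable_funeM.
move=> x _; rewrite -!EFinM lee_fin gwE normal_pdfE// /normal_fun s2 subr0.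
rewrite (_ : - 2^-1 * x ^+ 2 = x ^+ 2 / - 4 + x ^+ 2 / - 4); last by field.
rewrite (_ : - x ^+ 2 / (2 *+ 2) = x ^+ 2 / - 4); last by field.
rewrite expRD /C.
have h : x ^+ 2 * expR (x ^+ 2 / - 4) <= 4.
  have := expR_ge1Dx (x ^+ 2 / 4); have -> : x ^+ 2 / -4 = - (x ^+ 2 / 4) by field.
  move=> h; rewrite expRN ler_pdivrMr ?expR_gt0//; lra.
have e0 := expR_gt0 (x ^+ 2 / - 4).
rewrite [leLHS](_ : _ = normal_peak 1 * (x ^+ 2 * expR (x ^+ 2 / - 4)) * expR (x ^+ 2 / - 4)); last by ring.
rewrite [leRHS](_ : _ = normal_peak 1 * 4 * expR (x ^+ 2 / - 4)); last by field; rewrite gt_eqF.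
by rewrite ler_pM2r// ler_pM2l.
Qed.

(** Rescaled bumps: both [eta n] and its derivative are uniformly bounded and
the derivative is of order 1/n, so that [dstar (eta n)] tends to [dstar 1],
which is y, with a linear bound. *)
Lemma wide_cutoffs : exists (eta : nat -> R -> R) (M : R), 0 <= M /\
  [/\ forall n, exists r, csmooth (- r) r (eta n),
      forall n y, `|eta n y| <= M, forall n y, `|dstar (eta n) y| <= M * `|y| + M,
      forall y, eta n y @[n --> \oo] --> (1 : R) &
      forall y, dstar (eta n) y @[n --> \oo] --> y].
Proof.
pose k := (itv_bump (- 1) 1 (0 : R))^-1.
(* Normalised so that [eta0 0 = 1], the limit of [eta0] at [y / n.+1]. *)
pose eta0 (x : R) := k * itv_bump (- 1) 1 x.
have k0 : 0 < itv_bump (- 1) 1 (0 : R) by apply: bump_gt0; rewrite ltrN10 ltr01.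
have eta00 : eta0 0 = 1 by rewrite /eta0 /k mulVf// gt_eqF.
have ceta0 : csmooth (- 1) 1 eta0.
  apply: csmoothZ; split; first exact: smooth_bump.
  by move=> x h; apply: bump_out; apply: contra h => /andP[/ltW -> /ltW ->].
have seta0 := csmooth_smooth ceta0.
have [M1 HM1] := csmooth_bounded ceta0.
have [M2 HM2] := csmooth_bounded (csmooth_derive ceta0).
have M10 : 0 <= M1 := le_trans (normr_ge0 _) (HM1 0).
have M20 : 0 <= M2 := le_trans (normr_ge0 _) (HM2 0).
pose eta n (x : R) := eta0 (n.+1%:R^-1 * x).
have n0 n : 0 < n.+1%:R^-1 :> R by rewrite invr_gt0.
have n1 n : n.+1%:R^-1 <= 1 :> R by rewrite invf_le1// ler1n.
have D n y : 'D_1 (eta n) y = n.+1%:R^-1 * 'D_1 eta0 (n.+1%:R^-1 * y).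
  have h := is_derive1o (smooth_is_derive (n.+1%:R^-1 * y) seta0) (is_derive1Z n.+1%:R^-1 (is_derive1_id y)).
  by have [_ ->] := h; rewrite mulr1.
have cs y : n.+1%:R^-1 * y @[n --> \oo] --> (0 : R).
  by rewrite -[X in _ --> X](mul0r y); apply: cvgM; [exact: cvg_harmonic|exact: cvg_cst].
have ceta y : eta n y @[n --> \oo] --> (1 : R).
  rewrite -eta00; apply: (@cvg_comp _ _ _ (fun n => n.+1%:R^-1 * y) eta0 _ (nbhs (0 : R))); first exact: cs.
  exact: (smooth_continuous seta0).
exists eta, (M1 + M2); split; first exact: addr_ge0.
split => //.
- move=> n; exists n.+1%:R; split; first exact: smooth_scale.
  move=> x h; apply: (csmooth_out ceta0); apply: contra h => /andP[h1 h2].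
  apply/andP; split.
    by move: h1; rewrite mulrC ler_pdivlMr// mulN1r.
  by move: h2; rewrite mulrC ler_pdivrMr// mul1r.
- by move=> n y; rewrite (le_trans (HM1 _))// lerDl.
- move=> n y; rewrite /dstar D (le_trans (ler_normB _ _))// lerD//.
    by rewrite normrM mulrC ler_wpM2r// (le_trans (HM1 _))// lerDl.
  rewrite normrM (ger0_norm (ltW (n0 n))); apply: (@le_trans _ _ (1 * M2)); last by rewrite mul1r lerDr.
  by rewrite ler_pM// ltW.
- move=> y; rewrite /dstar; under eq_fun do rewrite D.
  suff : y * eta n y - n.+1%:R^-1 * 'D_1 eta0 (n.+1%:R^-1 * y) @[n --> \oo] --> y * 1 - 0.
    by rewrite mulr1 subr0.
  apply: cvgB; first by apply: cvgM; [exact: cvg_cst|exact: ceta].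
  rewrite -[X in _ --> X](mul0r ('D_1 eta0 0)); apply: cvgM; first exact: cvg_harmonic.
  apply: (@cvg_comp _ _ _ (fun n => n.+1%:R^-1 * y) ('D_1 eta0) _ (nbhs (0 : R))); first exact: cs.
  exact: (smooth_continuous (smooth_derive (1 : R) seta0)).
Qed.

End second_moment.

Section strip.
Variable R : realType.
Local Notation T1 := (measurableTypeR R).
Variable a : \bar R.
Hypothesis a0 : (0 < a)%E.
Local Notation I := (sym_itv a).
Local Notation S := (strip a).
Let mI := sym_itv_measurable a0.

Lemma stripE : S = I `*` [set: R].
Proof. by apply/seteqP; split => z //= -[]. Qed.

Lemma strip_open : open S.
Proof.
apply: (@open_comp _ _ (fst : R * R -> R) I); last exact: sym_itv_open.
by move=> z _; exact: cvg_fst.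
Qed.

Lemma strip_measurable : measurable (S : set (T1 * T1)).
Proof. exact: open_measurable2 strip_open. Qed.

Let mS := strip_measurable.

Lemma L2_strip_snd (g : R -> R) : L2 (gauss1 R) setT g -> L2 (gauss2 R) S (fun z => g z.2).
Proof.
move=> hg; have := L2_tensor mI (L2_cst 1 mI) hg; rewrite -stripE.
by under eq_fun do rewrite mul1r.
Qed.

Lemma nsq_strip_snd (g : R -> R) : L2 (gauss1 R) setT g ->
  \int[gauss2 R]_(z in S) (g z.2 ^+ 2) =
  \int[gauss1 R]_(x in I) 1 * \int[gauss1 R]_y (g y ^+ 2).
Proof.
move=> hg; rewrite stripE; have := nsq_tensor mI (L2_cst 1 mI) hg.
under eq_Rintegral do rewrite mul1r.
by under [X in _ = X * _ -> _]eq_Rintegral do rewrite expr1n.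
Qed.

Lemma H1_strip_snd (h : R -> R) : smooth h -> L2 (gauss1 R) setT h ->
  L2 (gauss1 R) setT ('D_1 h) -> H1 S (fun z => h z.2) (fun=> 0) (fun z => 'D_1 h z.2).
Proof.
move=> sh hh hh'; have [wx wy] := weak_partial_snd S sh; split => //.
- exact: L2_strip_snd.
- split; last exact: (@L2_strip_snd ('D_1 h) hh').
  by apply: (@L2_strip_snd (fun=> 0)); exact: L2_cst.
Qed.

(** Integration by parts against the cutoffs of both variables, then dominated
convergence: formally, y is [dstar 1] in the second variable. *)
Lemma strip_ipy phi phiy : L2 (gauss2 R) S phi -> L2 (gauss2 R) S phiy ->
  weak_partial S (0, 1) phi phiy ->
  \int[gauss2 R]_(z in S) phiy z = \int[gauss2 R]_(z in S) (z.2 * phi z).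
Proof.
move=> hphi hphiy wphi.
have [chi [hchi chi01 cchi]] := cutoffs a0.
have [eta [M [M0 [heta etaM detaM ceta cdeta]]]] := wide_cutoffs R.
have mT : measurable [set: T1] by [].
have hL2 n : L2 (gauss2 R) S (fun z => chi n z.1 * eta n z.2).
  by rewrite stripE; apply: (L2_tensor mI); [exact: (itest_L2 mI)|have [r hr] := heta n; exact: csmooth_L2 hr].
have hL2' n : L2 (gauss2 R) S (fun z => chi n z.1 * dstar (eta n) z.2).
  by rewrite stripE; apply: (L2_tensor mI); [exact: (itest_L2 mI)|have [r hr] := heta n; exact: (csmooth_L2 mT (csmooth_dstar hr))].
have hid := gauss1_L2_id R.
have habs : L2 (gauss1 R) setT (fun y => M * `|y| + M).
  apply: (L2D mT); last exact: L2_cst.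
  apply: (L2Z mT).
  have [mid Iid] := hid; split.
    move: mid => H; exact: (measurableT_comp (@normr_measurable R setT) H).
  by apply: eq_integrable Iid => // y _; rewrite real_normK ?num_real.
have E n : \int[gauss2 R]_(z in S) (phi z * (chi n z.1 * dstar (eta n) z.2)) =
           \int[gauss2 R]_(z in S) (phiy z * (chi n z.1 * eta n z.2)).
  have [r [rI hr]] := hchi n; have [s hs] := heta n.
  apply: (weak_dstar2 mS wphi hphi hphiy hr hs) => x y xr _.
  by apply: rI; rewrite ler_norml.
have chi1 n x : `|chi n x| <= 1 by have /andP[h0 h1] := chi01 n x; rewrite ger0_norm.
have C1 := cvg_ip_L2 mS hphi (L2_strip_snd habs) hL2' (L2_strip_snd hid).
have C2 := cvg_ip_L2 mS hphiy (L2_strip_snd (L2_cst M mT)) hL2 (L2_strip_snd (L2_cst 1 mT)).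
have {}C1 : \int[gauss2 R]_(z in S) (phi z * (chi n z.1 * dstar (eta n) z.2)) @[n --> \oo]
    --> \int[gauss2 R]_(z in S) (phi z * z.2).
  apply: C1 => [n z _|z Sz].
    by rewrite -[leRHS]mul1r normrM ler_pM.
  by rewrite -[X in _ --> X]mul1r; apply: cvgM; [exact: cchi|exact: cdeta].
have {}C2 : \int[gauss2 R]_(z in S) (phiy z * (chi n z.1 * eta n z.2)) @[n --> \oo]
    --> \int[gauss2 R]_(z in S) (phiy z * 1).
  apply: C2 => [n z _|z Sz].
    by rewrite -[leRHS]mul1r normrM ler_pM.
  by rewrite -[X in _ --> X]mul1r; apply: cvgM; [exact: cchi|exact: ceta].
rewrite (_ : (fun n => _) = fun n => \int[gauss2 R]_(z in S) (phiy z * (chi n z.1 * eta n z.2))) in C1; last first.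
  by apply/funext => n; exact: E.
have := cvg_unique _ C2 C1; under eq_Rintegral do rewrite mulr1.
move=> ->//; by apply: eq_Rintegral => z _; rewrite mulrC.
Qed.

(** The function y is not almost everywhere zero: testing the equation with y
itself equates its square norm with the positive measure of the strip. *)
Lemma strip_eigenvalue1 : neumann_eigenvalue S 1.
Proof.
have mT : measurable [set: T1] by [].
have D1 : 'D_1 (fun y : R => y) = fun=> 1.
  by apply/funext => y; have [_ ->] := is_derive1_id y.
have hid := gauss1_L2_id R.
have h1 : H1 S (fun z => z.2) (fun=> 0) (fun=> 1).
  have hD : L2 (gauss1 R) setT ('D_1 (fun y : R => y)) by rewrite D1; exact: L2_cst.
  rewrite (_ : (fun=> 1) = fun z : R * R => 'D_1 (fun y : R => y) z.2); last first.
    by apply/funext => z; have [_ ->] := is_derive1_id z.2.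
  exact: (@H1_strip_snd (fun y : R => y) (@smooth_id R) hid hD).
have eig phi phix phiy : H1 S phi phix phiy ->
    \int[gauss2 R]_(z in S) (0 * phix z + 1 * phiy z) =
    1 * \int[gauss2 R]_(z in S) (z.2 * phi z).
  move=> [hphi [_ hphiy] _ wphi]; rewrite mul1r -(strip_ipy hphi hphiy wphi).
  by apply: eq_Rintegral => z _; rewrite mul0r mul1r add0r.
exists (fun z => z.2), (fun=> 0), (fun=> 1); split => //.
move=> y0; have := eig _ _ _ h1.
under eq_Rintegral do rewrite mul0r add0r mul1r.
rewrite mul1r; under [RHS]eq_Rintegral do rewrite -expr2.
have G0 := gauss1_sym_itv_gt0 a0.
have -> : \int[gauss2 R]_(z in S) 1 = \int[gauss1 R]_(x in I) 1.
  have := nsq_strip_snd (L2_cst 1 mT); under eq_Rintegral do rewrite expr1n.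
  move=> ->; under [X in _ * X]eq_Rintegral do rewrite expr1n.
  rewrite [X in _ * X](_ : _ = 1) ?mulr1//.
  exact: gauss1_one.
move=> G1; move: G0; rewrite G1 [X in _ < X](_ : _ = 0) ?ltxx//.
rewrite /Rintegral (_ : (\int[_]_(_ in _) _)%E = 0%E)//.
rewrite -[RHS](integral0 (gauss2 R) S); apply: ae_eq_integral => //.
  by apply/measurable_EFinP; apply: measurable_funX; have [[]] := h1.
by move: y0; apply: negligibleS => z /= nQ K; apply: nQ => Sz; rewrite K// expr0n.
Qed.

End strip.

(** * The spectral gap of a strip *)

Section least_element.
Variable R : realType.
Implicit Types (A : set R) (m : R).

Lemma least_elementE A m :
  A m -> lbound A m -> least_element A = m%:E.
Proof.
move=> Am lm; rewrite /least_element.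
rewrite (_ : A `&` lbound A = [set m]) ?image_set1 ?ereal_inf1//.
apply/seteqP; split => [x [Ax lx]|_ ->//]; apply/eqP.
by rewrite eq_le (lx _ Am) (lm _ Ax).
Qed.

Lemma least_elementP A : least_element A = +oo%E \/
  exists2 m, A m & least_element A = m%:E.
Proof.
have [[m [Am lm]]|A0] := pselect (exists m, (A `&` lbound A) m).
  by right; exists m => //; exact: least_elementE.
left; rewrite /least_element (_ : A `&` lbound A = set0) ?image_set0 ?ereal_inf0//.
by apply/seteqP; split => // m Hm; apply: A0; exists m.
Qed.

End least_element.

Section strip_gap.
Variable R : realType.
Local Notation T1 := (measurableTypeR R).
Variable a : \bar R.
Hypothesis a0 : (0 < a)%E.
Local Notation I := (sym_itv a).
Local Notation S := (strip a).
Let mI := sym_itv_measurable a0.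
Let mS := strip_measurable a0.
Let mT : measurable [set: T1]. Proof. by []. Qed.

Local Notation range1 := (fun g => exists2 phi, tens S phi & g = dstar1 phi).
Local Notation range2 := (fun g => exists chi psi, [/\ itest I chi,
  itest [set: R] psi & g = fun z => chi z.1 * dstar psi z.2]).

Lemma itest_csmooth (b c : R) f : I b -> I c -> csmooth b c f -> itest I f.
Proof.
move=> Ib Ic hf; exists (Num.max `|b| `|c|); split; last first.
  apply: csmooth_widen hf.
    by rewrite lerNl le_max -normrN ler_norm.
  by rewrite le_max ler_norm orbT.
move: Ib Ic; have [[r r0 [_ ->]]|[_ ->]//] := sym_itvP a0.
rewrite /= !in_itv/= -!ltr_norml => br cr x; rewrite in_itv/= -ltr_norml.
by rewrite le_max => /orP[] /le_lt_trans; apply.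
Qed.

Lemma range1D f g : range1 f -> range1 g -> range1 (fun z => f z + g z).
Proof.
move=> [phi hphi ->] [psi hpsi ->]; exists (fun z => phi z + psi z); first exact: tensD.
apply/funext => -[x y]; rewrite !dstar1E dstarD//.
  exact: smooth_slice (tens_smooth hphi).
exact: smooth_slice (tens_smooth hpsi).
Qed.

(** [b] is the mean of [v] over the horizontal slices.  For a tensor al(x)
be(y) it is a multiple k of [be], and al - k is in the closure of the range of
[dstar] since its mean is zero. *)
Lemma strip_decomposition v : tens S v -> exists (b : R -> R) (r : R),
  [/\ csmooth (- r) r b,
      L2_closure (gauss2 R) S range1 (fun z => v z - b z.2) &
      forall g, L2 (gauss1 R) setT g -> \int[gauss2 R]_(z in S) (g z.2 * (v z - b z.2)) = 0].
Proof.
elim=> [|psi b c d e al be hpsi [B [r [hB clB ortB]]] hal hbe hO].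
  exists (fun=> 0), 0; split; first exact: csmooth0.
    apply: L2_closure_incl => //.
      exists (fun=> 0); first exact: tens0.
      apply/funext => -[x y]; rewrite dstar1E /dstar derive_cst; ring.
    by apply: (L2_strip_snd a0 (g := fun=> 0 - 0)); exact: L2_cst.
  by move=> g _; under eq_Rintegral do rewrite subrr mulr0; rewrite Rintegral_cst// mul0r.
have [bc|cb] := leP b c; last first.
  have E z : psi z + al z.1 * be z.2 = psi z by rewrite (csmooth_empty _ cb hal) mul0r addr0.
  exists B, r; split => [//||g hg].
    by rewrite (_ : (fun z => _) = fun z => psi z - B z.2)//; apply/funext => z; rewrite E.
  by rewrite -[RHS](ortB g hg); apply: eq_Rintegral => z _; rewrite E.
have [de|ed] := leP d e; last first.
  have E z : psi z + al z.1 * be z.2 = psi z by rewrite (csmooth_empty _ ed hbe) mulr0 addr0.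
  exists B, r; split => [//||g hg].
    by rewrite (_ : (fun z => _) = fun z => psi z - B z.2)//; apply/funext => z; rewrite E.
  by rewrite -[RHS](ortB g hg); apply: eq_Rintegral => z _; rewrite E.
have tal : itest I al.
  by apply: (@itest_csmooth b c) => //; [have := hO b d|have := hO c d]; apply; rewrite ?lexx ?bc ?de.
pose k := (\int[gauss1 R]_(x in I) al x) / \int[gauss1 R]_(x in I) 1.
have hbe2 : L2 (gauss1 R) setT be := csmooth_L2 mT hbe.
have hal2 : L2 (gauss1 R) I (fun x => al x - k).
  by apply: (L2B mI); [exact: (itest_L2 mI tal)|exact: L2_cst].
have hab : L2 (gauss2 R) S (fun z => (al z.1 - k) * be z.2).
  by rewrite stripE; exact: (L2_tensor mI hal2).
pose r' := Num.max r (Num.max `|d| `|e|).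
exists (fun y => B y + k * be y), r'; split.
- apply: csmoothD.
    by apply: csmooth_widen hB; rewrite /r' ?lerN2 le_max lexx.
  apply: csmoothZ; apply: csmooth_widen hbe.
    by rewrite lerNl /r' !le_max -normrN ler_norm orbT.
  by rewrite /r' !le_max ler_norm !orbT.
- rewrite (_ : (fun z => _) = fun z => (psi z - B z.2) + (al z.1 - k) * be z.2); last first.
    by apply/funext => z; ring.
  apply: (L2_closureD mS range1D clB).
  have clbe : L2_closure (gauss1 R) setT (fun f => f = be) be by exact: L2_closure_incl.
  rewrite [X in L2_closure _ X]stripE.
  apply: (closure_tensor mI _ (mean_zero_closure a0 tal) clbe).
  move=> _ _ [A [s [sI hA]] ->] ->; exists (fun z => A z.1 * be z.2).
    by apply: (tens1 hA hbe) => x y xs _; apply: sI; rewrite ler_norml.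
  apply/funext => -[x y]; rewrite dstar1E /= dstarZ//; exact: csmooth_smooth hA.
- move=> g hg.
  have hg2 := L2_strip_snd a0 hg.
  rewrite (_ : \int[_]_(_ in _) _ = \int[gauss2 R]_(z in S) (g z.2 * ((psi z - B z.2) + (al z.1 - k) * be z.2))); last first.
    by apply: eq_Rintegral => z _; ring.
  rewrite (ipDr mS hg2)//; last by case: clB.
  rewrite (ortB g hg) add0r.
  rewrite (_ : \int[_]_(_ in _) _ = \int[gauss2 R]_(z in I `*` [set: R]) ((al z.1 - k) * (g z.2 * be z.2))); last first.
    by rewrite stripE; apply: eq_Rintegral => z _; ring.
  have Ial : (gauss1 R).-integrable I (EFin \o (fun x => al x - k)).
    exact: (integrableB mI (itest_integrable mI tal) (integrable_cst1 k mI)).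
  rewrite (Rintegral_tensor mI Ial (L2_integrableM mT hg hbe2)).
  rewrite (RintegralB mI (itest_integrable mI tal) (integrable_cst1 k mI)).
  have -> : \int[gauss1 R]_(x in I) k = k * \int[gauss1 R]_(x in I) 1.
    rewrite -(RintegralZl k mI (integrable_cst1 1 mI)).
    by apply: eq_Rintegral => x _; rewrite mulr1.
  by rewrite /k divfK ?subrr ?mul0r// gt_eqF// gauss1_sym_itv_gt0.
Qed.

(** On the range of [dstar1] the derivative is moved to [u], and [phi] is not
larger than [dstar1 phi] in norm; the closure inherits the estimate. *)
Lemma range1_bound u ux f : L2 (gauss2 R) S u -> L2 (gauss2 R) S ux ->
  weak_partial S (1, 0) u ux -> L2_closure (gauss2 R) S range1 f ->
  (\int[gauss2 R]_(z in S) (u z * f z)) ^+ 2 <=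
  \int[gauss2 R]_(z in S) (ux z ^+ 2) * \int[gauss2 R]_(z in S) (f z ^+ 2).
Proof.
move=> hu hux wx; apply: (L2_closure_bound mS (nsq_ge0 _ _ _) hu).
move=> _ [phi hphi ->] _; rewrite (weak_dstar1 mS wx hu hux hphi).
apply: (le_trans (cauchy_schwarz mS hux (tens_L2 mS hphi))).
apply: ler_wpM2l; first exact: nsq_ge0.
have O1 : \int[gauss2 R]_(z in S) (phi z ^+ 2) = \int[gauss2 R]_z (phi z ^+ 2).
  by apply: Rintegral_out => z Oz; rewrite (tens_out hphi Oz) expr0n.
have O2 : \int[gauss2 R]_(z in S) (dstar1 phi z ^+ 2) = \int[gauss2 R]_z (dstar1 phi z ^+ 2).
  by apply: Rintegral_out => z Oz; rewrite (tens_out (tens_dstar1 hphi) Oz) expr0n.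
rewrite O1 O2 -[leLHS]mul1r.
apply: (@slice_inequality _ S I) => //.
by move=> f0 M _ hf0; rewrite mul1r (nsq_dstar hf0) lerDl nsq_ge0.
Qed.

Lemma range2_bound u uy f : L2 (gauss2 R) S u -> L2 (gauss2 R) S uy ->
  weak_partial S (0, 1) u uy -> L2_closure (gauss2 R) S range2 f ->
  (\int[gauss2 R]_(z in S) (u z * f z)) ^+ 2 <=
  \int[gauss2 R]_(z in S) (uy z ^+ 2) * \int[gauss2 R]_(z in S) (f z ^+ 2).
Proof.
move=> hu huy wy; apply: (L2_closure_bound mS (nsq_ge0 _ _ _) hu).
move=> _ [chi [psi [tchi tpsi ->]]] _.
have [r [rI hchi]] := tchi; have [s [_ hpsi]] := tpsi.
have hO x y : - r <= x <= r -> - s <= y <= s -> S (x, y).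
  by move=> xr _; apply: rI; rewrite ler_norml.
rewrite (weak_dstar2 mS wy hu huy hchi hpsi hO).
have hcp := tens_L2 mS (tens1 hchi hpsi hO).
apply: (le_trans (cauchy_schwarz mS huy hcp)).
apply: ler_wpM2l; first exact: nsq_ge0.
have h2 := itest_L2 mI tchi.
rewrite stripE (nsq_tensor mI h2 (itest_L2 mT tpsi)) (nsq_tensor mI h2 (itest_L2 mT (itest_dstar tpsi))).
by apply: ler_wpM2l; [exact: nsq_ge0|exact: itest_nsq_le_dstar tpsi].
Qed.

(** [mean_zero_closure] on the whole line, for the second variable, tensored
with cutoffs which tend to 1 on [I]. *)
Lemma centered_closure (b : R -> R) (r : R) : csmooth (- r) r b ->
  L2_closure (gauss2 R) S range2 (fun z => b z.2 - \int[gauss1 R]_y b y).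
Proof.
move=> hb.
have oo0 : (0 < +oo :> \bar R)%E by rewrite ltry.
have [[s _ [//]]|[_ Ioo]] := sym_itvP oo0.
have tb : itest (sym_itv (+oo%E : \bar R)) b by exists r; split => //; rewrite Ioo.
have := mean_zero_closure oo0 tb; rewrite Ioo gauss1_one divr1 => clb.
rewrite (_ : (fun z => _) = fun z : R * R => 1 * (b z.2 - \int[gauss1 R]_y b y)); last first.
  by apply/funext => z; rewrite mul1r.
rewrite [X in L2_closure _ X]stripE.
apply: (closure_tensor mI _ (one_closure a0) clb).
by move=> al _ tal [A hA ->]; exists al, A.
Qed.

(** The three terms of v = P + Q + c are orthogonal and [u] is orthogonal to
constants, so the bounds on <u, P> and <u, Q> add up by Pythagoras. *)
Lemma strip_bound u ux uy v :
  L2 (gauss2 R) S u -> L2 (gauss2 R) S ux -> L2 (gauss2 R) S uy ->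
  weak_partial S (1, 0) u ux -> weak_partial S (0, 1) u uy ->
  \int[gauss2 R]_(z in S) u z = 0 -> tens S v ->
  (\int[gauss2 R]_(z in S) (u z * v z)) ^+ 2 <=
  (\int[gauss2 R]_(z in S) (ux z ^+ 2) + \int[gauss2 R]_(z in S) (uy z ^+ 2)) *
  \int[gauss2 R]_(z in S) (v z ^+ 2).
Proof.
move=> hu hux huy wx wy u0 hv.
have [b [r [hb clP ort]]] := strip_decomposition hv.
have clQ := centered_closure hb.
set c := \int[gauss1 R]_y b y in clQ.
have hb2 : L2 (gauss1 R) setT b := csmooth_L2 mT hb.
pose P z := v z - b z.2; pose Q (z : R * R) := b z.2 - c.
have hP : L2 (gauss2 R) S P by case: clP.
have hQ : L2 (gauss2 R) S Q by case: clQ.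
have hc : L2 (gauss2 R) S (fun=> c) := L2_strip_snd a0 (L2_cst c mT).
have BP := range1_bound hu hux wx clP; have BQ := range2_bound hu huy wy clQ.
rewrite -/P -/Q in BP BQ.
have PQc : v = fun z => P z + (Q z + c) by apply/funext => z; rewrite /P /Q; ring.
have hQc : L2 (gauss2 R) S (fun z => Q z + c) := L2D mS hQ hc.
have Euv : \int[gauss2 R]_(z in S) (u z * v z) =
    \int[gauss2 R]_(z in S) (u z * P z) + \int[gauss2 R]_(z in S) (u z * Q z).
  rewrite [in LHS]PQc (ipDr mS hu hP hQc) (ipDr mS hu hQ hc).
  rewrite [X in _ + (_ + X)](_ : _ = 0) ?addr0//.
  have hone : L2 (gauss2 R) S (fun=> 1) := L2_strip_snd a0 (L2_cst 1 mT).
  have := ipZr mS c hu hone; under eq_Rintegral do rewrite mulr1.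
  by move=> ->; under eq_Rintegral do rewrite mulr1; rewrite u0 mulr0.
have Evv : \int[gauss2 R]_(z in S) (P z ^+ 2) + \int[gauss2 R]_(z in S) (Q z ^+ 2) <=
    \int[gauss2 R]_(z in S) (v z ^+ 2).
  rewrite [leRHS](_ : _ = \int[gauss2 R]_(z in S) (P z + (Q z + c)) ^+ 2); last first.
    by apply: eq_Rintegral => z _; rewrite {1}PQc.
  rewrite (nsqD mS hP hQc) (nsqD mS hQ hc).
  have -> : \int[gauss2 R]_(z in S) (P z * (Q z + c)) = 0.
    rewrite -(ort b hb2); apply: eq_Rintegral => z _.
    by rewrite mulrC /P /Q subrK.
  have -> : \int[gauss2 R]_(z in S) (Q z * c) = 0.
    transitivity (\int[gauss2 R]_(z in I `*` [set: R]) (c * (b z.2 - c))).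
      by rewrite stripE; apply: eq_Rintegral => z _; rewrite mulrC.
    have Ib : (gauss1 R).-integrable setT (EFin \o (fun y => b y - c)).
      exact: (integrableB mT (csmooth_integrable mT hb) (integrable_cst1 c mT)).
    rewrite (Rintegral_tensor mI (integrable_cst1 c mI) Ib).
    rewrite (RintegralB mT (csmooth_integrable mT hb) (integrable_cst1 c mT)) -/c.
    by rewrite [X in c - X]Rintegral_cst// [fine _]gauss1_setT mulr1 subrr mulr0.
  have := nsq_ge0 (gauss2 R) S (fun=> c); lra.
rewrite Euv; apply: le_trans; last first.
  by apply: (ler_wpM2l _ Evv); rewrite addr_ge0// nsq_ge0.
move: BP BQ; set p := \int[_]_(_ in _) _; set q := \int[_]_(_ in _) (_ * Q _).
have := nsq_ge0 (gauss2 R) S ux; have := nsq_ge0 (gauss2 R) S uy.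
have := nsq_ge0 (gauss2 R) S P; have := nsq_ge0 (gauss2 R) S Q.
move: (\int[_]_(_ in _) (ux _ ^+ 2)) (\int[_]_(_ in _) (uy _ ^+ 2)) => X Y.
move: (\int[_]_(_ in _) (P _ ^+ 2)) (\int[_]_(_ in _) (Q _ ^+ 2)) => A B.
move=> B0 A0 Y0 X0 pXA qYB.
(* The Cauchy-Schwarz inequality in the plane, by the arithmetic-geometric mean
inequality for [X * B] and [Y * A]. *)
have pq : `|p * q| <= (X * B + Y * A) / 2.
  rewrite -ler_sqr ?nnegrE; [|by []|by rewrite divr_ge0// addr_ge0// mulr_ge0].
  rewrite real_normK ?num_real// exprMn; apply: (le_trans (ler_pM _ _ pXA qYB)); rewrite ?sqr_ge0//.
  have := sqr_ge0 (X * B - Y * A); nra.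
have := ler_norm (p * q); lra.
Qed.

(** Testing with 1 shows that [u] has mean zero, since [m] is not zero; testing
with [u] relates |grad u|^2 to |u|^2. *)
Lemma strip_eigenvalue_ge1 (m : R) : 0 < m -> neumann_eigenvalue S m -> 1 <= m.
Proof.
move=> m0 [u [ux [uy [[hu [hux huy] wx wy] u0 eig]]]].
have h1 : H1 S (fun=> 1) (fun=> 0) (fun=> 0).
  rewrite [X in H1 _ _ _ X](_ : _ = fun z : R * R => 'D_1 (fun _ : R => 1 : R) z.2); last first.
    by apply/funext => z; rewrite derive_cst.
  apply: (@H1_strip_snd _ _ a0 (fun=> 1)); [exact: smooth_cst|exact: L2_cst|].
  rewrite (_ : 'D_(1 : R) (fun _ : R => 1 : R) = fun=> 0); first exact: L2_cst.
  by apply/funext => z; rewrite derive_cst.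
have Iu : \int[gauss2 R]_(z in S) u z = 0.
  have := eig _ _ _ h1; under eq_Rintegral do rewrite !mulr0 addr0.
  under [X in _ = _ * X]eq_Rintegral do rewrite mulr1.
  by rewrite Rintegral_cst// mul0r => /esym/eqP; rewrite mulf_eq0 gt_eqF//= => /eqP.
have E := eig _ _ _ (And4 hu (conj hux huy) wx wy).
have [_ Iux] := hux; have [_ Iuy] := huy.
have E2 : \int[gauss2 R]_(z in S) (ux z ^+ 2) + \int[gauss2 R]_(z in S) (uy z ^+ 2) =
    m * \int[gauss2 R]_(z in S) (u z ^+ 2).
  by rewrite -(RintegralD mS Iux Iuy); exact: E.
have U0 : 0 <= \int[gauss2 R]_(z in S) (u z ^+ 2) by exact: nsq_ge0.
have [U1|U1] := eqVneq (\int[gauss2 R]_(z in S) (u z ^+ 2)) 0.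
  by exfalso; apply: u0; exact: L2_ae0 U1.
have Up : 0 < \int[gauss2 R]_(z in S) (u z ^+ 2) by rewrite lt_neqAle eq_sym U1.
have K0 : 0 <= m * \int[gauss2 R]_(z in S) (u z ^+ 2) by rewrite mulr_ge0// ltW.
have := L2_closure_bound mS K0 hu _ (tens_dense (strip_open a0) hu).
rewrite -[X in X ^+ 2]/(\int[gauss2 R]_(z in S) (u z ^+ 2)).
move=> H; have := H _; rewrite expr2 ler_pM2r// -[X in X <= _]mul1r ler_pM2r//; apply.
by move=> v hv _; rewrite -E2; exact: strip_bound.
Qed.

Lemma mu1_strip : mu1 S = 1%E.
Proof.
apply: least_elementE; first by split => //; exact: strip_eigenvalue1.
by move=> m [m0 hm]; exact: strip_eigenvalue_ge1.
Qed.

End strip_gap.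

(** * The comparison theorem *)

Section admissible.
Variable R : realType.
Implicit Types (Omega : set (R * R)) (a : \bar R).

Lemma admissible_domain Omega a :
  bounded_assumptions Omega a \/ unbounded_assumptions Omega a ->
  [/\ (0 < a)%E, open Omega, symmetric_wrt_y_axis Omega,
      forall x y x', Omega (x, y) -> `|x'| <= `|x| -> Omega (x', y) &
      forall z, Omega z -> sym_itv a z.1].
Proof.
case=> [[[oO _ _] cO _ sO [/andP[a0 _] [p [q [_ _ _ _ OE]]]]]|].
  by split => //; [exact: convex_fiber|rewrite OE => z []].
move=> [[[oO _ _] _] cO _ [sO _] [a0 [p [_ _ _ OE]]]].
by split => //; [exact: convex_fiber|rewrite OE => z []].
Qed.

End admissible.

Theorem proposition3p1 (R : realType) (Omega : set (R * R)%type) (a : \bar R)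
    (hOmega : bounded_assumptions Omega a \/ unbounded_assumptions Omega a)
    (hmu : mu1 Omega = mu1_odd Omega) :
  [/\ (mu1 (strip a) = 1)%E,
      (mu1 Omega - mu1 (strip a) = mu1 Omega - 1)%E &
      (lambda1 a <= mu1 Omega - 1)%E].
Proof.
have [a0 oO sO fO OI] := admissible_domain hOmega.
split; rewrite ?(mu1_strip a0)//.
rewrite hmu /mu1_odd; have [->|[m [u eig odd] ->]] := least_elementP
  [set m | exists2 u, neumann_eigenpair Omega m u & odd_wrt_y_axis Omega u].
  by rewrite leey.
by rewrite -EFinB; exact: odd_eigenvalue_bound eig odd.
Qed.
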